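(* Let $(M,\Delta,g)$ be a contact sub-Riemannian manifold of dimension $2n+1$, $q_0\in M$, with the structure at $q_0$ in Agrachev–Gauthier normal form. For all $T,R>0$, normal extremals with initial covector $(h(0),\eta^{-1})$ have the following order 2 expansion at time $\eta\tau$, as $\eta\to0^+$, uniformly with respect to $\tau\in[0,T]$ and $h(0)\in B_R$. In normal form coordinates, denote $$e^{\eta\tau\vec H}\big((0,0),(h(0),\eta^{-1})\big)=\big((x(\tau),z(\tau)),(h(\tau),\eta^{-1}w(\tau)^{-1})\big).$$ Then $$x(\tau)=\eta\,\hat x(\tau,h(0))+\eta^2\int_0^\tau\!\int_0^\sigma e^{(\sigma-\rho)\bar J}J^{(1)}\big(\hat x(\rho,h(0))\big)\hat h(\rho,h(0))\,d\rho\,d\sigma+O(\eta^3),$$ $$z(\tau)=\eta^2\hat z(\tau,h(0))+O(\eta^3),$$ and $$h(\tau)=\hat h(\tau,h(0))+\eta\int_0^\tau e^{(\tau-\sigma)\bar J}J^{(1)}\big(\hat x(\sigma,h(0))\big)\hat h(\sigma,h(0))\,d\sigma+O(\eta^2),$$ $$w(\tau)=1+O(\eta^2).$$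
   Context: A contact sub-Riemannian manifold $(M,\Delta,g)$ of dimension $2n+1$ is a smooth manifold with a rank $2n$ subbundle $\Delta\subset TM$ locally the kernel of a smooth $1$-form $\omega$ with $\omega\wedge(d\omega)^n\ne0$, and a smooth scalar product $g$ on $\Delta$. The sub-Riemannian Hamiltonian is $H(p,q)=\frac12\sum_{i=1}^{2n}\langle p,X_i(q)\rangle^2$ for any local $g$-orthonormal frame $(X_i)$ of $\Delta$, $\vec H$ its Hamiltonian vector field on $T^*M$; normal extremals are its integral curves. Nilpotent invariants: writing $d\omega(X,Y)(q)=g_q(A(q)X(q),Y(q))$ on $\Delta$, the eigenvalues of $A(q)$ are $\pm ib_1,\dots,\pm ib_n$, rescaled so that $b_1\cdots b_n=1/n!$. Agrachev–Gauthier normal form at $q_0$ (known to exist at every $q_0$): coordinates $(x_1,\dots,x_{2n},z)$ centred at $q_0$ and a $g$-orthonormal frame $(X_1,\dots,X_{2n})$ of $\Delta$ near $q_0$, completed by $X_0=\partial_z$, such that, $(Y)_i$ denoting the $i$-th component of $Y$ in $(\partial_{x_1},\dots,\partial_{x_{2n}},\partial_z)$: (i) $(X_i)_j=(X_j)_i$ and $\sum_{j=1}^{2n}(X_j)_ix_j=x_i$ for $1\le i,j\le2n$; (ii) $\sum_{j=1}^{2n}(X_j)_{2n+1}x_j=0$; (iii) $X_0$ is the Reeb field ($\omega(X_0)=1$, $\iota_{X_0}d\omega=0$) of the form $\omega$ with $\ker\omega=\Delta$ and $(d\omega)^n|_\Delta=\mathrm{vol}_g$; (iv) $(X_i)_j(0,z)=\delta_{ij}$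 and $\partial_{x_k}(X_i)_j(0,z)=0$ for $1\le i,j,k\le 2n$; (v) on $V_i=\{x_{2j-1}=x_{2j}=0\ \forall j\ne i\}$ there are functions $\mu_i,\lambda_i$ of $(x_{2i-1},x_{2i},z)$ with $\mu_i(0,0,z)=0$, $(X_{2i-1})_{2i-1}=1+x_{2i}^2\mu_i$, $(X_{2i-1})_{2i}=(X_{2i})_{2i-1}=-x_{2i-1}x_{2i}\mu_i$, $(X_{2i})_{2i}=1+x_{2i-1}^2\mu_i$, $(X_{2i-1})_{2n+1}=x_{2i}\lambda_i/2$, $(X_{2i})_{2n+1}=-x_{2i-1}\lambda_i/2$; (vi) $\prod_i\lambda_i(0,0,z)=1/n!$, and with $\widetilde L_i=\partial_{x_{2i-1}}(X_{2i})_{2n+1}-\partial_{x_{2i}}(X_{2i-1})_{2n+1}$ one has $\sum_{j=1}^n\partial_{x_k}\widetilde L_j(0,z)\prod_{i\ne j}\lambda_i(0,0,z)=0$ for $1\le k\le2n$; (vii) $b_i=\lambda_i(0,0,0)$, and the matrix $J_{ij}=c^0_{ji}$, where $c^0_{ji}$ is the $X_0$-coefficient of $[X_j,X_i]$, is at $q_0$ the block diagonal matrix $\bar J:=J(q_0)=\mathrm{diag}(\bar J_1,\dots,\bar J_n)$ with $\bar J_i=\begin{pmatrix}0&b_i\\-b_i&0\end{pmatrix}$. Fiber coordinates on $T^*M$: $h_i(p,q)=\langle p,X_i(q)\rangle$, $0\le i\le2n$, $h=(h_1,\dots,h_{2n})$; points of $T^*M$ are written $((x,z),(h,h_0))$.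 $B_R=\{h\in\mathbb{R}^{2n}\mid\sum h_i^2\le R\}$. For $t\in\mathbb{R}$, $h\in\mathbb{R}^{2n}$: $$\hat h(t,h)=e^{t\bar J}h,\quad \hat x(t,h)=\bar J^{-1}(e^{t\bar J}-I_{2n})h,\quad \hat z(t,h)=\sum_{i=1}^n(h_{2i-1}^2+h_{2i}^2)\frac{b_it-\sin(b_it)}{2b_i}.$$ $J^{(1)}:\mathbb{R}^{2n}\to\mathcal{M}_{2n}(\mathbb{R})$ is given by $J^{(1)}_{i,j}(y)=\sum_{k=1}^{2n}\left(\frac{\partial^2(X_i)_{2n+1}}{\partial x_j\partial x_k}-\frac{\partial^2(X_j)_{2n+1}}{\partial x_i\partial x_k}\right)y_k$, derivatives at $q_0$. *)

(* Defs.v *)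
From HB Require Import structures.
From mathcomp Require Import all_boot all_order all_algebra.
From mathcomp Require Import perm complex.
From mathcomp Require Import all_classical all_reals all_analysis.

Set Implicit Arguments.
Unset Strict Implicit.
Unset Printing Implicit Defensive.

Import Order.TTheory GRing.Theory Num.Theory.
Import numFieldNormedType.Exports.

Local Open Scope classical_set_scope.
Local Open Scope ring_scope.

Section Calculus.
Context {R : realType}.

(* C^k on a set U, meant for open U. *)
Fixpoint Ck {V W : normedModType R} (k : nat) (U : set V) (f : V -> W) : Prop :=
  match k with
  | 0 => {in U, continuous f}
  | k'.+1 => {in U, forall x, differentiable f x} /\
             (forall v, Ck k' U ('D_v f))
  end.

Definition smooth {V W : normedModType R} (U : set V) (f : V -> W) : Prop :=
  forall k, Ck k U f.

Definition dotp {N : nat} (p v : 'rV[R]_N) : R := \sum_i p 0 i * v 0 i.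

Definition evec {N : nat} (i : 'I_N) : 'rV[R]_N := delta_mx 0 i.

Definition lie_bracket {N : nat} (X Y : 'rV[R]_N -> 'rV[R]_N) (x : 'rV[R]_N) :
    'rV[R]_N :=
  'D_(X x) Y x - 'D_(Y x) X x.

(* A 1-form on an open set of R^N is the field w of its coefficients, so that
   w_x(v) = dotp (w x) v, and dw(v1, v2) = v1(w(v2)) - v2(w(v1)) for constant
   v1, v2. *)
Definition ext_d {N : nat} (w : 'rV[R]_N -> 'rV[R]_N) (x v1 v2 : 'rV[R]_N) : R :=
  dotp ('D_v1 w x) v2 - dotp ('D_v2 w x) v1.

Definition mxexp {m : nat} (A : 'M[R]_m) : 'M[R]_m :=
  limn (series (fun k => (k`!%:R)^-1 *: A ^+ k)).

Definition vintegral {m : nat} (a b : R) (f : R -> 'cV[R]_m) : 'cV[R]_m :=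
  \col_i Rintegral (@lebesgue_measure R) `[a, b] (fun s => f s i 0).

End Calculus.

Section Manifolds.
Context {R : realType} {N : nat}.
Local Notation E := 'rV[R]_N.

Record chart (M : Type) := Chart {
  cdom : set M;
  ccoord : M -> E;
  cinv : E -> M }.

Definition cimage {M : Type} (c : chart M) : set E := ccoord c @` cdom c.

Definition chart_axiom {M : topologicalType} (c : chart M) : Prop :=
  [/\ open (cdom c), open (cimage c),
      {in cdom c, cancel (ccoord c) (cinv c)},
      {in cdom c, continuous (ccoord c)} &
      {in cimage c, continuous (cinv c)}].

Definition ctrans {M : Type} (c d : chart M) : E -> E := ccoord d \o cinv c.

Definition ccompat {M : Type} (c d : chart M) : Prop :=
  smooth (ccoord c @` (cdom c `&` cdom d)) (ctrans c d).

Record smooth_manifold := SmoothManifold {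
  mcar :> topologicalType;
  atlas : set (chart mcar);
  mfd_hausdorff : hausdorff_space mcar;
  mfd_second_countable : @second_countable mcar;
  atlas_chart : forall c, atlas c -> chart_axiom c;
  atlas_cover : forall q, exists2 c, atlas c & cdom c q;
  atlas_compat : forall c d, atlas c -> atlas d -> ccompat c d }.

(* The charts of the maximal atlas. *)
Definition smooth_chart {M : smooth_manifold} (c : chart M) : Prop :=
  chart_axiom c /\ (forall d, atlas d -> ccompat c d /\ ccompat d c).

Definition charts_at {M : smooth_manifold} (q : M) : set (chart M) :=
  [set c | smooth_chart c /\ cdom c q].

(* Differential at q of the change of coordinates from c to d.  A tangent
   (resp. cotangent) vector at q is handled through the family, indexed by the
   charts c at q, of its coordinates with respect to d/dx^1, ..., d/dx^N (resp.
   dx^1, ..., dx^N); these families are the ones that transform by dtrans. *)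
Definition dtrans {M : Type} (c d : chart M) (q : M) (v : E) : E :=
  'D_v (ctrans c d) (ccoord c q).

Definition is_covector {M : smooth_manifold} (q : M) (p : chart M -> E) : Prop :=
  forall c d, charts_at q c -> charts_at q d ->
    forall v, dotp (p c) v = dotp (p d) (dtrans c d q v).

End Manifolds.
Arguments chart R N M : clear implicits.
Arguments smooth_manifold R N : clear implicits.

Section Contact.
Context {R : realType} {n : nat}.
Local Notation N := (n.*2.+1).
Local Notation E := 'rV[R]_N.

(* Indices are 0-based: (ix i, iy i) stands for (2i-1, 2i), the positions of
   (x_{2i-1}, x_{2i}); sp embeds the 2n positions of x into the 2n+1 positions
   of (x, z), and ord_max is the position of z. *)
Fact ix_subproof (i : 'I_n) : (i.*2 < n.*2)%N.
Proof. by rewrite ltn_double. Qed.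
Fact iy_subproof (i : 'I_n) : (i.*2.+1 < n.*2)%N.
Proof. by rewrite ltn_Sdouble. Qed.
Definition ix (i : 'I_n) : 'I_(n.*2) := Ordinal (ix_subproof i).
Definition iy (i : 'I_n) : 'I_(n.*2) := Ordinal (iy_subproof i).
Definition sp (i : 'I_(n.*2)) : 'I_N := lift ord_max i.

Definition zpart (y : E) : R := y 0 ord_max.
Definition xpart (y : E) : 'cV[R]_(n.*2) := \col_i y 0 (sp i).
Definition dz : E := evec ord_max.

(* (v_1, ..., v_2n) |-> a^n (v_1, ..., v_2n) for a 2-form a, with the
   convention (a /\ b)(v) = (1 / k! l!) \sum_s sgn(s) a(v_s) b(v_s). *)
Definition wedge_pow (a : E -> E -> R) (v : 'I_(n.*2) -> E) : R :=
  (2 ^+ n)^-1 * \sum_(s : 'S_(n.*2))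
    (-1) ^+ s * \prod_(i < n) a (v (s (ix i))) (v (s (iy i))).

(* (dw)^n /\ w = w /\ (dw)^n evaluated on the canonical basis of R^(2n+1). *)
Definition contact_volume (w : E -> E) (x : E) : R :=
  (2 ^+ n)^-1 * \sum_(s : 'S_N)
    (-1) ^+ s * dotp (w x) (evec (s ord_max)) *
    \prod_(i < n) ext_d w x (evec (s (sp (ix i)))) (evec (s (sp (iy i)))).

(* dist c q is the fibre of Delta at q and metr c q the scalar product g_q, both
   read in the coordinates of the chart c. *)
Record contact_subriemannian (M : smooth_manifold R N) := ContactSubRiemannian {
  dist : chart R N M -> M -> set E;
  metr : chart R N M -> M -> E -> E -> R;
  dist_trans : forall q c d, charts_at q c -> charts_at q d ->
    forall v, dist c q v <-> dist d q (dtrans c d q v);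
  metr_trans : forall q c d, charts_at q c -> charts_at q d ->
    forall v w, dist c q v -> dist c q w ->
      metr c q v w = metr d q (dtrans c d q v) (dtrans c d q w);
  dist_contact : forall q, exists c (w : E -> E),
    [/\ charts_at q c, smooth (cimage c) w,
        (forall q', cdom c q' ->
           dist c q' = [set v | dotp (w (ccoord c q')) v = 0]) &
        (forall q', cdom c q' -> contact_volume w (ccoord c q') <> 0)];
  metr_sym : forall q c, charts_at q c -> forall v w,
    dist c q v -> dist c q w -> metr c q v w = metr c q w v;
  metr_linear : forall q c, charts_at q c -> forall a u v w,
    dist c q u -> dist c q v -> dist c q w ->
      metr c q (a *: u + v) w = a * metr c q u w + metr c q v w;
  metr_pos : forall q c, charts_at q c -> forall v,
    dist c q v -> v <> 0 -> 0 < metr c q v v;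
  metr_smooth : forall c, smooth_chart c -> forall X Y : E -> E,
    smooth (cimage c) X -> smooth (cimage c) Y ->
    (forall q, cdom c q ->
       dist c q (X (ccoord c q)) /\ dist c q (Y (ccoord c q))) ->
    smooth (cimage c)
      (fun x => metr c (cinv c x) (X x) (Y x) : R^o) }.

Definition orthonormal_frame {M : smooth_manifold R N}
    (S : contact_subriemannian M) (c : chart R N M)
    (X : 'I_(n.*2) -> E -> E) : Prop :=
  (forall i, smooth (cimage c) (X i)) /\
  (forall q, cdom c q ->
     (forall i, dist S c q (X i (ccoord c q))) /\
     (forall i j,
        metr S c q (X i (ccoord c q)) (X j (ccoord c q)) = (i == j)%:R)).

Definition hamiltonian (X : 'I_(n.*2) -> E -> E) (x p : E) : R :=
  2^-1 * \sum_i (dotp p (X i x)) ^+ 2.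

(* t |-> (q t, p t), t in ]alpha, beta[, is an integral curve in T^*M of the
   Hamiltonian vector field of H: Hamilton's equations hold in the canonical
   coordinates induced by any chart, H being expressed there by means of any
   orthonormal frame (every point has a chart carrying such a frame). *)
Definition normal_extremal {M : smooth_manifold R N}
    (S : contact_subriemannian M) (alpha beta : R)
    (q : R -> M) (p : R -> chart R N M -> E) : Prop :=
  forall t, alpha < t < beta ->
    [/\ {for t, continuous q}, is_covector (q t) (p t) &
     forall c, charts_at (q t) c -> forall X, orthonormal_frame S c X ->
       let x := ccoord c (q t) in
       is_derive t 1 (fun s => ccoord c (q s))
         (\row_j 'D_(evec j) (fun y : E => hamiltonian X x y : R^o) (p t c)) /\
       is_derive t 1 (fun s => p s c)
         (- \row_j 'D_(evec j) (fun y : E => hamiltonian X y (p t c) : R^o) x)].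

Definition Jbar (b : 'I_n -> R) : 'M[R]_(n.*2) :=
  \sum_i b i *: (delta_mx (ix i) (iy i) - delta_mx (iy i) (ix i)).

(* v = a X_0 + (linear combination of X_1, ..., X_2n) at x, where X_0 = d/dz. *)
Definition X0_coefficient (X : 'I_(n.*2) -> E -> E) (x v : E) (a : R) : Prop :=
  exists k : 'I_(n.*2) -> R, v = a *: dz + \sum_i k i *: X i x.

(* The eigenvalues, with multiplicity, of the skew-symmetric endomorphism A of
   Delta_q defined by dw(Y, Z) = g(A Y, Z) are +- i b_1, ..., +- i b_n; A is
   written as a matrix in the orthonormal frame X. *)
Definition nilpotent_invariants {M : smooth_manifold R N}
    (S : contact_subriemannian M) (c : chart R N M) (X : 'I_(n.*2) -> E -> E)
    (w : E -> E) (q : M) (b : 'I_n -> R) : Prop :=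
  exists A : 'M[R]_(n.*2),
    (forall i j, let x := ccoord c q in
       ext_d w x (X i x) (X j x) =
       metr S c q (\sum_k A k i *: X k x) (X j x)) /\
    map_poly (real_complex R) (char_poly A) =
    \prod_(i < n) (('X - (0 +i* b i)%C%:P) * ('X - (0 -i* b i)%C%:P)).

Definition zaxis (y : E) : Prop := forall i, y 0 (sp i) = 0.

Definition Vplane (i : 'I_n) (y : E) : Prop :=
  forall j, j != i -> y 0 (sp (ix j)) = 0 /\ y 0 (sp (iy j)) = 0.

Definition Ltilde (X : 'I_(n.*2) -> E -> E) (i : 'I_n) (y : E) : R :=
  'D_(evec (sp (ix i))) (fun x => zpart (X (iy i) x) : R^o) y -
  'D_(evec (sp (iy i))) (fun x => zpart (X (ix i) x) : R^o) y.

(* Agrachev-Gauthier normal form at q0.  The conditions are required on the whole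
   domain of the chart nf_c, which can be shrunk at will around q0.  In nf_volume
   vol_g is the volume form of g for which the frame is positively oriented. *)
Record normal_form {M : smooth_manifold R N} (S : contact_subriemannian M)
    (q0 : M) := NormalForm {
  nf_c : chart R N M;
  nf_X : 'I_(n.*2) -> E -> E;
  nf_w : E -> E;
  nf_mu : 'I_n -> R -> R -> R -> R;
  nf_la : 'I_n -> R -> R -> R -> R;
  nf_b : 'I_n -> R;
  nf_chart : charts_at q0 nf_c;
  nf_centred : ccoord nf_c q0 = 0;
  nf_frame : orthonormal_frame S nf_c nf_X;
  nf_sym : forall y, cimage nf_c y -> forall i j,
    nf_X i y 0 (sp j) = nf_X j y 0 (sp i);
  nf_radial : forall y, cimage nf_c y -> forall i,
    \sum_j nf_X j y 0 (sp i) * y 0 (sp j) = y 0 (sp i);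
  nf_radial_z : forall y, cimage nf_c y ->
    \sum_j zpart (nf_X j y) * y 0 (sp j) = 0;
  nf_form_smooth : smooth (cimage nf_c) nf_w;
  nf_form_ker : forall q, cdom nf_c q ->
    dist S nf_c q = [set v | dotp (nf_w (ccoord nf_c q)) v = 0];
  nf_volume : forall y, cimage nf_c y ->
    wedge_pow (ext_d nf_w y) (fun i => nf_X i y) = 1;
  nf_reeb : forall y, cimage nf_c y -> dotp (nf_w y) dz = 1;
  nf_reeb_d : forall y, cimage nf_c y -> forall v, ext_d nf_w y dz v = 0;
  nf_axis : forall y, cimage nf_c y -> zaxis y -> forall i j,
    nf_X i y 0 (sp j) = (i == j)%:R;
  nf_axis_d : forall y, cimage nf_c y -> zaxis y -> forall i j k,
    'D_(evec (sp k)) (fun x => nf_X i x 0 (sp j) : R^o) y = 0;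
  nf_mu0 : forall i y, cimage nf_c y -> zaxis y ->
    nf_mu i 0 0 (zpart y) = 0;
  nf_plane : forall i y, cimage nf_c y -> Vplane i y ->
    let x1 := y 0 (sp (ix i)) in
    let x2 := y 0 (sp (iy i)) in
    let mu := nf_mu i x1 x2 (zpart y) in
    let la := nf_la i x1 x2 (zpart y) in
    [/\ nf_X (ix i) y 0 (sp (ix i)) = 1 + x2 ^+ 2 * mu,
        nf_X (ix i) y 0 (sp (iy i)) = - (x1 * x2 * mu) /\
        nf_X (iy i) y 0 (sp (ix i)) = - (x1 * x2 * mu),
        nf_X (iy i) y 0 (sp (iy i)) = 1 + x1 ^+ 2 * mu,
        zpart (nf_X (ix i) y) = x2 * la / 2 &
        zpart (nf_X (iy i) y) = - (x1 * la / 2)];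
  nf_prod : forall y, cimage nf_c y -> zaxis y ->
    \prod_i nf_la i 0 0 (zpart y) = (n`!%:R)^-1;
  nf_trace : forall y, cimage nf_c y -> zaxis y -> forall k,
    \sum_j 'D_(evec (sp k)) (Ltilde nf_X j : E -> R^o) y *
      \prod_(i | i != j) nf_la i 0 0 (zpart y) = 0;
  nf_invariants : nilpotent_invariants S nf_c nf_X nf_w q0 nf_b;
  nf_b_la : forall i, nf_b i = nf_la i 0 0 0;
  nf_J : forall i j,
    X0_coefficient nf_X 0 (lie_bracket (nf_X j) (nf_X i) 0) (Jbar nf_b i j) }.

Definition hhat (b : 'I_n -> R) (t : R) (h : 'cV[R]_(n.*2)) : 'cV[R]_(n.*2) :=
  mxexp (t *: Jbar b) *m h.

Definition xhat (b : 'I_n -> R) (t : R) (h : 'cV[R]_(n.*2)) : 'cV[R]_(n.*2) :=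
  invmx (Jbar b) *m (mxexp (t *: Jbar b) - 1%:M) *m h.

Definition zhat (b : 'I_n -> R) (t : R) (h : 'cV[R]_(n.*2)) : R :=
  \sum_i (h (ix i) 0 ^+ 2 + h (iy i) 0 ^+ 2) *
    ((b i * t - sin (b i * t)) / (2 * b i)).

Definition d2z (X : 'I_(n.*2) -> E -> E) (i j k : 'I_(n.*2)) : R :=
  'D_(evec (sp j)) ('D_(evec (sp k)) (fun x => zpart (X i x) : R^o)) 0.

Definition J1 (X : 'I_(n.*2) -> E -> E) (y : 'cV[R]_(n.*2)) : 'M[R]_(n.*2) :=
  \matrix_(i, j) \sum_k (d2z X i j k - d2z X j i k) * y k 0.

Definition ball_h (r : R) : set 'cV[R]_(n.*2) :=
  [set h | \sum_i h i 0 ^+ 2 <= r].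

(* The covector p, in the coordinates of the domain of the frame, has fibre
   coordinates (h, h0) at the point y. *)
Definition fibre_coordinates (X : 'I_(n.*2) -> E -> E) (y p : E)
    (h : 'cV[R]_(n.*2)) (h0 : R) : Prop :=
  (forall i, dotp p (X i y) = h i 0) /\ dotp p dz = h0.

(* (q, p) is a normal extremal defined at least on [0, a], starting at q0 with
   initial covector (h, h0). *)
Definition extremal_from {M : smooth_manifold R N} (S : contact_subriemannian M)
    (q0 : M) (F : normal_form S q0) (h : 'cV[R]_(n.*2)) (h0 a : R)
    (q : R -> M) (p : R -> chart R N M -> E) : Prop :=
  (exists alpha beta, [/\ alpha < 0, a < beta & normal_extremal S alpha beta q p]) /\
  q 0 = q0 /\ fibre_coordinates (nf_X F) 0 (p 0 (nf_c F)) h h0.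

End Contact.

(* Main.v *)
(**
Put [t = eta tau] and let [zeta] be [eta] times the covector. The Hamiltonian being
quadratic in the covector, extremals become solutions on [[0, T]] of the same
Hamiltonian system with initial covector [(eta h, 1)], which is [O(eta)]-close to
the equilibrium [(0, dz)]. Gronwall's inequality keeps [x] and [zeta - dz] of size
[O(eta)]. Write [g_i = <zeta, X_i(x)>]. The normal form determines the
brackets of the frame to first order at [q0], so that
  [g' = (J + J1(x) + O(eta^2)) g],  [x' = g + O(eta^3)],
  [z' = 1/2 <g, J x> + O(eta^3)],   [zeta_z' = O(eta^2)],
and comparison with the Duhamel formula for the constant matrix [J] gives the
expansion.

Solutions exist in the normal form chart by Picard iteration. They are extremals
in every other chart because [\sum_i X_i (x) X_i], hence the Hamiltonian, depends
only on the metric. Conversely the a priori bound confines every extremal to the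
normal form chart up to time [eta T].
*)
Require Import Defs.
From mathcomp Require Import all_boot all_order all_algebra.
From mathcomp Require Import all_classical all_reals all_analysis.
From mathcomp Require Import ring lra.

Set Implicit Arguments.
Unset Strict Implicit.
Unset Printing Implicit Defensive.

Import Order.TTheory GRing.Theory Num.Theory.
Import numFieldNormedType.Exports.

Local Open Scope classical_set_scope.
Local Open Scope ring_scope.

(** * Differential calculus *)

Section MatrixEntries.
Context {R : realType}.

(** The bracket condition at $q_0$ gives only the antisymmetric part of the first derivatives of the
    vertical components $(X_i)_{2n+1}$. The radial condition kills the symmetric part, so each
    derivative is half an entry of [J]. The horizontal components agree with the identity to first
    order and $z=O(\eta^2)$, so the only second derivatives at $q_0$ that reach the orders kept are
    those entering [J1].

    The comparison is run twice. A first pass gives $x$ and $g$ up to $O(\eta^2)$; this determines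
    the products $x_kg_j$ up to $O(\eta^3)$, which is what the second pass needs, in [J1(x) g] and
    in $z'$.

    All bounds concern $g=\eta h$ and $\zeta_z=1/w$. Dividing by $\eta$ costs one order, hence the
    coarser error for $h$ than for $x$; inverting $\zeta_z$ is harmless because it stays near 1.

    Uniformity asks for one constant valid for all extremals at once, so orders of magnitude are
    predicates on families indexed by trajectories instead of limits along a single one. *)

Lemma ler_mx_entry (m n : nat) (A : 'M[R]_(m, n)) i j : `|A i j| <= `|A|.
Proof.
rewrite [leRHS]/Num.Def.normr/= mx_normrE.
exact: (le_bigmax _ (fun ij : 'I_m * 'I_n => `|A ij.1 ij.2|) (i, j)).
Qed.

Lemma mx_norm_le (m n : nat) (A : 'M[R]_(m, n)) (c : R) :
  0 <= c -> (forall i j, `|A i j| <= c) -> `|A| <= c.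
Proof.
move=> c0 Ac; rewrite /Num.Def.normr/= mx_normrE.
by apply: bigmax_le => // -[i j] _; exact: Ac.
Qed.

Lemma mx_entryD (m n : nat) (A B : 'M[R]_(m, n)) i j : (A + B) i j = A i j + B i j.
Proof. by rewrite !mxE. Qed.

Lemma mx_entryB (m n : nat) (A B : 'M[R]_(m, n)) i j : (A - B) i j = A i j - B i j.
Proof. by rewrite !mxE. Qed.

Lemma mx_entryZ (m n : nat) (c : R) (A : 'M[R]_(m, n)) i j : (c *: A) i j = c * A i j.
Proof. by rewrite !mxE. Qed.

End MatrixEntries.

Section Chain.
Context {R : realType}.

Lemma derive_comp (U V W : normedModType R) (g : U -> V) (f : V -> W) (x v : U) :
  differentiable g x -> differentiable f (g x) ->
  'D_v (f \o g) x = 'D_('D_v g x) f (g x).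
Proof.
move=> dg df; rewrite deriveE; last exact: differentiable_comp.
by rewrite diff_comp//= !deriveE.
Qed.

Lemma is_derive_continuous (V : normedModType R) (f : R -> V) (t : R) (d : V) :
  is_derive t 1 f d -> {for t, continuous f}.
Proof. by move=> [df _]; apply/differentiable_continuous/derivable1_diffP. Qed.

Lemma is_derive_comp (V W : normedModType R) (g : R -> V) (f : V -> W) (t : R)
    (dg : V) :
  is_derive t 1 g dg -> differentiable f (g t) ->
  is_derive t 1 (fun s => f (g s)) ('D_dg f (g t)).
Proof.
move=> [dvg <-] df.
have dfg : differentiable g t by exact/derivable1_diffP.
split; last by rewrite -(derive_comp _ dfg df).
by apply/derivable1_diffP; exact: differentiable_comp.
Qed.

Lemma derive_sum_evec (N : nat) (W : normedModType R) (f : 'rV[R]_N -> W)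
    (a v : 'rV[R]_N) : differentiable f a ->
  'D_v f a = \sum_k v 0 k *: 'D_(evec k) f a.
Proof.
move=> df; rewrite deriveE// {1}(row_sum_delta v) linear_sum.
by apply: eq_bigr => k _; rewrite linearZ/= deriveE.
Qed.

Lemma derive_entry (V : normedModType R) (m n : nat) (f : V -> 'M[R]_(m, n))
    (x v : V) i j : derivable f x v ->
  'D_v (fun y => f y i j) x = 'D_v f x i j.
Proof. by move=> df; rewrite derive_mx// mxE. Qed.

Lemma is_derive_entry (V : normedModType R) (m n : nat) (f : V -> 'M[R]_(m, n))
    (x v : V) (df : 'M[R]_(m, n)) i j : is_derive x v f df ->
  is_derive x v (fun y => f y i j) (df i j).
Proof.
by move=> [df1 <-]; split; [apply: (derivable_mxP _ _ _).1 | exact: derive_entry].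
Qed.

Lemma is_derive_mx (V : normedModType R) (m n : nat) (f : V -> 'M[R]_(m, n))
    (x v : V) (df : 'M[R]_(m, n)) : (forall i j, is_derive x v (fun y => f y i j) (df i j)) ->
  is_derive x v f df.
Proof.
move=> dij.
have df1 : derivable f x v by apply/derivable_mxP => i j; case: (dij i j).
split=> //; rewrite derive_mx//; apply/matrixP => i j; rewrite mxE.
by case: (dij i j).
Qed.

Lemma differentiable_entry (V : normedModType R) (m n : nat)
    (f : V -> 'M[R]_(m, n)) (x : V) i j : differentiable f x ->
  differentiable (fun y => f y i j) x.
Proof.
move=> df; apply: (@differentiable_comp _ _ _ _ f (fun A : 'M[R]_(m, n) => A i j)).
  exact: df.
exact: differentiable_coord.
Qed.

Lemma differentiable_row (V : normedModType R) (N : nat)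
    (f : V -> 'rV[R]_N) (x : V) :
  (forall j, differentiable (fun y => f y 0 j : R) x) -> differentiable f x.
Proof.
move=> df.
have -> : f = \sum_(j < N) (fun y => f y 0 j *: (delta_mx 0 j : 'rV[R]_N)).
  by apply/funext => y; rewrite fct_sumE; exact: row_sum_delta.
by apply: differentiable_sum => j; exact: differentiableZl.
Qed.

End Chain.

Section MeanValue.
Context {R : realType} {N : nat}.
Local Notation E := 'rV[R]_N.

Lemma is_derive_line (W : normedModType R) (f : E -> W) (a v : E) (t : R) :
  differentiable f (a + t *: v) ->
  is_derive t 1 (fun s : R => f (a + s *: v)) ('D_v f (a + t *: v)).
Proof.
move=> df; apply: (@is_derive_comp _ _ _ (fun s : R => a + s *: v)) => //.
have dsv : is_derive t 1 (fun s : R => s *: v) v.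
  split; first by apply/derivable1_diffP; exact: ex_diff.
  by rewrite deriveE; [rewrite diff_val /= scale1r|exact: ex_diff].
rewrite -[X in is_derive _ _ _ X]add0r.
exact: (@is_deriveD _ _ _ (cst a) (fun s : R => s *: v)).
Qed.

Lemma line_ball (a x y : E) (rho s : R) : `|x - a| <= rho -> `|y - a| <= rho ->
  0 <= s <= 1 -> `|x + s *: (y - x) - a| <= rho.
Proof.
move=> xa ya /andP[s0 s1].
have -> : x + s *: (y - x) - a = (1 - s) *: (x - a) + s *: (y - a).
  by apply/rowP => i; rewrite !mxE; ring.
apply: (le_trans (ler_normD _ _)); rewrite !normrZ !ger0_norm ?subr_ge0//.
apply: (@le_trans _ _ ((1 - s) * rho + s * rho)); last by lra.
by rewrite lerD// ler_wpM2l// subr_ge0.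
Qed.

(** The bound on [c - x] records that [c] lies on the segment; [taylor2] turns it into the second
    factor of its remainder. *)
Lemma mvt_ball (f : E -> R) (a : E) (rho : R) :
  (forall y, `|y - a| <= rho -> differentiable f y) ->
  forall x y, `|x - a| <= rho -> `|y - a| <= rho ->
  exists c, [/\ `|c - a| <= rho, `|c - x| <= `|y - x| & f y - f x = 'D_(y - x) f c].
Proof.
move=> df x y xa ya.
have D (s : R) : 0 <= s <= 1 ->
    is_derive s 1 (fun s : R => f (x + s *: (y - x))) ('D_(y - x) f (x + s *: (y - x))).
  by move=> s01; apply: is_derive_line; apply: df; exact: line_ball.
have [|||s s01] := @MVT_segment R (fun s : R => f (x + s *: (y - x)))
    (fun s => 'D_(y - x) f (x + s *: (y - x))) 0 1.
- exact: ler01.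
- by move=> s; rewrite in_itv/= => /andP[s0 s1]; apply: D; rewrite !ltW.
- apply: derivable_within_continuous => s; rewrite in_itv/= => s01.
  by have [] := D s s01.
rewrite scale0r addr0 scale1r subr0 mulr1 [x + (y - x)]addrC subrK => fE.
move: s01; rewrite in_itv/= => s01.
exists (x + s *: (y - x)); split => //; first exact: line_ball.
rewrite addrAC subrr add0r normrZ; case/andP: s01 => s0 s1.
by rewrite ger0_norm// ler_piMl.
Qed.

Definition lipnear (a : E) (f : E -> R) := exists L rho : R,
  [/\ 0 <= L, 0 < rho & forall x y, `|x - a| <= rho -> `|y - a| <= rho ->
    `|f y - f x| <= L * `|y - x|].

Lemma nbhs_cball (a : E) (P : set E) : nbhs a P <->
  exists2 rho : R, 0 < rho & forall y, `|y - a| <= rho -> P y.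
Proof.
split=> [/nbhs_normP[e /= e0 eP]|[rho rho0 H]].
  exists (e / 2); first by rewrite divr_gt0.
  move=> y ya; apply: eP => /=; rewrite distrC (le_lt_trans ya)//.
  by rewrite ltr_pdivrMr// ltr_pMr// ltr1n.
apply/nbhs_ballP; exists rho => //= y; rewrite mx_norm_ball /ball_/= => ya.
by apply: H; rewrite distrC ltW.
Qed.

Lemma lipnear_C1 (a : E) (f : E -> R) (M : R) :
  (\forall y \near a, differentiable f y) ->
  (forall k, \forall y \near a, `|'D_(evec k) f y| <= M) -> lipnear a f.
Proof.
move=> df Mf.
have : \forall y \near a, differentiable f y /\
    (forall k, `|'D_(evec k) f y| <= M).
  near=> y; split; first by near: y.
  by near: y; apply: filter_forall.
move/nbhs_cball => [rho rho0 H].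
exists (`|M| *+ N), rho; split => //.
move=> x y xa ya.
have [|c [ca cx ->]] := @mvt_ball f a rho _ x y xa ya; first by move=> z /H[].
have [dfc Mc] := H _ ca.
rewrite derive_sum_evec//; apply: (le_trans (ler_norm_sum _ _ _)).
have -> : `|M| *+ N * `|y - x| = \sum_(k < N) `|M| * `|y - x|.
  by rewrite sumr_const card_ord mulrnAl.
apply: ler_sum => k _; rewrite normrZ mulrC ler_pM//.
  by rewrite (le_trans (Mc k))// ler_norm.
exact: ler_mx_entry.
Unshelve. all: by end_near. Qed.

End MeanValue.

(** * Differentiability and C^k regularity of germs *)

Section DifferentiableNear.
Context {R : realType} {V W : normedModType R}.

Lemma differentiable_approx (f : V -> W) (x : V) : differentiable f x ->
  forall e : R, 0 < e ->
    \forall h \near (0 : V), `|f (x + h) - f x - 'D_h f x| <= e * `|h|.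
Proof.
move=> df e e0; have /diff_locallyP[_ /eqaddoP/(_ e e0)] := df.
apply: filterS => h /=.
rewrite -[(_ - _ : V -> W) _]/(_ - _) /= -[(_ + _ : V -> W) _]/(_ + _) /=.
by rewrite deriveE// opprD addrA [h + x]addrC.
Qed.

Lemma near0_differentiable (f : V -> W) (x : V) :
  (\forall y \near x, f y = 0) -> differentiable f x.
Proof.
move=> f0; have fx0 : f x = 0 := nbhs_singleton f0.
apply/diffP.
(* The differential is defined by a choice operator on this predicate, so exhibiting the zero map as
   a witness proves the specification for the chosen map. *)
apply: (@getPex _ (fun (df : {linear V -> W}) => continuous df /\
  forall y, f y = f (lim (nbhs x)) + df (y - lim (nbhs x))
                  +o_(y \near x) (y - lim (nbhs x)))).
exists (\0 : {linear V -> W}); split; first exact: cst_continuous.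
suff : f = (fun _ => f (lim (nbhs x)) + 0)
    +o_ (nbhs x) (fun y => y - lim (nbhs x)) by rewrite funeqE.
apply/eqaddoP => e e0; rewrite lim_id//.
apply: filterS f0 => z fz.
rewrite -[(_ - _ : V -> W) _]/(_ - _) /=.
by rewrite fz fx0 /= addr0 subr0 normr0 mulr_ge0// ltW.
Qed.

Lemma near_eq_differentiable (f g : V -> W) (x : V) :
  (\forall y \near x, f y = g y) -> differentiable f x -> differentiable g x.
Proof.
move=> fg df.
have -> : g = f + (g - f).
  by apply/funext => y; rewrite -[RHS]/(f y + (g y - f y)) addrC subrK.
apply: differentiableD => //; apply: near0_differentiable.
by apply: filterS fg => y fgy; rewrite -[LHS]/(g y - f y) fgy subrr.
Qed.

(** Openness of [U] turns equality on [U] into equality of germs at each of its points, which passes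
    to derivatives. *)
Lemma Ck_ext (k : nat) (U : set V) (f g : V -> W) : open U ->
  {in U, f =1 g} -> Ck k U f -> Ck k U g.
Proof.
move=> Uo.
have UN x : x \in U -> \forall y \near x, y \in U.
  move=> /set_mem Ux; apply: filterS (open_nbhs_nbhs (conj Uo Ux)) => y.
  exact: mem_set.
elim: k f g => [|k IH] f g fg /=.
  move=> fc x Ux; rewrite /continuous_at -fg//.
  apply: cvg_trans (fc x Ux); apply: near_eq_cvg.
  by near=> y; apply: fg; near: y; exact: UN.
move=> [df Df]; split.
  move=> x Ux; apply: near_eq_differentiable (df x Ux).
  by near=> y; apply: fg; near: y; exact: UN.
move=> v; apply: IH (Df v) => x Ux; apply: near_eq_derive.
by near=> y; apply: fg; near: y; exact: UN.
Unshelve. all: by end_near. Qed.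

End DifferentiableNear.

Lemma Ck_entry (R : realType) (V : normedModType R) (m n k : nat) (U : set V)
    (f : V -> 'M[R]_(m, n)) i j : open U -> Ck k U f ->
  Ck k U (fun x => f x i j).
Proof.
move=> Uo; elim: k f => [|k IH] f /=.
  move=> fc x Ux.
  apply: (@continuous_comp _ _ _ f (fun A : 'M[R]_(m, n) => A i j)).
    exact: fc.
  exact: coord_continuous.
move=> [df Df]; split; first by move=> x Ux; exact/differentiable_entry/df.
move=> v; apply: (Ck_ext Uo _ (IH _ (Df v))) => x Ux; apply/esym.
by apply: derive_entry; apply/diff_derivable/df.
Qed.

(** * Taylor's formula and symmetry of second derivatives *)

Section Smoothness.
Context {R : realType} {N : nat}.
Local Notation E := 'rV[R]_N.
Implicit Types f g : E -> R.

Lemma Ck1_lipnear (U : set E) (a : E) f : open U -> U a -> Ck 1 U f ->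
  lipnear a f.
Proof.
move=> Uo Ua [df cf].
apply: (@lipnear_C1 _ _ a f (\sum_k `|'D_(evec k) f a| + 1)).
  apply: filterS (open_nbhs_nbhs (conj Uo Ua)) => y Uy.
  by apply: df; exact: mem_set.
move=> k; have /cvgrPdist_le/(_ 1 ltr01) := cf (evec k) a (mem_set Ua).
apply: filterS => y Hy.
rewrite -[X in `|X|](subrK ('D_(evec k) f a)) (le_trans (ler_normD _ _))//.
rewrite addrC lerD//; last by rewrite distrC.
by rewrite (bigD1 k)//= lerDl sumr_ge0.
Qed.

(** Lipschitz first derivatives are the form of C^2 regularity that a quadratic Taylor remainder
    consumes. *)
Definition C2near (a : E) f := (\forall y \near a, differentiable f y) /\
  forall k, lipnear a ('D_(evec k) f).

Lemma Ck2_C2near (U : set E) (a : E) f : open U -> U a -> Ck 2 U f ->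
  C2near a f.
Proof.
move=> Uo Ua [df cf]; split; last by move=> k; exact: (@Ck1_lipnear U).
apply: filterS (open_nbhs_nbhs (conj Uo Ua)) => y Uy.
by apply: df; exact: mem_set.
Qed.

Lemma lipnear_unif (a : E) (I : finType) (F : I -> E -> R) (P : E -> Prop) :
  (forall i, lipnear a (F i)) -> (\forall y \near a, P y) ->
  exists L rho : R, [/\ 0 <= L, 0 < rho, forall y, `|y - a| <= rho -> P y &
    forall i x y, `|x - a| <= rho -> `|y - a| <= rho ->
    `|F i y - F i x| <= L * `|y - x|].
Proof.
move=> FL /nbhs_cball[r r0 rP].
pose L i := sval (cid (FL i)); have HL i := svalP (cid (FL i)).
pose rh i := sval (cid (HL i)); have Hr i := svalP (cid (HL i)).
have [rho rho0 Hrho] : exists2 rho : R, 0 < rho & forall i, rho <= rh i.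
  exists (\big[Order.min/1]_i rh i).
    apply: lt_bigmin => [|i _]; first exact: ltr01.
    by have [] := Hr i.
  by move=> i; exact: bigmin_le.
exists (\sum_i L i), (Order.min r rho); split.
- by apply: sumr_ge0 => i _; have [] := Hr i.
- by rewrite lt_min r0.
- by move=> y; rewrite le_min => /andP[yr _]; exact: rP.
move=> i x y; rewrite !le_min => /andP[_ xr] /andP[_ yr].
have [L0 _ H] := Hr i.
have rh_i : rho <= rh i := Hrho i.
apply: (le_trans (H x y (le_trans xr rh_i) (le_trans yr rh_i))).
rewrite ler_wpM2r// (bigD1 i)//= lerDl sumr_ge0// => j _.
by have [] := Hr j.
Qed.

(** The mean value point is no farther from [a] than [y] is, so replacing the derivatives there by
    those at [a] costs one more factor [|y - a|]. *)
Lemma taylor2 (a : E) f : C2near a f -> exists C rho : R,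
  [/\ 0 <= C, 0 < rho & forall y, `|y - a| <= rho ->
   `|f y - f a - \sum_k (y - a) 0 k * 'D_(evec k) f a| <= C * `|y - a| ^+ 2].
Proof.
move=> [df Lf].
have [L [rho [L0 rho0 rP HL]]] := lipnear_unif Lf df.
exists (L *+ N), rho; split => //; first by rewrite mulrn_wge0.
move=> y ya; have aa : `|a - a| <= rho by rewrite subrr normr0 ltW.
have [c [ca cx ->]] := mvt_ball rP aa ya.
rewrite derive_sum_evec; last exact: rP.
rewrite -sumrB; apply: (le_trans (ler_norm_sum _ _ _)).
have -> : L *+ N * `|y - a| ^+ 2 = \sum_(k < N) L * `|y - a| ^+ 2.
  by rewrite sumr_const card_ord mulrnAl.
apply: ler_sum => k _.
rewrite -[_ *: _]/(_ * _) -mulrBr normrM.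
apply: (@le_trans _ _ (`|y - a| * (L * `|y - a|))); last by lra.
apply: ler_pM => //; first exact: ler_mx_entry.
apply: (le_trans (HL _ _ _ aa ca)).
by rewrite ler_wpM2l.
Qed.

(* Mean value theorem applied to the second difference of [f]. *)
Lemma schwarz_approx (a u v : E) f :
  (\forall y \near a, differentiable f y) -> differentiable ('D_u f) a ->
  forall e : R, 0 < e -> \forall s \near 0^'+,
  `|f (a + s *: u + s *: v) - f (a + s *: u) - (f (a + s *: v) - f a) -
    s ^+ 2 * 'D_v ('D_u f) a| <= e * s ^+ 2.
Proof.
move=> /nbhs_cball[rho rho0 df] dG e e0.
(* Differentiability of ['D_u f] at [a] is used with precision [e / K] at two points, each within
   [s * (|u| + |v|)] of [a]; the two errors then add up to at most [e * s]. The extra 1 keeps [K]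
   positive. *)
pose K := 2 * (`|u| + `|v|) + 1.
have K0 : 0 < K by rewrite /K ltr_wpDl// mulr_ge0// addr_ge0.
have /nbhs_cball[r r0] := differentiable_approx dG (divr_gt0 e0 K0).
move=> Hr.
pose m := Order.min rho r / K.
have m0 : 0 < m by rewrite divr_gt0// lt_min rho0.
near=> s.
have s0 : 0 < s by near: s; exact: nbhs_right_gt.
have sm : s < m by near: s; exact: nbhs_right_lt.
have small (x : R) : 0 <= x <= s -> forall y, 0 <= y <= s ->
    `|x *: u + y *: v| <= Order.min rho r /\
    `|x *: u + y *: v| <= s * (`|u| + `|v|).
  move=> /andP[x0 xs] y /andP[y0 ys].
  have H : `|x *: u + y *: v| <= s * (`|u| + `|v|).
    rewrite (le_trans (ler_normD _ _))// !normrZ !ger0_norm// mulrDr.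
    by rewrite lerD// ler_wpM2r.
  split => //; rewrite (le_trans H)//.
  move: sm; rewrite /m ltr_pdivlMr// => /ltW; apply: le_trans.
  by rewrite ler_wpM2l ?(ltW s0)// /K; have := normr_ge0 u; have := normr_ge0 v; lra.
have s0s : 0 <= s <= s by rewrite lexx ltW.
have o0s : (0 : R) <= (0 : R) <= s by rewrite lexx ltW.
have D (x : R) : 0 <= x <= s ->
  is_derive x 1 (fun x : R => f (a + s *: v + x *: u) - f (a + x *: u))
    ('D_u f (a + s *: v + x *: u) - 'D_u f (a + x *: u)).
  move=> xs; apply: is_deriveB; apply: is_derive_line; apply: df.
    have -> : a + s *: v + x *: u - a = x *: u + s *: v.
      by apply/rowP => i; rewrite !mxE; ring.
    by have [+ _] := small x xs s s0s; rewrite le_min => /andP[].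
  rewrite addrAC subrr add0r.
  have [+ _] := small x xs 0 o0s.
  by rewrite scale0r addr0 le_min => /andP[].
have [|||x xs] := @MVT_segment R
    (fun x : R => f (a + s *: v + x *: u) - f (a + x *: u))
    (fun x => 'D_u f (a + s *: v + x *: u) - 'D_u f (a + x *: u)) 0 s.
- exact: ltW.
- by move=> x; rewrite in_itv/= => /andP[x0 x1]; apply: D; rewrite !ltW.
- apply: derivable_within_continuous => x; rewrite in_itv/= => xs.
  by have [] := D x xs.
rewrite scale0r !addr0 subr0 => fE.
have -> : f (a + s *: u + s *: v) - f (a + s *: u) - (f (a + s *: v) - f a) =
  ('D_u f (a + s *: v + x *: u) - 'D_u f (a + x *: u)) * s.
  by rewrite -fE [a + s *: v + _]addrAC.
move: xs; rewrite in_itv/= => xs.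
have [A1 A2] := small x xs s s0s.
have [B1 B2] := small x xs 0 o0s.
have := Hr (x *: u + s *: v); rewrite subr0.
move: A1; rewrite le_min => /andP[_ A1] /(_ A1) EA.
have := Hr (x *: u); rewrite subr0.
move: B1 B2; rewrite scale0r addr0 le_min => /andP[_ B1] B2 /(_ B1) EB.
have lin : 'D_(x *: u + s *: v) ('D_u f) a = 'D_(x *: u) ('D_u f) a + s * 'D_v ('D_u f) a.
  by rewrite !deriveE// linearD/= [in X in _ + X]linearZ.
set P := 'D_u f (a + s *: v + x *: u).
have PE : P = 'D_u f (a + (x *: u + s *: v)) by rewrite /P -addrA [s *: v + _]addrC.
rewrite -PE lin in EA.
have alg (p q c b d : R) :
    (p - q) * s - s ^+ 2 * d = s * ((p - c - (b + s * d)) - (q - c - b)) by ring.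
rewrite (alg _ _ ('D_u f a) ('D_(x *: u) ('D_u f) a)).
rewrite normrM gtr0_norm// expr2 mulrCA ler_pM2l//.
rewrite (le_trans (ler_normB _ _))//.
apply: (le_trans (lerD EA EB)).
rewrite -mulrDr -ler_pdivlMl ?divr_gt0//.
rewrite (le_trans (lerD A2 B2))//.
have -> : (e / K)^-1 * (e * s) = K * s by field; rewrite !gt_eqF.
have algK (A : R) : (2 * A + 1) * s = s * A + s * A + s by ring.
by rewrite /K algK lerDl ltW.
Unshelve. all: by end_near. Qed.

(** The second difference of [f] over the parallelogram spanned by [s u] and [s v] is symmetric in
    [u] and [v], and [schwarz_approx] identifies it, up to $o(s^2)$, with $s^2$ times either mixed
    derivative. *)
Lemma schwarz (a u v : E) f :
  (\forall y \near a, differentiable f y) ->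
  differentiable ('D_u f) a -> differentiable ('D_v f) a ->
  'D_v ('D_u f) a = 'D_u ('D_v f) a.
Proof.
move=> df du dv; apply/eqP; rewrite -subr_eq0 -normr_le0.
apply/ler_addgt0Pr => e e0; rewrite add0r.
have e20 : 0 < e / 2 by rewrite divr_gt0.
have A1 := schwarz_approx v df du e20.
have A2 := schwarz_approx u df dv e20.
have A3 : \forall s \near (0 : R)^'+, 0 < s := nbhs_right_gt 0.
have [s [H1 [H2 s0]]] := filter_ex (filterI A1 (filterI A2 A3)).
have s20 : 0 < s ^+ 2 by rewrite exprn_gt0.
rewrite -(ler_pM2r s20) -{1}(gtr0_norm s20) -normrM.
have := le_trans (ler_normB _ _) (lerD H2 H1).
rewrite [a + s *: v + _]addrAC.
have alg (p q r t b d : R) : (p - q - (r - t) - s ^+ 2 * b) -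
  (p - r - (q - t) - s ^+ 2 * d) = (d - b) * s ^+ 2 by ring.
by rewrite alg -mulrDl -splitr.
Qed.

End Smoothness.

(** * Primitives on the line and comparison of real functions *)

Section RealFunctions.
Context {R : realType}.
Implicit Types f g df dg : R -> R.

Lemma derive_le0_le f df (a b : R) : a <= b ->
  (forall t, a <= t <= b -> is_derive t 1 f (df t)) ->
  (forall t, a <= t <= b -> df t <= 0) -> f b <= f a.
Proof.
move=> ab Df df0.
have [||t] := @MVT_segment R f df a b ab.
- by move=> t; rewrite in_itv/= => /andP[a1 b1]; apply: Df; rewrite !ltW.
- apply: derivable_within_continuous => t; rewrite in_itv/= => tab.
  by have [] := Df t tab.
rewrite in_itv/= => tab E; rewrite -subr_le0 E.
by rewrite mulr_le0_ge0 ?df0// subr_ge0.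
Qed.

Lemma derive_bound f df g dg (a b : R) : a <= b ->
  (forall t, a <= t <= b -> is_derive t 1 f (df t)) ->
  (forall t, a <= t <= b -> is_derive t 1 g (dg t)) ->
  (forall t, a <= t <= b -> `|df t| <= dg t) -> `|f b - f a| <= g b - g a.
Proof.
move=> ab Df Dg B.
have H1 : f b - g b <= f a - g a.
  apply: (@derive_le0_le (f - g) (fun t => df t - dg t)) => // t tab.
    by apply: is_deriveB; [exact: Df|exact: Dg].
  by rewrite subr_le0 (le_trans (ler_norm _))// B.
have H2 : - f b - g b <= - f a - g a.
  apply: (@derive_le0_le (- f - g) (fun t => - df t - dg t)) => // t tab.
    apply: is_deriveB; [apply: is_deriveN; exact: Df|exact: Dg].
  by rewrite subr_le0 (le_trans (ler_norm _))// normrN B.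
by rewrite ler_norml; apply/andP; split; lra.
Qed.

(** The fundamental theorem of calculus is applied at points strictly to the right of the base point
    [a]. Subtracting the value at 0 makes the result independent of [a]. *)
Definition primitive_from (a : R) f (t : R) : R :=
  Rintegral (@lebesgue_measure R) `[a, t] f -
  Rintegral (@lebesgue_measure R) `[a, 0] f.

Lemma is_derive_primitive_from (a : R) f (t : R) : continuous f -> a < t ->
  is_derive t 1 (primitive_from a f) (f t).
Proof.
move=> cf at_.
have [||dF FE] := @continuous_FTC1_closed R f a t (t + 1) _ _ at_ (cf t).
- by rewrite ltrDl.
- apply: continuous_compact_integrable; first exact: segment_compact.
  exact: continuous_subspaceT.
rewrite -[X in is_derive _ _ _ X]subr0 /primitive_from.
apply: is_deriveB.
split; first exact: dF.
by move: FE; rewrite derive1E; apply.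
Qed.

Lemma primitive_from_indep (a b t : R) f : continuous f ->
  a < 0 -> b < 0 -> a < t -> b < t ->
  primitive_from a f t = primitive_from b f t.
Proof.
move=> cf a0 b0 at_ bt; apply/eqP; rewrite -subr_eq0 -normr_le0.
pose u s := primitive_from a f s - primitive_from b f s.
have u0 : u 0 = 0 by rewrite /u /primitive_from !subrr.
have B (x y : R) : x <= y -> a < x -> b < x -> `|u y - u x| <= 0.
  move=> xy ax bx; rewrite -[leRHS](subrr (0 : R)).
  apply: (@derive_bound u (fun=> 0) (cst 0) (fun=> 0) x y xy) => s /andP[xs _].
  - rewrite -[X in is_derive _ _ _ X](subrr (f s)).
    apply: is_deriveB; apply: is_derive_primitive_from => //.
      exact: lt_le_trans ax xs.
    exact: lt_le_trans bx xs.
  - by rewrite normr0.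
have [t0|t0] := leP 0 t.
  by have := B 0 t t0 a0 b0; rewrite u0 subr0.
by have := B t 0 (ltW t0) at_ bt; rewrite u0 sub0r normrN.
Qed.

(** The base point moves with [t] so as to lie to the left of both 0 and [t]; this gives a primitive
    on the whole line. *)
Definition primitive f (t : R) : R := primitive_from (- (`|t| + 1)) f t.

Lemma primitive0 f : primitive f 0 = 0.
Proof. by rewrite /primitive /primitive_from subrr. Qed.

Lemma is_derive_primitive f (t : R) : continuous f ->
  is_derive t 1 (primitive f) (f t).
Proof.
move=> cf.
have lt_opp (s c : R) : `|s| < c -> - c < s by rewrite ltr_norml => /andP[].
(* For [s] within 1 of [t] the moving base point can be replaced by this fixed one, by
   [primitive_from_indep]. *)
have H : is_derive t 1 (primitive_from (- (`|t| + 2)) f) (f t).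
  apply: is_derive_primitive_from => //; apply: lt_opp; lra.
apply: near_eq_is_derive H.
have : \forall s \near t, `|s - t| < 1.
  by apply/nbhs_ballP; exists 1 => //= s; rewrite /ball/= distrC.
apply: filterS => s st; have ns := normr_ge0 s; have nt := normr_ge0 t.
apply: primitive_from_indep => //.
- by apply: lt_opp; have := ler_normD (s - t) t; rewrite subrK; lra.
- by apply: lt_opp; lra.
Qed.

Lemma Rintegral_primitive f (F : R -> R) (a b : R) : continuous f -> a <= b ->
  (forall t : R, is_derive t 1 F (f t)) ->
  Rintegral (@lebesgue_measure R) `[a, b] f = F b - F a.
Proof.
move=> cf; rewrite le_eqVlt => /orP[/eqP <-|ab] DF.
  by rewrite set_itv1 Rintegral_set1 subrr.
rewrite /Rintegral (@continuous_FTC2 R f F)//.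
- exact: continuous_subspaceT.
- split.
  + by move=> x _; have [] := DF x.
  + by apply: cvg_at_right_filter; exact: is_derive_continuous (DF a).
  + by apply: cvg_at_left_filter; exact: is_derive_continuous (DF b).
- by move=> x _; rewrite derive1E; have [] := DF x.
Qed.

(* Pointwise forms of [is_deriveD] etc., which unify with lambda-abstractions. *)
Lemma derD f g (t a b : R) : is_derive t 1 f a -> is_derive t 1 g b ->
  is_derive t 1 (fun s => f s + g s) (a + b).
Proof. exact: is_deriveD. Qed.

Lemma derB f g (t a b : R) : is_derive t 1 f a -> is_derive t 1 g b ->
  is_derive t 1 (fun s => f s - g s) (a - b).
Proof. exact: is_deriveB. Qed.

Lemma derM f g (t a b : R) : is_derive t 1 f a -> is_derive t 1 g b ->
  is_derive t 1 (fun s => f s * g s) (a * g t + f t * b).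
Proof.
move=> df dg; apply: is_derive_eq (is_deriveM df dg) _.
by rewrite addrC -[_ *: a]/(_ * a) -[_ *: b]/(_ * b) [g t * a]mulrC.
Qed.

Lemma derZ f (t a c : R) : is_derive t 1 f a ->
  is_derive t 1 (fun s => c * f s) (c * a).
Proof. exact: is_deriveZ. Qed.

Lemma der_sum (I : Type) (r : seq I) (P : pred I) (F : I -> R -> R) (t : R)
    (dF : I -> R) : (forall i, is_derive t 1 (F i) (dF i)) ->
  is_derive t 1 (fun s => \sum_(i <- r | P i) F i s) (\sum_(i <- r | P i) dF i).
Proof.
move=> DF; elim: r => [|i r IH].
  under eq_fun do rewrite big_nil.
  by rewrite big_nil; exact: is_derive_cst.
under eq_fun do rewrite big_cons.
by rewrite big_cons; case: (P i) => //; exact: derD.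
Qed.

Lemma der_scale f (t a c : R) : is_derive (c * t) 1 f a ->
  is_derive t 1 (fun s => f (c * s)) (c * a).
Proof.
move=> df; rewrite mulrC; apply: (@is_derive1_comp _ f (fun s => c * s)) => //.
by rewrite -[X in is_derive _ _ _ X]mulr1; apply: derZ; exact: is_derive_id.
Qed.

(* The weight [cosh2 K t] turns the Picard operator into a contraction on the
   whole line at once, so that no gluing of local solutions is needed. *)
Definition cosh2 (K t : R) := expR (K * t) + expR (- K * t).
Definition sinh2 (K t : R) := expR (K * t) - expR (- K * t).

Lemma is_derive_sinh2 (K t : R) : is_derive t 1 (sinh2 K) (K * cosh2 K t).
Proof.
apply: (@is_derive_eq _ _ _ _ _ _ _ (K * expR (K * t) - - K * expR (- K * t))).
  by apply: derB; apply: der_scale; exact: is_derive_expR.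
by rewrite mulNr opprK mulrDr.
Qed.

Lemma cosh2_ge1 (K t : R) : 1 <= cosh2 K t.
Proof.
rewrite /cosh2; have := expR_gt0 (K * t); have := expR_gt0 (- K * t).
have [Kt|Kt] := leP 0 (K * t).
  by have := expR_ge1Dx (K * t); lra.
by have := expR_ge1Dx (- K * t); rewrite mulNr; lra.
Qed.

Lemma continuous_cosh2 (K : R) : continuous (cosh2 K).
Proof.
move=> t; apply: (@is_derive_continuous _ _ _ _ (K * expR (K * t) + - K * expR (- K * t))).
by apply: derD; apply: der_scale; exact: is_derive_expR.
Qed.

(** [A * sinh2 K] has derivative [A * K * cosh2 K] and its absolute value is at most [A * cosh2 K]:
    integrating from 0 gains a factor [1 / K] in both directions of time. *)
Lemma cosh2_bound (K A : R) g dg : 0 <= A -> 0 < K -> g 0 = 0 ->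
  (forall t : R, is_derive t 1 g (dg t)) ->
  (forall t, `|dg t| <= A * K * cosh2 K t) -> forall t, `|g t| <= A * cosh2 K t.
Proof.
move=> A0 K0 g0 Dg B t.
have S0 : sinh2 K 0 = 0 by rewrite /sinh2 !mulr0 subrr.
have DS (s : R) : is_derive s 1 (fun s => A * sinh2 K s) (A * K * cosh2 K s).
  by rewrite -mulrA; apply: derZ; exact: is_derive_sinh2.
have e1 := expR_gt0 (K * t); have e2 := expR_gt0 (- K * t).
have [t0|t0] := leP 0 t.
  have := @derive_bound g dg (fun s => A * sinh2 K s) (fun s => A * K * cosh2 K s)
    0 t t0 (fun s _ => Dg s) (fun s _ => DS s) (fun s _ => B s).
  rewrite g0 S0 mulr0 !subr0 => /le_trans; apply.
  by rewrite ler_wpM2l// /sinh2 /cosh2; lra.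
have := @derive_bound g dg (fun s => A * sinh2 K s) (fun s => A * K * cosh2 K s)
    t 0 (ltW t0) (fun s _ => Dg s) (fun s _ => DS s) (fun s _ => B s).
rewrite g0 S0 mulr0 !sub0r normrN => /le_trans; apply.
by rewrite -mulrN ler_wpM2l// /sinh2 /cosh2; lra.
Qed.

End RealFunctions.

Lemma halving_le0 (R : realType) (x A : R) :
  (forall k, x <= A * 2^-1 ^+ k) -> x <= 0.
Proof.
move=> H; apply/ler_addgt0Pr => e e0; rewrite add0r.
have c0 : (fun k => A * (2^-1 : R) ^+ k) @ \oo --> (0 : R).
  rewrite -(mulr0 A); apply: cvgM; first exact: cvg_cst.
  by apply: cvg_expr; rewrite ger0_norm ?invr_ge0// invf_lt1 ?ltr1n.
have /cvgrPdist_le/(_ e e0)[k _ /(_ k (leqnn k))] := c0.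
rewrite sub0r normrN => /(le_trans (ler_norm _)).
exact: le_trans.
Qed.

(** * Picard iteration *)

Section Picard.
Context {R : realType} {m : nat}.
Local Notation E := 'rV[R]_m.
Variables (f : E -> E) (L : R) (y0 : E).
Hypothesis L0 : 0 < L.
Hypothesis fL : forall u v, `|f u - f v| <= L * `|u - v|.

Definition picard_step (Y : R -> E) : R -> E :=
  fun t => y0 + \row_i primitive (fun s => f (Y s) 0 i) t.

Definition picard_iter k := iter k picard_step (fun=> y0).

Lemma continuous_field (Y : R -> E) i : continuous Y ->
  continuous (fun s => f (Y s) 0 i).
Proof.
move=> cY t; apply/cvgrPdist_le => e e0.
have /cvgrPdist_le/(_ (e / L) (divr_gt0 e0 L0)) := cY t.
apply: filterS => s; rewrite ler_pdivlMr// mulrC => H.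
have := ler_mx_entry (f (Y t) - f (Y s)) 0 i; rewrite !mxE => /le_trans; apply.
by rewrite (le_trans (fL _ _)).
Qed.

Lemma is_derive_picard_step (Y : R -> E) (t : R) : continuous Y ->
  is_derive t 1 (picard_step Y) (f (Y t)).
Proof.
move=> cY; apply: is_derive_mx => i j; rewrite ord1.
rewrite -[X in is_derive _ _ _ X]add0r /picard_step.
under eq_fun do rewrite !mxE.
apply: derD.
exact: (is_derive_primitive _ (continuous_field cY)).
Qed.

Lemma continuous_picard_iter k : continuous (picard_iter k).
Proof.
case: k => [|k]; first by move=> t; exact: cst_continuous.
elim: k => [|k IH] t; apply: is_derive_continuous; apply: is_derive_picard_step.
  by move=> s; exact: cst_continuous.
exact: IH.
Qed.

Lemma picard_step0 Y : picard_step Y 0 = y0.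
Proof.
by apply/rowP => i; rewrite !mxE primitive0 addr0.
Qed.

(** With exponent twice the Lipschitz constant, one Picard step halves the weighted distance; [c] is
    the weighted size of the first step. *)
Let K := 2 * L.
Let c := `|f y0| / K.

Let K0 : 0 < K. Proof. by rewrite mulr_gt0. Qed.
Let c0 : 0 <= c. Proof. by rewrite divr_ge0// ltW. Qed.

Lemma picard_step_bound (A : R) (Y Z : R -> E) : 0 <= A ->
  continuous Y -> continuous Z ->
  (forall t, `|Y t - Z t| <= A * cosh2 K t) ->
  forall t, `|picard_step Y t - picard_step Z t| <= A / 2 * cosh2 K t.
Proof.
move=> A0 cY cZ YZ t.
have w1 := cosh2_ge1 K t.
apply: mx_norm_le => [|i j]; first by rewrite mulr_ge0 ?divr_ge0// (le_trans _ w1).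
rewrite ord1 mx_entryB.
apply: (@cosh2_bound R K (A / 2) (fun t => picard_step Y t 0 j - picard_step Z t 0 j)
   (fun t => f (Y t) 0 j - f (Z t) 0 j)) => //.
- by rewrite divr_ge0.
- by rewrite !picard_step0 subrr.
- by move=> s; apply: derB; apply: is_derive_entry; exact: is_derive_picard_step.
move=> s; have := ler_mx_entry (f (Y s) - f (Z s)) 0 j; rewrite mx_entryB => /le_trans; apply.
rewrite (le_trans (fL _ _))// (le_trans (ler_wpM2l (ltW L0) (YZ s)))//.
by have -> : A / 2 * K * cosh2 K s = L * (A * cosh2 K s) by rewrite /K; field.
Qed.

Lemma picard_iter_bound k t :
  `|picard_iter k.+1 t - picard_iter k t| <= c * 2^-1 ^+ k * cosh2 K t.
Proof.
elim: k t => [|k IH] t.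
  have w1 := cosh2_ge1 K t.
  rewrite expr0 mulr1; apply: mx_norm_le => [|i j].
    by rewrite mulr_ge0// (le_trans _ w1).
  rewrite ord1 mx_entryB.
  apply: (@cosh2_bound R K c (fun t => picard_step (fun=> y0) t 0 j - y0 0 j)
     (fun t => f y0 0 j)) => //.
  + by rewrite picard_step0 subrr.
  + move=> s; rewrite -[X in is_derive _ _ _ X]subr0; apply: derB.
    apply: is_derive_entry; apply: (@is_derive_picard_step (fun=> y0)).
    by move=> u; exact: cst_continuous.
  move=> s; rewrite (le_trans (ler_mx_entry _ _ _))// /c divfK ?gt_eqF//.
  by rewrite ler_peMr// cosh2_ge1.
have := picard_step_bound _ (continuous_picard_iter (k := k.+1))
  (continuous_picard_iter (k := k)) IH t.
rewrite exprSr mulrA; apply.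
by rewrite mulr_ge0// exprn_ge0// invr_ge0.
Qed.

(** Keeping the exact partial geometric sum, rather than bounding it by its total, lets the
    induction on [j] close. *)
Lemma picard_iter_cauchy k j t : `|picard_iter (k + j) t - picard_iter k t| <=
  2 * c * cosh2 K t * (2^-1 ^+ k - 2^-1 ^+ (k + j)).
Proof.
elim: j => [|j IH]; first by rewrite addn0 !subrr normr0 mulr0.
rewrite addnS -[X in `|X|](subrKA (picard_iter (k + j) t)).
rewrite (le_trans (ler_normD _ _))//.
apply: (le_trans (lerD (picard_iter_bound _ _) IH)).
rewrite exprSr; set a := _ ^+ (k + j); set b := _ ^+ k.
by rewrite le_eqVlt; apply/orP; left; apply/eqP; field.
Qed.

(** Each iterate plus or minus its geometric tail gives an upper and a lower estimate. Every lower
    estimate is below every upper one, so the supremum of the lower ones lies between them, which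
    yields the limit together with its rate of convergence. *)
Definition picard_limit (t : R) : E := \row_i
  sup (range (fun k => picard_iter k t 0 i - 2 * c * cosh2 K t * 2^-1 ^+ k)).

Lemma picard_limit_bound k t :
  `|picard_limit t - picard_iter k t| <= 2 * c * 2^-1 ^+ k * cosh2 K t.
Proof.
have W0 : 0 <= cosh2 K t by rewrite (le_trans _ (cosh2_ge1 K t)).
have p0 j : 0 <= 2^-1 ^+ j :> R by rewrite exprn_ge0// invr_ge0.
apply: mx_norm_le => [|i j]; first by rewrite mulr_ge0// mulr_ge0// mulr_ge0.
rewrite ord1 mx_entryB {i}.
pose a k := picard_iter k t 0 j - 2 * c * cosh2 K t * 2^-1 ^+ k.
pose b k := picard_iter k t 0 j + 2 * c * cosh2 K t * 2^-1 ^+ k.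
have ab p q : a p <= b q.
  have H u v : `|picard_iter (u + v) t 0 j - picard_iter u t 0 j| <=
      2 * c * cosh2 K t * 2^-1 ^+ u - 2 * c * cosh2 K t * 2^-1 ^+ (u + v).
    have := ler_mx_entry (picard_iter (u + v) t - picard_iter u t) 0 j.
    rewrite mx_entryB => /le_trans; apply.
    by rewrite -mulrBr; exact: picard_iter_cauchy.
  have pos u : 0 <= 2 * c * cosh2 K t * 2^-1 ^+ u by rewrite mulr_ge0// mulr_ge0// mulr_ge0.
  rewrite /a /b; have [pq|qp] := leqP p q.
    have := H p (q - p)%N; rewrite subnKC// ler_norml => /andP[+ _].
    by have := pos p; have := pos q; lra.
  have := H q (p - q)%N; rewrite subnKC ?(ltnW qp)// ler_norml => /andP[_ +].
  by have := pos p; have := pos q; lra.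
have ne : range a !=set0 by exists (a 0%N), 0%N.
have H1 : a k <= sup (range a).
  apply: ub_le_sup; last by exists k.
  by exists (b 0%N) => _ [q _ <-].
have H2 : sup (range a) <= b k by apply: ge_sup => // _ [q _ <-].
rewrite [picard_limit t 0 j]mxE -/(range a); rewrite ler_norml; apply/andP; move: H1 H2.
rewrite -/a /a /b.
have -> : 2 * c * 2^-1 ^+ k * cosh2 K t = 2 * c * cosh2 K t * 2^-1 ^+ k by rewrite mulrAC.
by split; lra.
Qed.

Lemma continuous_picard_limit : continuous picard_limit.
Proof.
move=> t; apply/cvgrPdist_le => e e0.
(* [W] bounds the weight at all [s] near [t], so the iterates converge uniformly there. *)
pose W := cosh2 K t + 1.
have W0 : 0 < W by rewrite /W; have := cosh2_ge1 K t; lra.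
have [k Hk] : exists k, 2 * c * 2^-1 ^+ k * W <= e / 3.
  apply: contrapT => /forallNP H.
  have : e / 3 <= 0.
    apply: (@halving_le0 _ _ (2 * c * W)) => k.
    by rewrite mulrAC ltW// ltNge; apply/negP/H.
  by rewrite leNgt divr_gt0.
have e30 : 0 < e / 3 by rewrite divr_gt0.
have /cvgrPdist_le/(_ _ e30) A1 := @continuous_picard_iter k t.
have /cvgrPdist_le/(_ _ ltr01) A2 := @continuous_cosh2 R K t.
apply: filterS2 A1 A2 => s A1 A2.
have p0 : 0 <= 2 * c * 2^-1 ^+ k by apply: mulr_ge0; [exact: mulr_ge0|rewrite exprn_ge0// invr_ge0].
have B1 : `|picard_limit t - picard_iter k t| <= e / 3.
  rewrite (le_trans (picard_limit_bound _ _))// (le_trans _ Hk)// ler_wpM2l//.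
  by rewrite /W lerDl.
have B2 : `|picard_limit s - picard_iter k s| <= e / 3.
  rewrite (le_trans (picard_limit_bound _ _))// (le_trans _ Hk)// ler_wpM2l//.
  by move: A2; rewrite ler_norml /W => /andP[+ _]; lra.
have alg (a b p q : E) : a - b = (a - p) + (p - q) - (b - q).
  by apply/rowP => i; rewrite !mxE; ring.
rewrite (alg _ _ (picard_iter k t) (picard_iter k s)).
rewrite (le_trans (ler_normB _ _))//.
have := ler_normD (picard_limit t - picard_iter k t) (picard_iter k t - picard_iter k s).
by lra.
Qed.

Lemma picard_limit_fix t : picard_limit t = picard_step picard_limit t.
Proof.
apply/eqP; rewrite -subr_eq0 -normr_le0.
apply: (@halving_le0 _ _ (2 * c * cosh2 K t)) => k.
have p0 : 0 <= 2 * c * 2^-1 ^+ k.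
  by apply: mulr_ge0; [exact: mulr_ge0|rewrite exprn_ge0// invr_ge0].
have H1 := picard_limit_bound k.+1 t.
have H2 := picard_step_bound p0 continuous_picard_limit
  (continuous_picard_iter (k := k)) (picard_limit_bound k) t.
have -> : picard_limit t - picard_step picard_limit t =
  (picard_limit t - picard_iter k.+1 t) - (picard_step picard_limit t - picard_iter k.+1 t).
  by rewrite opprB addrA subrK.
rewrite (le_trans (ler_normB _ _))// (le_trans (lerD H1 H2))//.
rewrite exprSr; set a := _ ^+ k.
by rewrite le_eqVlt; apply/orP; left; apply/eqP; field.
Qed.

Theorem picard : exists y : R -> E, y 0 = y0 /\
  forall t : R, is_derive t 1 y (f (y t)).
Proof.
exists picard_limit; split; first by rewrite picard_limit_fix picard_step0.
move=> t; rewrite (funext picard_limit_fix).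
have := is_derive_picard_step t continuous_picard_limit.
by rewrite -(funext picard_limit_fix).
Qed.

End Picard.

Lemma cvg_sum_seq (R : realType) (V : normedModType R) (I : Type) (s : seq I)
    (f : I -> nat -> V) (l : I -> V) : (forall i, f i @ \oo --> l i) ->
  (fun k => \sum_(i <- s) f i k) @ \oo --> \sum_(i <- s) l i.
Proof.
move=> fl; elim: s => [|i s IH].
  under eq_fun do rewrite big_nil.
  by rewrite big_nil; exact: cvg_cst.
under eq_fun do rewrite big_cons.
by rewrite big_cons; exact: cvgD.
Qed.

(** * The nilpotent flow *)

Section BlockRotation.
Context {R : realType} {n : nat}.
Local Notation m := (n.*2).
Implicit Types a b c d : 'I_n -> R.

Lemma ix_or_iy (k : 'I_m) : exists i : 'I_n, k = ix i \/ k = iy i.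
Proof.
have kn : (k./2 < n)%N by rewrite ltn_half_double.
exists (Ordinal kn); case ko : (odd k); [right|left]; apply: val_inj => /=.
  by rewrite -[LHS]odd_double_half ko.
by rewrite -[LHS]odd_double_half ko.
Qed.

Lemma eq_ix (i j : 'I_n) : (ix i == ix j) = (i == j).
Proof. by rewrite -!val_eqE /= (inj_eq double_inj). Qed.

Lemma eq_iy (i j : 'I_n) : (iy i == iy j) = (i == j).
Proof. by rewrite -!val_eqE /= eqSS (inj_eq double_inj). Qed.

Lemma eq_ixy (i j : 'I_n) : (ix i == iy j) = false.
Proof.
rewrite -val_eqE /=; apply/negP => /eqP/(congr1 odd).
by rewrite /= !odd_double.
Qed.

Lemma eq_iyx (i j : 'I_n) : (iy i == ix j) = false.
Proof. by rewrite eq_sym eq_ixy. Qed.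

(** The block diagonal matrix with blocks $\begin{pmatrix}a_i&c_i\\-c_i&a_i\end{pmatrix}$, that is,
    the complex vector $a+ic$ acting by multiplication. [Jbar b], its inverse and its exponentials
    all have this form, which reduces matrix identities to scalar trigonometry. *)
Definition rot a c : 'M[R]_m := \sum_i
  (a i *: (delta_mx (ix i) (ix i) + delta_mx (iy i) (iy i)) +
   c i *: (delta_mx (ix i) (iy i) - delta_mx (iy i) (ix i))).

Lemma rot_ix a c i k : rot a c (ix i) k = a i * (k == ix i)%:R + c i * (k == iy i)%:R.
Proof.
rewrite /rot summxE (bigD1 i)//= !mxE !eqxx eq_ixy /= big1 => [|j ji].
  by ring.
rewrite !mxE eq_ixy !eq_ix [i == j]eq_sym (negbTE ji) /=; ring.
Qed.

Lemma rot_iy a c i k : rot a c (iy i) k = a i * (k == iy i)%:R - c i * (k == ix i)%:R.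
Proof.
rewrite /rot summxE (bigD1 i)//= !mxE !eqxx eq_iyx /= big1 => [|j ji].
  by ring.
rewrite !mxE eq_iyx !eq_iy [i == j]eq_sym (negbTE ji) /=; ring.
Qed.

Lemma mul_rot_ix (p : nat) a c (A : 'M[R]_(m, p)) i k :
  (rot a c *m A) (ix i) k = a i * A (ix i) k + c i * A (iy i) k.
Proof.
rewrite mxE; under eq_bigr do rewrite rot_ix mulrDl -!mulrA.
rewrite big_split/= -!mulr_sumr; congr (_ * _ + _ * _).
  by rewrite (bigD1 (ix i))//= eqxx mul1r big1 ?addr0// => j /negbTE->; rewrite mul0r.
by rewrite (bigD1 (iy i))//= eqxx mul1r big1 ?addr0// => j /negbTE->; rewrite mul0r.
Qed.

Lemma mul_rot_iy (p : nat) a c (A : 'M[R]_(m, p)) i k :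
  (rot a c *m A) (iy i) k = a i * A (iy i) k - c i * A (ix i) k.
Proof.
rewrite mxE; under eq_bigr do rewrite rot_iy mulrBl -!mulrA.
rewrite sumrB/= -!mulr_sumr; congr (_ * _ - _ * _).
  by rewrite (bigD1 (iy i))//= eqxx mul1r big1 ?addr0// => j /negbTE->; rewrite mul0r.
by rewrite (bigD1 (ix i))//= eqxx mul1r big1 ?addr0// => j /negbTE->; rewrite mul0r.
Qed.

Lemma mulmx_rot a b c d :
  rot a c *m rot b d = rot (fun i => a i * b i - c i * d i) (fun i => a i * d i + c i * b i).
Proof.
apply/matrixP => k l; have [i [->|->]] := ix_or_iy k.
  by rewrite mul_rot_ix !rot_ix rot_iy; ring.
by rewrite mul_rot_iy !rot_iy rot_ix; ring.
Qed.

Lemma rot1 : rot (fun=> 1) (fun=> 0) = 1%:M.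
Proof.
apply/matrixP => k l; have [i [->|->]] := ix_or_iy k.
  by rewrite rot_ix mxE eq_sym; ring.
by rewrite rot_iy mxE eq_sym; ring.
Qed.

Lemma Jbar_rot b : Jbar b = rot (fun=> 0) b.
Proof. by apply: eq_bigr => i _; rewrite scale0r add0r. Qed.

Lemma scale_rot (t : R) a c : t *: rot a c = rot (fun i => t * a i) (fun i => t * c i).
Proof.
by rewrite /rot scaler_sumr; apply: eq_bigr => i _; rewrite scalerDr !scalerA.
Qed.

Lemma rotD a b c d : rot a c + rot b d = rot (fun i => a i + b i) (fun i => c i + d i).
Proof.
by rewrite /rot -big_split/=; apply: eq_bigr => i _; rewrite addrACA -!scalerDl.
Qed.

Lemma eq_rot a b c d : a =1 b -> c =1 d -> rot a c = rot b d.
Proof. by move=> ab cd; apply: eq_bigr => i _; rewrite ab cd. Qed.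

Lemma fact_cos_coeff (x : R) k :
  k`!%:R * cos_coeff x k = (~~ odd k)%:R * (-1) ^+ k./2 * x ^+ k.
Proof.
have nz : k`!%:R != 0 :> R by rewrite pnatr_eq0 -lt0n fact_gt0.
by rewrite /cos_coeff mulrC divfK.
Qed.

Lemma fact_sin_coeff (x : R) k :
  k`!%:R * sin_coeff x k = (odd k)%:R * (-1) ^+ k.-1./2 * x ^+ k.
Proof.
have nz : k`!%:R != 0 :> R by rewrite pnatr_eq0 -lt0n fact_gt0.
by rewrite /sin_coeff mulrC divfK.
Qed.

(** [Jbar b] corresponds to multiplication by $ib$, so this is the splitting of $(ib_it)^k/k!$ into
    real and imaginary parts. *)
Lemma expJbar_coeff b (t : R) k :
  (k`!%:R)^-1 *: (t *: Jbar b) ^+ k =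
  rot (fun i => cos_coeff (b i * t) k) (fun i => sin_coeff (b i * t) k).
Proof.
have E j : (t *: Jbar b) ^+ j =
    rot (fun i => j`!%:R * cos_coeff (b i * t) j) (fun i => j`!%:R * sin_coeff (b i * t) j).
  elim: j => [|j IH].
    rewrite expr0 -[LHS]rot1; apply: eq_rot => i.
      by rewrite fact_cos_coeff /= !expr0 !mul1r.
    by rewrite fact_sin_coeff /= !mul0r.
  rewrite exprSr IH Jbar_rot scale_rot; etransitivity; first exact: mulmx_rot.
  apply: eq_rot => i; rewrite !fact_cos_coeff !fact_sin_coeff /=.
    case oj : (odd j) => /=; last by ring.
    have -> : (uphalf j = (j.-1)./2.+1)%N by case: j oj {IH} => //= j ->.
    by rewrite !exprS; ring.
  by case: (odd j) => /=; rewrite ?exprS; ring.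
rewrite E scale_rot.
have nz (l : nat) : l`!%:R != 0 :> R by rewrite pnatr_eq0 -lt0n fact_gt0.
by apply: eq_rot => i; rewrite mulKf.
Qed.

Lemma mxexp_Jbar b (t : R) :
  mxexp (t *: Jbar b) = rot (fun i => cos (b i * t)) (fun i => sin (b i * t)).
Proof.
rewrite /mxexp; apply: cvg_lim; first exact: norm_hausdorff.
have -> : series (fun k => (k`!%:R)^-1 *: (t *: Jbar b) ^+ k) = fun k =>
    rot (fun i => series (cos_coeff (b i * t)) k) (fun i => series (sin_coeff (b i * t)) k).
  apply/funext => k; rewrite /series /=; elim: k => [|k IH].
    rewrite big_geq// -[LHS](scale0r (rot (fun=> 0) (fun=> 0))) scale_rot.
    by apply: eq_rot => i; rewrite mul0r big_geq.
  rewrite big_nat_recr//= IH expJbar_coeff rotD.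
  by apply: eq_rot => i; rewrite big_nat_recr.
rewrite /rot; apply: cvg_sum_seq => i.
apply: cvgD; apply: cvgZr_tmp.
  by rewrite cos.unlock; exact: is_cvg_series_cos_coeff.
by rewrite sin.unlock; exact: is_cvg_series_sin_coeff.
Qed.

End BlockRotation.

(** * The curves [hhat], [xhat], [zhat] and their derivatives *)

Section NilpotentFlow.
Context {R : realType} {n : nat}.
Local Notation m := (n.*2).
Local Notation V := 'cV[R]_m.
Variable b : 'I_n -> R.

Lemma is_derive_rot (a c : R -> 'I_n -> R) (W : R -> V) (t : R)
    (da dc : 'I_n -> R) (dW : V) (k : 'I_m) :
  (forall i, is_derive t 1 (fun s => a s i) (da i)) ->
  (forall i, is_derive t 1 (fun s => c s i) (dc i)) ->
  (forall i, is_derive t 1 (fun s => W s i 0) (dW i 0)) ->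
  is_derive t 1 (fun s => (rot (a s) (c s) *m W s) k 0)
    ((rot da dc *m W t + rot (a t) (c t) *m dW) k 0).
Proof.
move=> Da Dc DW; rewrite [in X in is_derive _ _ _ X]mxE; have [i [->|->]] := ix_or_iy k.
  under eq_fun do rewrite mul_rot_ix.
  by rewrite !mul_rot_ix addrACA; apply: derD; exact: derM.
under eq_fun do rewrite mul_rot_iy.
by rewrite !mul_rot_iy addrACA -opprD; apply: derB; exact: derM.
Qed.

Lemma is_derive_cos_scale (w t : R) :
  is_derive t 1 (fun s => cos (w * s)) (- w * sin (w * t)).
Proof.
by rewrite mulNr -mulrN; apply: der_scale; exact: is_derive_cos.
Qed.

Lemma is_derive_sin_scale (w t : R) :
  is_derive t 1 (fun s => sin (w * s)) (w * cos (w * t)).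
Proof. by apply: der_scale; exact: is_derive_sin. Qed.

Lemma is_derive_mxexp_mul (W : R -> V) (t : R) (dW : V) (k : 'I_m) :
  (forall i, is_derive t 1 (fun s => W s i 0) (dW i 0)) ->
  is_derive t 1 (fun s => (mxexp (s *: Jbar b) *m W s) k 0)
    ((Jbar b *m (mxexp (t *: Jbar b) *m W t) + mxexp (t *: Jbar b) *m dW) k 0).
Proof.
move=> DW; under eq_fun do rewrite mxexp_Jbar.
have := is_derive_rot k (fun i => is_derive_cos_scale (b i) t)
   (fun i => is_derive_sin_scale (b i) t) DW.
move=> D; apply: is_derive_eq D _; congr (fun_of_matrix (_ + _) k 0); last by rewrite mxexp_Jbar.
rewrite mxexp_Jbar Jbar_rot mulmxA mulmx_rot; congr (_ *m _).
by apply: eq_rot => i; ring.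
Qed.

Lemma mxexp_Jbar0 : mxexp (0 *: Jbar b) = 1%:M.
Proof.
rewrite mxexp_Jbar -rot1; apply: eq_rot => i; rewrite mulr0 ?cos0 ?sin0//.
Qed.

Lemma mxexp_JbarB (s t : R) :
  mxexp ((s - t) *: Jbar b) = mxexp (s *: Jbar b) *m mxexp ((- t) *: Jbar b).
Proof.
rewrite !mxexp_Jbar mulmx_rot; apply: eq_rot => i.
  by rewrite mulrDr cosD.
by rewrite mulrDr sinD addrC.
Qed.

Lemma is_derive_hhat h (t : R) k :
  is_derive t 1 (fun s => hhat b s h k 0) ((Jbar b *m hhat b t h) k 0).
Proof.
have := @is_derive_mxexp_mul (fun=> h) t 0 k.
rewrite /hhat mulmx0 addr0; apply => i; rewrite mxE; exact: is_derive_cst.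
Qed.

Lemma hhat0 h : hhat b 0 h = h.
Proof. by rewrite /hhat mxexp_Jbar0 mul1mx. Qed.

Hypothesis b0 : forall i, b i != 0.

Lemma mul_Jbar_inv : Jbar b *m rot (fun=> 0) (fun i => - (b i)^-1) = 1%:M.
Proof.
rewrite Jbar_rot mulmx_rot -rot1; apply: eq_rot => i; last by ring.
by rewrite mul0r mulrN mulfV// sub0r opprK.
Qed.

Lemma Jbar_unit : Jbar b \in unitmx.
Proof. by have [] := mulmx1_unit mul_Jbar_inv. Qed.

Lemma invmx_Jbar : invmx (Jbar b) = rot (fun=> 0) (fun i => - (b i)^-1).
Proof. by rewrite -[LHS]mulmx1 -mul_Jbar_inv mulKmx// Jbar_unit. Qed.

Lemma xhat_rot t h : xhat b t h =
  rot (fun i => sin (b i * t) / b i) (fun i => (1 - cos (b i * t)) / b i) *m h.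
Proof.
rewrite /xhat invmx_Jbar mxexp_Jbar -rot1 -scaleN1r scale_rot rotD mulmx_rot.
by congr (_ *m _); apply: eq_rot => i; field.
Qed.

Lemma is_derive_xhat h (t : R) k :
  is_derive t 1 (fun s => xhat b s h k 0) (hhat b t h k 0).
Proof.
under eq_fun do rewrite xhat_rot.
rewrite (_ : hhat b t h = rot (fun i => cos (b i * t)) (fun i => sin (b i * t)) *m h +
   rot (fun i => sin (b i * t) / b i) (fun i => (1 - cos (b i * t)) / b i) *m 0);
   last by rewrite mulmx0 addr0 /hhat mxexp_Jbar.
apply: is_derive_rot => i; last by rewrite mxE; exact: is_derive_cst.
  under eq_fun do rewrite mulrC.
  rewrite (_ : cos _ = (b i)^-1 * (b i * cos (b i * t))); last by rewrite mulKf.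
  by apply: derZ; exact: is_derive_sin_scale.
under eq_fun do rewrite mulrC.
rewrite (_ : sin _ = (b i)^-1 * (0 - (- b i * sin (b i * t)))); last first.
  by rewrite sub0r mulNr opprK mulKf.
apply: derZ; apply: derB; exact: is_derive_cos_scale.
Qed.

Lemma xhat0 h : xhat b 0 h = 0.
Proof. by rewrite /xhat mxexp_Jbar0 subrr mulmx0 mul0mx. Qed.

Lemma zhat0 h : zhat b 0 h = 0.
Proof.
rewrite /zhat big1// => i _; rewrite mulr0 sin0 subrr mul0r mulr0//.
Qed.

Lemma sum_mul_rot (g x : V) :
  \sum_k g k 0 * (Jbar b *m x) k 0 =
  \sum_i b i * (g (ix i) 0 * x (iy i) 0 - g (iy i) 0 * x (ix i) 0).
Proof.
have -> : \sum_k g k 0 * (Jbar b *m x) k 0 = (g^T *m (Jbar b *m x)) 0 0.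
  by rewrite [RHS]mxE; apply: eq_bigr => k _; rewrite [g^T _ _]mxE.
have dm (p q : 'I_m) : (g^T *m (delta_mx p q *m x)) 0 0 = g p 0 * x q 0.
  have dq k : (delta_mx p q *m x) k 0 = (k == p)%:R * x q 0.
    rewrite mxE (bigD1 q)//= big1 ?addr0 => [|j jq]; rewrite mxE.
      by rewrite eqxx andbT.
    by rewrite (negbTE jq) andbF mul0r.
  rewrite mxE (bigD1 p)//= big1 ?addr0 => [|k kp]; rewrite dq mxE.
    by rewrite eqxx mul1r.
  by rewrite (negbTE kp) mul0r mulr0.
rewrite /Jbar mulmx_suml mulmx_sumr summxE; apply: eq_bigr => i _.
rewrite -scalemxAl -scalemxAr mulmxBl mulmxBr.
by rewrite [LHS]mxE mx_entryB !dm.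
Qed.

(** On the i-th block the pairing reduces, by $\cos^2+\sin^2=1$, to $(h_{2i-1}^2+h_{2i}^2)(1-\cos
    b_it)/2$. *)
Lemma is_derive_zhat h (t : R) : is_derive t 1 (fun s => zhat b s h)
  (2^-1 * \sum_k hhat b t h k 0 * (Jbar b *m xhat b t h) k 0).
Proof.
rewrite sum_mul_rot mulr_sumr /zhat.
apply: der_sum => i.
have bi := b0 i.
rewrite [f in is_derive _ _ f _](_ : _ = fun s : R =>
    (2 * b i)^-1 * (h (ix i) 0 ^+ 2 + h (iy i) 0 ^+ 2) * (b i * s - sin (b i * s))).
  apply: is_derive_eq
    (derZ _ (derB (derZ (b i) (is_derive_id t 1)) (is_derive_sin_scale (b i) t))) _.
rewrite xhat_rot /hhat mxexp_Jbar !mul_rot_ix !mul_rot_iy.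
have := cos2Dsin2 (b i * t); set c := cos _; set s := sin _ => cs.
move: (h (ix i) 0) (h (iy i) 0) => p q.
  have -> : 2^-1 * (b i * ((c * p + s * q) * (s / b i * q - (1 - c) / b i * p) -
     (c * q - s * p) * (s / b i * p + (1 - c) / b i * q))) =
     2^-1 * ((p ^+ 2 + q ^+ 2) * (c ^+ 2 + s ^+ 2 - c)) by field.
  by rewrite cs; field.
by apply/funext => s; field.
Qed.

End NilpotentFlow.

(** * Variation of constants *)

Section Duhamel.
Context {R : realType} {n : nat}.
Local Notation m := (n.*2).
Local Notation V := 'cV[R]_m.
Variable b : 'I_n -> R.

Lemma continuous_rot (a c : R -> 'I_n -> R) (w : R -> V) k :
  (forall i, continuous (fun s => a s i)) -> (forall i, continuous (fun s => c s i)) ->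
  (forall i, continuous (fun s => w s i 0)) ->
  continuous (fun s => (rot (a s) (c s) *m w s) k 0).
Proof.
move=> ca cc cw; have [j [->|->]] := ix_or_iy k.
  rewrite (_ : (fun s => _) = fun s => a s j * w s (ix j) 0 + c s j * w s (iy j) 0).
    by move=> s; apply: cvgD; apply: cvgM; [exact: ca|exact: cw|exact: cc|exact: cw].
  by apply/funext => s; rewrite mul_rot_ix.
rewrite (_ : (fun s => _) = fun s => a s j * w s (iy j) 0 - c s j * w s (ix j) 0).
  by move=> s; apply: cvgB; apply: cvgM; [exact: ca|exact: cw|exact: cc|exact: cw].
by apply/funext => s; rewrite mul_rot_iy.
Qed.

(** The integrals of the expansion are replaced by functions known through their differential
    equations and initial values, the form in which Gronwall's inequality compares them with the
    trajectories. *)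
Lemma duhamel (v : R -> V) : (forall i, continuous (fun s => v s i 0)) ->
  exists H X : R -> V, [/\ H 0 = 0, X 0 = 0,
    forall (t : R) k, is_derive t 1 (fun s => H s k 0) ((Jbar b *m H t) k 0 + v t k 0),
    forall (t : R) k, is_derive t 1 (fun s => X s k 0) (H t k 0) &
    forall t, 0 <= t ->
      vintegral 0 t (fun s => mxexp ((t - s) *: Jbar b) *m v s) = H t /\
      vintegral 0 t (fun u => vintegral 0 u
        (fun s => mxexp ((u - s) *: Jbar b) *m v s)) = X t].
Proof.
move=> cv.
pose u s := mxexp ((- s) *: Jbar b) *m v s.
have ccos (w : R) : continuous (fun s => cos (w * - s)).
  move=> s; apply: (@continuous_comp _ _ _ (fun s => w * - s) cos); last exact: continuous_cos.
  by apply: cvgMr; apply: cvgN; exact: cvg_id.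
have csin (w : R) : continuous (fun s => sin (w * - s)).
  move=> s; apply: (@continuous_comp _ _ _ (fun s => w * - s) sin); last exact: continuous_sin.
  by apply: cvgMr; apply: cvgN; exact: cvg_id.
have cu i : continuous (fun s => u s i 0).
  have -> : (fun s => u s i 0) = fun s =>
      (rot (fun j => cos (b j * - s)) (fun j => sin (b j * - s)) *m v s) i 0.
    by apply/funext => s; rewrite /u mxexp_Jbar.
  exact: continuous_rot.
pose W t : V := \col_i primitive (fun s => u s i 0) t.
have DW (t : R) i : is_derive t 1 (fun s => W s i 0) (u t i 0).
  by under eq_fun do rewrite mxE; exact: is_derive_primitive.
pose H t := mxexp (t *: Jbar b) *m W t.
have W0 : W 0 = 0 by apply/colP => i; rewrite !mxE primitive0.
have DH (t : R) k : is_derive t 1 (fun s => H s k 0) ((Jbar b *m H t) k 0 + v t k 0).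
  have := is_derive_mxexp_mul b k (DW t); move=> D; apply: is_derive_eq D _.
  rewrite mxE; congr (_ + _); rewrite /u mulmxA -mxexp_JbarB subrr mxexp_Jbar0.
  by rewrite mul1mx.
have cH k : continuous (fun s => H s k 0) by move=> t; exact: is_derive_continuous (DH t k).
pose X t : V := \col_i primitive (fun s => H s i 0) t.
have DX (t : R) k : is_derive t 1 (fun s => X s k 0) (H t k 0).
  by under eq_fun do rewrite mxE; exact: is_derive_primitive.
have HE t : 0 <= t -> vintegral 0 t (fun s => mxexp ((t - s) *: Jbar b) *m v s) = H t.
  move=> t0; apply/colP => k; rewrite mxE.
  (* With the outer [t] frozen, the group law writes the integrand as [mxexp (t *: Jbar b) *m u s],
     of which [G] is a primitive. *)
  pose G s := mxexp (t *: Jbar b) *m W s.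
  have DG (s : R) : is_derive s 1 (fun s => G s k 0)
      ((mxexp ((t - s) *: Jbar b) *m v s) k 0).
    rewrite mxexp_JbarB -mulmxA -/(u s) /G mxexp_Jbar.
    have := @is_derive_rot _ _ (fun=> fun i => cos (b i * t)) (fun=> fun i => sin (b i * t))
      W s (fun=> 0) (fun=> 0) (u s) k (fun i => is_derive_cst _ _ _)
      (fun i => is_derive_cst _ _ _) (DW s).
    move=> D; apply: is_derive_eq D _; rewrite mxE -[RHS]add0r; congr (_ + _).
    by rewrite /rot big1 ?mul0mx ?mxE// => i _; rewrite !scale0r addr0.
  rewrite (@Rintegral_primitive _ _ (fun s => G s k 0))//.
    by rewrite /G W0 mulmx0 [X in _ - X]mxE subr0.
  have -> : (fun s => (mxexp ((t - s) *: Jbar b) *m v s) k 0) = fun s =>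
      (rot (fun j => cos (b j * t)) (fun j => sin (b j * t)) *m u s) k 0.
    by apply/funext => s; rewrite mxexp_JbarB -mulmxA -/(u s) mxexp_Jbar.
  by apply: continuous_rot => // j s; exact: cvg_cst.
exists H, X; split => //.
- by rewrite /H W0 mulmx0.
- by apply/colP => i; rewrite !mxE primitive0.
move=> t t0; split; first exact: HE.
apply/colP => k; rewrite mxE.
rewrite -[X t k 0]subr0 -[X in _ - X](_ : X 0 k 0 = 0); last by rewrite mxE primitive0.
rewrite -(@Rintegral_primitive _ (fun s => H s k 0) (fun s => X s k 0))//.
apply: eq_Rintegral => s; rewrite inE/= in_itv/= => /andP[s0 _].
by rewrite HE.
Qed.

End Duhamel.

(** * Asymptotic comparison of differential systems *)

Section Gronwall.
Context {R : realType}.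

Lemma gronwall_scalar (v dv : R -> R) (K t : R) : 0 <= t ->
  (forall s, 0 <= s <= t -> is_derive s 1 v (dv s)) ->
  (forall s, 0 <= s <= t -> dv s <= K * v s) -> v t <= v 0 * expR (K * t).
Proof.
move=> t0 Dv B.
have : v t * expR (- K * t) <= v 0 * expR (- K * 0).
  apply: (@derive_le0_le _ (fun s => v s * expR (- K * s))
    (fun s => dv s * expR (- K * s) + v s * (- K * expR (- K * s)))) => // s st.
    by apply: derM; [exact: Dv|apply: der_scale; exact: is_derive_expR].
  have -> : dv s * expR (- K * s) + v s * (- K * expR (- K * s)) =
    (dv s - K * v s) * expR (- K * s) by ring.
  by rewrite mulr_le0_ge0 ?expR_ge0// subr_le0 B.
rewrite mulr0 expR0 mulr1 => H.
have -> : v t = v t * expR (- K * t) * expR (K * t).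
  by rewrite -mulrA -expRD mulNr addNr expR0 mulr1.
by rewrite ler_wpM2r// expR_ge0.
Qed.

Lemma sqr_sum_le (J : finType) (y : J -> R) :
  (\sum_j `|y j|) ^+ 2 <= #|J|%:R * \sum_j y j ^+ 2.
Proof.
rewrite expr2 mulr_suml.
apply: (@le_trans _ _ (\sum_i \sum_j (y i ^+ 2 + y j ^+ 2) / 2)).
  apply: ler_sum => i _; rewrite mulr_sumr; apply: ler_sum => j _.
  rewrite ler_pdivlMr// -(real_normK (num_real (y i))) -(real_normK (num_real (y j))).
  by have := sqr_ge0 (`|y i| - `|y j|); lra.
under eq_bigr do rewrite -mulr_suml big_split/= sumr_const.
rewrite -mulr_suml big_split/= sumr_const sumrMnl.
rewrite -[X in (X + _) / 2 <= _]mulr_natl -[X in (_ + X) / 2 <= _]mulr_natl.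
by rewrite le_eqVlt; apply/orP; left; apply/eqP; field.
Qed.

(* Gronwall's inequality for the differentiable quantity [\sum_j y_j ^ 2 + d ^ 2]. *)
Lemma gronwall (J : finType) (A T : R) : 0 <= A -> 0 <= T ->
  exists2 C : R, 0 <= C & forall (y dy : J -> R -> R) (d t : R), 0 <= d ->
    0 <= t <= T ->
    (forall j s, 0 <= s <= t -> is_derive s 1 (y j) (dy j s)) ->
    (forall j s, 0 <= s <= t -> `|dy j s| <= A * (\sum_i `|y i s|) + d) ->
    (forall j, `|y j 0| <= d) -> forall j, `|y j t| <= C * d.
Proof.
move=> A0 T0; set m : R := #|J|%:R.
have m0 : 0 <= m by rewrite /m.
(* With $S=\sum_i|y_i|$ and $q=\sum_iy_i^2$ one has $2S(AS+d)\le(2A+1)S^2+d^2$ and $S^2\le mq$. *)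
pose K := (2 * A + 1) * m + 1.
have K0 : 0 <= K by rewrite /K addr_ge0// mulr_ge0// addr_ge0// mulr_ge0.
pose Q := (m + 1) * expR (K * T).
have Q0 : 0 <= Q by rewrite /Q mulr_ge0 ?expR_ge0// addr_ge0.
(* [Q + 1] stands for the square root of [Q], since $Q\le(Q+1)^2$. *)
exists (Q + 1); first by rewrite addr_ge0.
move=> y dy d t d0 /andP[t0 tT] Dy B y0 j.
pose u s := \sum_j y j s ^+ 2 + d ^+ 2.
pose du s := \sum_j (dy j s * y j s + y j s * dy j s) + 0.
have Du s : 0 <= s <= t -> is_derive s 1 u (du s).
  move=> st; apply: derD; apply: der_sum => i.
  under eq_fun do rewrite expr2.
  by apply: derM; exact: Dy.
have Bu s : 0 <= s <= t -> du s <= K * u s.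
  move=> st; rewrite /du addr0.
  set S := \sum_i `|y i s|.
  have S0 : 0 <= S by apply: sumr_ge0.
  apply: (@le_trans _ _ (\sum_i 2 * `|y i s| * (A * S + d))).
    apply: ler_sum => i _.
    have -> : dy i s * y i s + y i s * dy i s = 2 * (y i s * dy i s) by ring.
    rewrite -mulrA ler_pM2l// (le_trans (ler_norm _))// normrM.
    by rewrite ler_wpM2l// B.
  rewrite -mulr_suml -mulr_sumr -/S.
  have := sqr_sum_le (fun i => y i s); rewrite -/S -/m /u.
  set q := \sum_i _ => Sq.
  have q0 : 0 <= q by apply: sumr_ge0 => i _; exact: sqr_ge0.
  have H1 : 2 * S * d <= S ^+ 2 + d ^+ 2 by have := sqr_ge0 (S - d); lra.
  have H2 : (2 * A + 1) * S ^+ 2 <= (2 * A + 1) * (m * q).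
    by rewrite ler_wpM2l// addr_ge0// mulr_ge0.
  have H3 : 0 <= ((2 * A + 1) * m) * d ^+ 2.
    by rewrite mulr_ge0 ?sqr_ge0// mulr_ge0// addr_ge0// mulr_ge0.
  rewrite /K; lra.
have u0 : u 0 <= (m + 1) * d ^+ 2.
  rewrite /u mulrDl mul1r lerD2r /m mulr_natl -sumr_const.
  apply: ler_sum => i _; rewrite -real_normK ?num_real//.
  by rewrite lerXn2r ?nnegrE.
have ut : u t <= Q * d ^+ 2.
  rewrite (le_trans (gronwall_scalar t0 Du Bu))// /Q mulrAC.
  apply: ler_pM => //.
  - by rewrite /u addr_ge0 ?sqr_ge0// sumr_ge0// => i _; exact: sqr_ge0.
  - by rewrite ler_expR ler_wpM2l.
have yu : `|y j t| ^+ 2 <= u t.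
  rewrite real_normK ?num_real// /u (bigD1 j)//= -addrA lerDl.
  by rewrite addr_ge0 ?sqr_ge0// sumr_ge0// => i _; exact: sqr_ge0.
have Qd : 0 <= (Q + 1) * d by rewrite mulr_ge0// addr_ge0.
rewrite -(@ler_pXn2r _ 2)// ?nnegrE// (le_trans yu)// (le_trans ut)//.
rewrite exprMn ler_wpM2r ?sqr_ge0//; nra.
Qed.

End Gronwall.

(** * Calculus of orders in [eta], uniform over a family *)

Section BigO.
Context {R : realType} {I : Type}.
Variables (D : I -> Prop) (eta : I -> R) (T : R).
Hypothesis eta01 : forall i, D i -> 0 < eta i <= 1.
Hypothesis T0 : 0 <= T.
Implicit Types F G : I -> R -> R.

(** The small parameter is itself a function of the index: the index will be a whole trajectory, so
    one [C] covers all values of [eta], all initial covectors and all times. *)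
Definition unifO (k : nat) F := exists2 C : R, 0 <= C &
  forall i, D i -> forall t, 0 <= t <= T -> `|F i t| <= C * eta i ^+ k.

Lemma unifO_ext k F G : (forall i, D i -> forall t, 0 <= t <= T -> F i t = G i t) ->
  unifO k F -> unifO k G.
Proof.
by move=> FG [C C0 H]; exists C => // i Di t tT; rewrite -FG//; exact: H.
Qed.

Lemma unifOD k F G : unifO k F -> unifO k G -> unifO k (fun i t => F i t + G i t).
Proof.
move=> [C C0 H] [C' C'0 H']; exists (C + C'); first exact: addr_ge0.
move=> i Di t tT; rewrite (le_trans (ler_normD _ _))// mulrDl.
by rewrite lerD ?H ?H'.
Qed.

Lemma unifON k F : unifO k F -> unifO k (fun i t => - F i t).
Proof. by move=> [C C0 H]; exists C => // i Di t tT; rewrite normrN H. Qed.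

Lemma unifOB k F G : unifO k F -> unifO k G -> unifO k (fun i t => F i t - G i t).
Proof. by move=> FO GO; apply: unifOD => //; exact: unifON. Qed.

Lemma unifOM k l F G : unifO k F -> unifO l G ->
  unifO (k + l) (fun i t => F i t * G i t).
Proof.
move=> [C C0 H] [C' C'0 H']; exists (C * C'); first exact: mulr_ge0.
move=> i Di t tT; rewrite normrM exprD mulrACA.
by rewrite ler_pM// ?H ?H'.
Qed.

Lemma unifO_cst c : unifO 0 (fun _ _ => c).
Proof. by exists `|c| => // i Di t tT; rewrite expr0 mulr1. Qed.

Lemma unifO_eta k : unifO k (fun i _ => eta i ^+ k).
Proof.
exists 1 => // i Di t tT; have /andP[e0 _] := eta01 Di.
by rewrite mul1r ger0_norm// exprn_ge0// ltW.
Qed.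

Lemma unifO_le k l F : (k <= l)%N -> unifO l F -> unifO k F.
Proof.
move=> kl [C C0 H]; exists C => // i Di t tT.
rewrite (le_trans (H i Di t tT))// ler_wpM2l//.
have /andP[e0 e1] := eta01 Di.
by apply: ler_wiXn2l => //; exact: ltW.
Qed.

Lemma unifO0 k : unifO k (fun _ _ => 0).
Proof. by exists 0 => // i Di t tT; rewrite normr0 mul0r. Qed.

Lemma unifO_sum k (J : Type) (s : seq J) (P : pred J) (F : J -> I -> R -> R) :
  (forall j, unifO k (F j)) -> unifO k (fun i t => \sum_(j <- s | P j) F j i t).
Proof.
move=> FO; elim: s => [|j s IH].
  by apply: unifO_ext (unifO0 k) => i Di t tT; rewrite big_nil.
case Pj : (P j); last by apply: unifO_ext IH => i Di t tT; rewrite big_cons Pj.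
by apply: unifO_ext (unifOD (FO j) IH) => i Di t tT; rewrite big_cons Pj.
Qed.

Lemma unifO_fin (J : finType) k (F : J -> I -> R -> R) : (forall j, unifO k (F j)) ->
  exists2 C : R, 0 <= C & forall j i, D i -> forall t, 0 <= t <= T ->
    `|F j i t| <= C * eta i ^+ k.
Proof.
move=> FO; exists (\sum_j s2val (cid2 (FO j))).
  by apply: sumr_ge0 => j _; exact: (s2valP (cid2 (FO j))).
move=> j i Di t tT; have /= := s2valP' (cid2 (FO j)) i Di t tT.
move=> /le_trans; apply; have /andP[e0 _] := eta01 Di.
rewrite ler_wpM2r ?exprn_ge0 ?(ltW e0)// (bigD1 j)//= lerDl.
by apply: sumr_ge0 => l _; exact: (s2valP (cid2 (FO l))).
Qed.

(** Gronwall's constant depends only on the bound for [A] and on [T], so residuals and initial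
    values of order [k] give solutions of the same order, whatever [k] is. *)
Lemma unifO_gronwall k (J : finType) (y dy : J -> I -> R -> R)
    (A : J -> J -> I -> R -> R) :
  (forall j i, D i -> forall t, 0 <= t <= T -> is_derive t 1 (y j i) (dy j i t)) ->
  (forall j l, unifO 0 (A j l)) ->
  (forall j, unifO k (fun i t => dy j i t - \sum_l A j l i t * y l i t)) ->
  (forall j, unifO k (fun i _ => y j i 0)) ->
  forall j, unifO k (y j).
Proof.
move=> Dy AO rO y0O.
have [a a0 Ha] := @unifO_fin (J * J)%type 0%N (fun jl => A jl.1 jl.2) (fun jl => AO _ _).
have [c c0 Hc] := unifO_fin rO.
have [c' c'0 Hc'] := unifO_fin y0O.
have [C C0 HC] := @gronwall R J a T a0 T0.
move=> j; exists (C * (c + c')); first by rewrite mulr_ge0// addr_ge0.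
move=> i Di t tT; have /andP[e0 _] := eta01 Di.
have d0 : 0 <= (c + c') * eta i ^+ k by rewrite mulr_ge0 ?addr_ge0// exprn_ge0// ltW.
have ek : 0 <= eta i ^+ k by rewrite exprn_ge0// ltW.
rewrite -mulrA; apply: (HC (y^~ i) (dy^~ i)) => //.
- move=> l s /andP[s0 st]; apply: Dy => //; rewrite s0 (le_trans st)//.
  by case/andP: tT.
- move=> l s /andP[s0 st].
  have sT : 0 <= s <= T by rewrite s0 (le_trans st)//; case/andP: tT.
  rewrite -[dy l i s](subrK (\sum_p A l p i s * y p i s)) addrC.
  rewrite (le_trans (ler_normD _ _))// lerD//.
    rewrite (le_trans (ler_norm_sum _ _ _))// mulr_sumr ler_sum// => p _.
    rewrite normrM ler_wpM2r//.
    by have := Ha (l, p) i Di s sT; rewrite expr0 mulr1.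
  by rewrite (le_trans (Hc l i Di s sT))// ler_wpM2r// lerDl.
- move=> l; have z0 : 0 <= (0 : R) <= T by rewrite lexx.
  by rewrite (le_trans (Hc' l i Di 0 z0))// ler_wpM2r// lerDr.
Qed.

Lemma unifO_int k (y dy : I -> R -> R) :
  (forall i, D i -> forall t, 0 <= t <= T -> is_derive t 1 (y i) (dy i t)) ->
  unifO k dy -> (forall i, D i -> y i 0 = 0) -> unifO k y.
Proof.
move=> Dy dO y0.
apply: (@unifO_gronwall k unit (fun=> y) (fun=> dy) (fun _ _ _ _ => 0)) => //.
- by move=> _ _; exact: unifO_cst.
- move=> _; apply: unifO_ext dO => i Di t tT.
  by rewrite big1 ?subr0// => l _; rewrite mul0r.
- by move=> _; apply: unifO_ext (unifO0 k) => i Di t tT; rewrite y0.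
Qed.

End BigO.

(** * Locally Lipschitz functions of position and covector *)

Section Lip2.
Context {R : realType} {N : nat}.
Local Notation E := 'rV[R]_N.
Variables a c : E.
Implicit Types f g : E -> E -> R.

Definition lip2 f := exists L rho : R, [/\ 0 <= L, 0 < rho &
  forall x z x' z', `|x - a| <= rho -> `|z - c| <= rho ->
    `|x' - a| <= rho -> `|z' - c| <= rho ->
    `|f x' z' - f x z| <= L * (`|x' - x| + `|z' - z|)].

Lemma lip2_fst (u : E -> R) : lipnear a u -> lip2 (fun x _ => u x).
Proof.
move=> [L [rho [L0 r0 H]]]; exists L, rho; split => // x z x' z' xa _ x'a _.
by rewrite (le_trans (H _ _ xa x'a))// ler_wpM2l// lerDl.
Qed.

Lemma lip2_snd j : lip2 (fun _ z => z 0 j).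
Proof.
exists 1, 1; split => // x z x' z' _ _ _ _; rewrite mul1r.
have := ler_mx_entry (z' - z) 0 j; rewrite mx_entryB => /le_trans; apply.
by rewrite lerDr.
Qed.

Lemma lip2_cst u : lip2 (fun _ _ => u).
Proof.
by exists 0, 1; split => // *; rewrite subrr normr0 mul0r.
Qed.

Lemma lip2D f g : lip2 f -> lip2 g -> lip2 (fun x z => f x z + g x z).
Proof.
move=> [L [r [L0 r0 H]]] [L' [r' [L'0 r'0 H']]].
exists (L + L'), (Order.min r r'); split; first exact: addr_ge0.
  by rewrite lt_min r0.
move=> x z x' z'; rewrite !le_min => /andP[x1 x2] /andP[z1 z2] /andP[y1 y2] /andP[w1 w2].
rewrite opprD addrACA (le_trans (ler_normD _ _))// mulrDl.
by rewrite lerD ?H ?H'.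
Qed.

Lemma lip2N f : lip2 f -> lip2 (fun x z => - f x z).
Proof.
move=> [L [r [L0 r0 H]]]; exists L, r; split => // x z x' z' *.
by rewrite -opprD normrN H.
Qed.

Lemma lip2M f g : lip2 f -> lip2 g -> lip2 (fun x z => f x z * g x z).
Proof.
move=> [L [r [L0 r0 H]]] [L' [r' [L'0 r'0 H']]].
pose M := `|f a c| + L * (r + r); pose M' := `|g a c| + L' * (r' + r').
have M0 : 0 <= M by rewrite addr_ge0// mulr_ge0// addr_ge0// ltW.
have M'0 : 0 <= M' by rewrite addr_ge0// mulr_ge0// addr_ge0// ltW.
exists (M * L' + M' * L), (Order.min r r'); split.
- by rewrite addr_ge0// mulr_ge0.
- by rewrite lt_min r0.
move=> x z x' z'; rewrite !le_min => /andP[x1 x2] /andP[z1 z2] /andP[y1 y2] /andP[w1 w2].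
have aa (s : R) : 0 < s -> `|a - a| <= s by move=> s0; rewrite subrr normr0 ltW.
have cc (s : R) : 0 < s -> `|c - c| <= s by move=> s0; rewrite subrr normr0 ltW.
have fM : `|f x' z'| <= M.
  rewrite -[f x' z'](subrK (f a c)) addrC (le_trans (ler_normD _ _))// lerD2l.
  rewrite (le_trans (H _ _ _ _ (aa _ r0) (cc _ r0) y1 w1))// ler_wpM2l// lerD//.
have gM : `|g x z| <= M'.
  rewrite -[g x z](subrK (g a c)) addrC (le_trans (ler_normD _ _))// lerD2l.
  rewrite (le_trans (H' _ _ _ _ (aa _ r'0) (cc _ r'0) x2 z2))// ler_wpM2l// lerD//.
have -> : f x' z' * g x' z' - f x z * g x z =
  f x' z' * (g x' z' - g x z) + g x z * (f x' z' - f x z) by ring.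
rewrite (le_trans (ler_normD _ _))// !normrM mulrDl -!mulrA.
by rewrite lerD// ler_pM// ?H ?H'.
Qed.

Lemma lip2_sum (I : Type) (s : seq I) (P : pred I) (F : I -> E -> E -> R) :
  (forall i, lip2 (F i)) -> lip2 (fun x z => \sum_(i <- s | P i) F i x z).
Proof.
move=> FL; elim: s => [|i s IH].
  rewrite (_ : (fun _ _ => _) = fun _ _ => 0); first exact: lip2_cst.
  by apply/funext => x; apply/funext => z; rewrite big_nil.
case Pi : (P i).
  rewrite (_ : (fun _ _ => _) = fun x z => F i x z + \sum_(i <- s | P i) F i x z).
    exact: lip2D.
  by apply/funext => x; apply/funext => z; rewrite big_cons Pi.
rewrite (_ : (fun _ _ => _) = fun x z => \sum_(i <- s | P i) F i x z) //.
by apply/funext => x; apply/funext => z; rewrite big_cons Pi.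
Qed.

Lemma lip2_unif (J : finType) (F : J -> E -> E -> R) :
  (forall j, lip2 (F j)) -> exists L rho : R, [/\ 0 <= L, 0 < rho &
  forall j x z x' z', `|x - a| <= rho -> `|z - c| <= rho ->
    `|x' - a| <= rho -> `|z' - c| <= rho ->
    `|F j x' z' - F j x z| <= L * (`|x' - x| + `|z' - z|)].
Proof.
move=> FL.
pose L i := sval (cid (FL i)); have HL i := svalP (cid (FL i)).
pose rh i := sval (cid (HL i)); have Hr i := svalP (cid (HL i)).
have [rho rho0 Hrho] : exists2 rho : R, 0 < rho & forall i, rho <= rh i.
  exists (\big[Order.min/1]_i rh i).
    apply: lt_bigmin => [|i _]; first exact: ltr01.
    by have [] := Hr i.
  by move=> i; exact: bigmin_le.
exists (\sum_i L i), rho; split => //.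
- by apply: sumr_ge0 => i _; have [] := Hr i.
move=> i x z x' z' x1 z1 y1 w1.
have [L0 _ H] := Hr i.
have rh_i : rho <= rh i := Hrho i.
apply: (le_trans (H x z x' z' _ _ _ _)); [exact: le_trans rh_i..|].
rewrite ler_wpM2r ?addr_ge0// (bigD1 i)//= lerDl sumr_ge0// => j _.
by have [] := Hr j.
Qed.

End Lip2.

(** * The Hamiltonian system of a frame *)

Section HamiltonianField.
Context {R : realType} {n : nat}.
Local Notation m := (n.*2).
Local Notation N := (n.*2.+1).
Local Notation E := 'rV[R]_N.

Lemma is_derive_dotp (V : normedModType R) (f g : V -> E) (x v : V) (df dg : E) :
  is_derive x v f df -> is_derive x v g dg ->
  is_derive x v (fun y => dotp (f y) (g y)) (dotp df (g x) + dotp (f x) dg).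
Proof.
move=> Df Dg.
have -> : (fun y => dotp (f y) (g y)) = \sum_(i < N) (fun y => f y 0 i * g y 0 i).
  by apply/funext => y; rewrite fct_sumE.
have -> : dotp df (g x) + dotp (f x) dg =
    \sum_(i < N) (f x 0 i *: dg 0 i + g x 0 i *: df 0 i).
  rewrite /dotp -big_split/=; apply: eq_bigr => i _.
  by rewrite addrC -[_ *: dg 0 i]/(_ * _) -[_ *: df 0 i]/(_ * _) [g x 0 i * _]mulrC.
apply: is_derive_sum => i.
by apply: is_deriveM; exact: is_derive_entry.
Qed.

Lemma dotpC (u v : E) : dotp u v = dotp v u.
Proof. by apply: eq_bigr => i _; rewrite mulrC. Qed.

Lemma dotpDr (u v w : E) : dotp u (v + w) = dotp u v + dotp u w.
Proof. by rewrite /dotp -big_split/=; apply: eq_bigr => i _; rewrite mxE mulrDr. Qed.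

Lemma dotpZr (k : R) (u v : E) : dotp u (k *: v) = k * dotp u v.
Proof. by rewrite /dotp mulr_sumr; apply: eq_bigr => i _; rewrite mxE mulrCA. Qed.

Lemma dotp0 (u : E) : dotp u 0 = 0.
Proof. by rewrite /dotp big1// => i _; rewrite mxE mulr0. Qed.

Lemma dotp_sumr (I : Type) (s : seq I) (P : pred I) (u : E) (F : I -> E) :
  dotp u (\sum_(i <- s | P i) F i) = \sum_(i <- s | P i) dotp u (F i).
Proof.
by elim/big_rec2: _ => [|i y1 y2 _ <-]; [exact: dotp0|exact: dotpDr].
Qed.

Lemma dotp_evec (u : E) j : dotp u (evec j) = u 0 j.
Proof.
rewrite /dotp (bigD1 j)//= big1 => [|i ij]; first by rewrite mxE !eqxx mulr1 addr0.
by rewrite mxE (negbTE ij) andbF mulr0.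
Qed.

Lemma big_zmax (F : 'I_N -> R) : \sum_k F k = \sum_i F (sp i) + F ord_max.
Proof.
rewrite big_ord_recr; congr (_ + _); apply: eq_bigr => i _.
suff -> : widen_ord (leqnSn m) i = sp i by [].
by apply: ord_inj; rewrite /sp lift_max.
Qed.

Variable X : 'I_m -> E -> E.

Definition hfib i (x z : E) : R := dotp z (X i x).

(** The partial derivative of [hfib i] in the position, at fixed covector. It is expanded over the
    entries of the frame so that scalar Taylor estimates apply to each of them. *)
Definition dhfib l i (x z : E) : R :=
  \sum_j z 0 j * 'D_(evec l) (fun y => X i y 0 j) x.

Definition field_x (x z : E) : E := \sum_i hfib i x z *: X i x.

Definition field_p (x z : E) : E := - \row_l \sum_i hfib i x z * dhfib l i x z.

Lemma dhfibE l i x z : derivable (X i) x (evec l) ->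
  dhfib l i x z = dotp z ('D_(evec l) (X i) x).
Proof. by move=> dX; apply: eq_bigr => j _; rewrite derive_entry. Qed.

(** Position and covector vary through arbitrary maps [f] and [g], so that the same formula serves
    for both partial derivatives and for changes of chart. *)
Lemma is_derive_hamiltonian (V : normedModType R) (f g : V -> E) (a v : V)
  (dh : 'I_m -> R) :
  (forall i, is_derive a v (fun y => dotp (g y) (X i (f y))) (dh i)) ->
  is_derive a v (fun y => hamiltonian X (f y) (g y)) (\sum_i hfib i (f a) (g a) * dh i).
Proof.
move=> Dh; rewrite /hamiltonian.
have -> : (fun y => 2^-1 * \sum_i dotp (g y) (X i (f y)) ^+ 2) =
   2^-1 *: \sum_(i < m) (fun y => dotp (g y) (X i (f y)) ^+ 2).
  by apply/funext => y; rewrite -[RHS]/(_ * _) fct_sumE.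
have -> : \sum_i hfib i (f a) (g a) * dh i = 2^-1 *: \sum_(i < m)
    (dotp (g a) (X i (f a)) *: dh i + dotp (g a) (X i (f a)) *: dh i).
  rewrite -[RHS]/(_ * _) mulr_sumr; apply: eq_bigr => i _.
  by rewrite -[_ *: dh i]/(_ * dh i) /hfib; field.
apply: is_deriveZ; apply: is_derive_sum => i.
rewrite (_ : (fun y => _) = (fun y => dotp (g y) (X i (f y))) * (fun y => dotp (g y) (X i (f y)))).
  exact: is_deriveM.
by apply/funext => y; rewrite expr2.
Qed.

Lemma hamiltonian_dp (x z : E) j :
  'D_(evec j) (fun p => hamiltonian X x p) z = field_x x z 0 j.
Proof.
have D : is_derive z (evec j) (fun p => hamiltonian X x p)
    (\sum_i hfib i x z * (dotp (evec j) (X i x) + dotp z 0)).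
  apply: (@is_derive_hamiltonian _ (fun=> x) id) => i.
  by apply: is_derive_dotp.
rewrite (@derive_val _ _ _ _ _ _ _ D) /field_x summxE; apply: eq_bigr => i _.
by rewrite dotp0 addr0 dotpC dotp_evec mxE.
Qed.

Lemma hamiltonian_dx (x z : E) j : (forall i, differentiable (X i) x) ->
  'D_(evec j) (fun y => hamiltonian X y z) x = - field_p x z 0 j.
Proof.
move=> dX.
have D : is_derive x (evec j) (fun y => hamiltonian X y z)
    (\sum_i hfib i x z * (dotp 0 (X i x) + dotp z ('D_(evec j) (X i) x))).
  apply: (@is_derive_hamiltonian _ id (fun=> z)) => i.
  apply: is_derive_dotp.
  by apply: derivableP; exact: diff_derivable.
rewrite (@derive_val _ _ _ _ _ _ _ D) /field_p !mxE opprK; apply: eq_bigr => i _.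
by rewrite dotpC dotp0 add0r dhfibE//; exact: diff_derivable.
Qed.

End HamiltonianField.

Section Eventually.
Context {R : realType} {N : nat}.
Local Notation E := 'rV[R]_N.

(* [Q C y] holds for all large C and all small y, jointly. *)
Definition large_small (Q : R -> E -> Prop) := exists C rho : R,
  [/\ 0 <= C, 0 < rho & forall C' y, C <= C' -> `|y| <= rho -> Q C' y].

Lemma large_small_and Q Q' : large_small Q -> large_small Q' ->
  large_small (fun C y => Q C y /\ Q' C y).
Proof.
move=> [C [r [C0 r0 H]]] [C' [r' [C'0 r'0 H']]].
exists (C + C'), (Order.min r r'); split; first exact: addr_ge0.
  by rewrite lt_min r0.
move=> D y CD; rewrite le_min => /andP[y1 y2]; split.
  by apply: H => //; rewrite (le_trans _ CD)// lerDl.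
by apply: H' => //; rewrite (le_trans _ CD)// lerDr.
Qed.

Lemma large_small_forall (J : finType) (Q : J -> R -> E -> Prop) :
  (forall j, large_small (Q j)) -> large_small (fun C y => forall j, Q j C y).
Proof.
move=> QE.
have : large_small (fun C y => forall j, j \in enum J -> Q j C y).
  elim: (enum J) => [|j s IH]; first by exists 0, 1; split.
  have [C [r [C0 r0 H]]] := large_small_and (QE j) IH.
  exists C, r; split => // C' y CC' yr k; rewrite inE => /orP[/eqP->|ks].
    by have [] := H C' y CC' yr.
  by have [_] := H C' y CC' yr; apply.
move=> [C [r [C0 r0 H]]]; exists C, r; split => // C' y CC' yr j.
by apply: H => //; rewrite mem_enum.
Qed.

Lemma large_small_nbhs (P : E -> Prop) : (\forall y \near (0 : E), P y) ->
  large_small (fun _ => P).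
Proof.
move=> /nbhs_cball[r r0 rP]; exists 0, r; split => // C y _ yr.
by apply: rP; rewrite subr0.
Qed.

Lemma large_small_lip (f : E -> R) : lipnear 0 f ->
  large_small (fun C y => `|f y - f 0| <= C * `|y|).
Proof.
move=> [L [r [L0 r0 H]]]; exists L, r; split => // C y LC yr.
have := H 0 y; rewrite !subr0 normr0 => /(_ (ltW r0) yr)/le_trans; apply.
by rewrite ler_wpM2r.
Qed.

Lemma large_small_taylor (f : E -> R) : C2near 0 f ->
  large_small (fun C y =>
    `|f y - f 0 - \sum_k y 0 k * 'D_(evec k) f 0| <= C * `|y| ^+ 2).
Proof.
move=> /taylor2[L [r [L0 r0 H]]]; exists L, r; split => // C y LC yr.
have := H y; rewrite !subr0 => /(_ yr)/le_trans; apply.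
by rewrite ler_wpM2r// exprn_ge0.
Qed.

End Eventually.

(** * Expansion of rescaled solutions *)

Section Asymptotics.
Context {R : realType} {n : nat}.
Local Notation m := (n.*2).
Local Notation N := (n.*2.+1).
Local Notation E := 'rV[R]_N.
Local Notation e0 := (@dz R n).
(** The hypotheses below collect the value and the first derivatives of the frame at the origin; the
    section [NormalFormFacts] extracts them from the normal form. *)
Variables (X : 'I_m -> E -> E) (b : 'I_n -> R) (U : set E).
Hypothesis Uo : open U.
Hypothesis U0 : U 0.
Hypothesis XS : forall i j, Ck 3 U (fun y => X i y 0 j).
Hypothesis X0 : forall i, X i 0 = evec (sp i).
Hypothesis DXh : forall i j l, 'D_(evec l) (fun y => X i y 0 (sp j)) 0 = 0.
Hypothesis DXz : forall i, 'D_(evec ord_max) (fun y => X i y 0 ord_max) 0 = 0.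
Hypothesis DXJ : forall i k,
  'D_(evec (sp k)) (fun y => X i y 0 ord_max) 0 = 2^-1 * Jbar b i k.

Let Xc i j (y : E) := X i y 0 j.
Let DX l i j := 'D_(evec l) (Xc i j).

Let XS1 i j : Ck 1 U (Xc i j).
Proof.
have [d1 d2] := XS i j; split; first exact: d1.
by move=> v x Ux; have [d3 _] := d2 v; apply/differentiable_continuous/d3.
Qed.

Let XS2 i j : Ck 2 U (Xc i j).
Proof.
have [d1 d2] := XS i j; split; first exact: d1.
move=> v; have [d3 d4] := d2 v; split => // w x Ux.
by have [d5 _] := d4 w; apply/differentiable_continuous/d5.
Qed.

Let DS2 l i j : Ck 2 U (DX l i j).
Proof. by have [_] := XS i j; apply. Qed.

Let DS1 l i j : Ck 1 U (DX l i j).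
Proof.
have [d1 d2] := DS2 l i j; split; first exact: d1.
by move=> v x Ux; have [d3 _] := d2 v; apply/differentiable_continuous/d3.
Qed.

Lemma frame_differentiable i x : U x -> differentiable (X i) x.
Proof.
move=> Ux; apply: differentiable_row => j.
by have [d1 _] := XS i j; apply: d1; exact: mem_set.
Qed.

Lemma sp_max (i : 'I_m) : (sp i == ord_max) = false.
Proof. by apply/negbTE; rewrite eq_sym neq_lift. Qed.

Lemma dz_sp i : e0 0 (sp i) = 0.
Proof. by rewrite mxE eqxx sp_max. Qed.

Lemma dz_max : e0 0 ord_max = 1.
Proof. by rewrite mxE !eqxx. Qed.

Lemma hfibE i x z : hfib X i x z =
  \sum_a z 0 (sp a) * Xc i (sp a) x + z 0 ord_max * Xc i ord_max x.
Proof. exact: big_zmax. Qed.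

Lemma dhfibE2 l i x z : dhfib X l i x z =
  \sum_a z 0 (sp a) * DX l i (sp a) x + z 0 ord_max * DX l i ord_max x.
Proof. exact: big_zmax. Qed.

Lemma Xc0 i j : Xc i j 0 = (j == sp i)%:R.
Proof. by rewrite /Xc X0 mxE eqxx. Qed.

Lemma Xc0_sp i j : Xc i (sp j) 0 = (j == i)%:R.
Proof. by rewrite Xc0 (inj_eq lift_inj). Qed.

Lemma Xc0_max i : Xc i ord_max 0 = 0.
Proof. by rewrite Xc0 eq_sym sp_max. Qed.

Lemma hfib0 i : hfib X i 0 e0 = 0.
Proof.
rewrite hfibE Xc0_max mulr0 addr0 big1// => a _.
by rewrite dz_sp mul0r.
Qed.

Let lip2_Xc i j : lip2 0 e0 (fun x _ => Xc i j x).
Proof. by apply: lip2_fst; exact: (@Ck1_lipnear _ _ U). Qed.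

Let lip2_DX l i j : lip2 0 e0 (fun x _ => DX l i j x).
Proof. by apply: lip2_fst; exact: (@Ck1_lipnear _ _ U). Qed.

Lemma lip2_hfib i : lip2 0 e0 (hfib X i).
Proof. by apply: lip2_sum => j; apply: lip2M (lip2_snd _ _ j) (lip2_Xc i j). Qed.

Lemma lip2_dhfib l i : lip2 0 e0 (dhfib X l i).
Proof. by apply: lip2_sum => j; apply: lip2M (lip2_snd _ _ j) (lip2_DX l i j). Qed.

Definition field (j : 'I_N + 'I_N) (x z : E) : R :=
  match j with inl j => field_x X x z 0 j | inr j => field_p X x z 0 j end.

Lemma field_xE x z j : field_x X x z 0 j = \sum_i hfib X i x z * Xc i j x.
Proof. by rewrite /field_x summxE; apply: eq_bigr => i _; rewrite mxE. Qed.

Lemma field_pE x z j : field_p X x z 0 j = - \sum_i hfib X i x z * dhfib X j i x z.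
Proof. by rewrite !mxE. Qed.

Lemma lip2_field j : lip2 0 e0 (field j).
Proof.
case: j => j.
  rewrite (_ : field (inl j) = fun x z => \sum_i hfib X i x z * Xc i j x).
    by apply: lip2_sum => i; apply: lip2M (lip2_hfib i) (lip2_Xc i j).
  by apply/funext => x; apply/funext => z; exact: field_xE.
rewrite (_ : field (inr j) = fun x z => - \sum_i hfib X i x z * dhfib X j i x z).
  apply: lip2N; apply: lip2_sum => i.
  exact: lip2M (lip2_hfib i) (lip2_dhfib j i).
by apply/funext => x; apply/funext => z; exact: field_pE.
Qed.

Lemma field0 j : field j 0 e0 = 0.
Proof.
by case: j => j /=; rewrite ?field_xE ?field_pE big1 ?oppr0// => i _; rewrite hfib0 mul0r.
Qed.

(** One constant and one radius serve all entries, so a trajectory confined to radius [rho] inherits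
    every estimate at once. *)
Definition frame_estimate (C rho : R) := [/\ 0 <= C, 0 < rho,
  forall x, `|x| <= rho -> [/\ U x,
    forall k : 'I_m * 'I_N, `|Xc k.1 k.2 x - Xc k.1 k.2 0| <= C * `|x|,
    forall k : 'I_N * 'I_m * 'I_N,
      `|DX k.1.1 k.1.2 k.2 x - DX k.1.1 k.1.2 k.2 0| <= C * `|x|,
    forall k : 'I_m * 'I_N, `|Xc k.1 k.2 x - Xc k.1 k.2 0 -
      \sum_l x 0 l * 'D_(evec l) (Xc k.1 k.2) 0| <= C * `|x| ^+ 2 &
    forall k : 'I_N * 'I_m * 'I_N,
      `|DX k.1.1 k.1.2 k.2 x - DX k.1.1 k.1.2 k.2 0 -
      \sum_l x 0 l * 'D_(evec l) (DX k.1.1 k.1.2 k.2) 0| <= C * `|x| ^+ 2] &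
  forall j x z x' z', `|x| <= rho -> `|z - e0| <= rho ->
    `|x'| <= rho -> `|z' - e0| <= rho ->
    `|field j x' z' - field j x z| <= C * (`|x' - x| + `|z' - z|)].

Lemma frame_estimates : exists C rho : R, frame_estimate C rho.
Proof.
have [L [r [L0 r0 HL]]] := lip2_unif lip2_field.
have A1 := large_small_forall (fun k : 'I_m * 'I_N =>
  large_small_lip (Ck1_lipnear Uo U0 (XS1 k.1 k.2))).
have A2 := large_small_forall (fun k : 'I_N * 'I_m * 'I_N =>
  large_small_lip (Ck1_lipnear Uo U0 (DS1 k.1.1 k.1.2 k.2))).
have A3 := large_small_forall (fun k : 'I_m * 'I_N =>
  large_small_taylor (Ck2_C2near Uo U0 (XS2 k.1 k.2))).
have A4 := large_small_forall (fun k : 'I_N * 'I_m * 'I_N =>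
  large_small_taylor (Ck2_C2near Uo U0 (DS2 k.1.1 k.1.2 k.2))).
have A5 := large_small_nbhs (open_nbhs_nbhs (conj Uo U0)).
have [C [rho [C0 rho0 H]]] := large_small_and (large_small_and A1 A2)
  (large_small_and (large_small_and A3 A4) A5).
exists (L + C), (Order.min r rho); split.
- exact: addr_ge0.
- by rewrite lt_min r0.
- move=> x; rewrite le_min => /andP[_ xr].
  by have [|[? ?] [[? ?] ?]] := H (L + C) x _ xr; first by rewrite lerDr.
move=> j x z x' z'; rewrite !le_min => /andP[x1 _] /andP[z1 _] /andP[y1 _] /andP[w1 _].
apply: (@le_trans _ _ (L * (`|x' - x| + `|z' - z|))).
  by apply: HL => //; rewrite subr0.
by rewrite ler_wpM2r ?addr_ge0// lerDl.
Qed.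

Lemma mx_norm_sum (k : nat) (x : 'rV[R]_k) : `|x| <= \sum_j `|x 0 j|.
Proof.
apply: mx_norm_le => [|i j]; first exact: sumr_ge0.
by rewrite ord1 (bigD1 j)//= lerDl sumr_ge0.
Qed.

(** The assumptions bear on [[0, t]] only, with a constant independent of [t], as a continuation
    argument requires. The velocities are abstract because the bound is also applied to a truncated
    field. *)
Lemma apriori (L T : R) : 0 <= L -> 0 <= T -> exists2 C0 : R, 0 <= C0 &
  forall (x z dx dp : R -> E) (d t : R), 0 <= d -> 0 <= t <= T ->
  (forall j s, 0 <= s <= t -> is_derive s 1 (fun s => x s 0 j) (dx s 0 j)) ->
  (forall j s, 0 <= s <= t -> is_derive s 1 (fun s => z s 0 j) (dp s 0 j)) ->
  (forall j s, 0 <= s <= t -> `|dx s 0 j| <= L * (`|x s| + `|z s - e0|)) ->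
  (forall j s, 0 <= s <= t -> `|dp s 0 j| <= L * (`|x s| + `|z s - e0|)) ->
  `|x 0| <= d -> `|z 0 - e0| <= d -> `|x t| <= C0 * d /\ `|z t - e0| <= C0 * d.
Proof.
move=> L0 T0; have [C C0 HC] := @gronwall R ('I_N + 'I_N)%type L T L0 T0.
exists C => // x z dx dp d t d0 tT Dx Dz Bx Bz x0 z0.
pose y (j : 'I_N + 'I_N) s :=
  match j with inl j => x s 0 j | inr j => z s 0 j - e0 0 j end.
pose dy (j : 'I_N + 'I_N) s :=
  match j with inl j => dx s 0 j | inr j => dp s 0 j - 0 end.
have B s : `|x s| + `|z s - e0| <= \sum_j `|y j s|.
  rewrite big_sumType/= lerD ?mx_norm_sum//.
  apply: le_trans (mx_norm_sum _) _; apply: ler_sum => j _.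
  by rewrite mx_entryB.
have Cd : 0 <= C * d by exact: mulr_ge0.
have H : forall j, `|y j t| <= C * d.
  apply: (HC y dy) => //.
  - move=> [j|j] s st; first exact: Dx.
    by apply: derB; exact: Dz.
  - move=> [j|j] s st /=; rewrite -[leLHS]addr0 lerD// ?subr0.
      by rewrite (le_trans (Bx _ _ st))// ler_wpM2l.
    by rewrite (le_trans (Bz _ _ st))// ler_wpM2l.
  - move=> [j|j] /=; first by rewrite (le_trans (ler_mx_entry _ _ _)).
    by rewrite -mx_entryB (le_trans (ler_mx_entry _ _ _)).
split; apply: mx_norm_le => // i j; rewrite ord1; first exact: (H (inl j)).
by rewrite mx_entryB; exact: (H (inr j)).
Qed.

(** [ball_h] bounds the squared norm; [r + 1] stands for the square root of [r]. *)
Lemma ball_h_entry (r : R) (h : 'cV[R]_m) i : ball_h r h -> `|h i 0| <= r + 1.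
Proof.
rewrite /ball_h/= => hr.
have hi : h i 0 ^+ 2 <= r.
  by rewrite (le_trans _ hr)// (bigD1 i)//= lerDl sumr_ge0// => j _; exact: sqr_ge0.
have r0 : 0 <= r by rewrite (le_trans _ hi)// sqr_ge0.
rewrite -(@ler_pXn2r _ 2)// ?nnegrE ?addr_ge0// real_normK ?num_real//.
by rewrite (le_trans hi)//; nra.
Qed.

(* A solution [(t_x, t_z)] of the Hamiltonian system in the rescaled variables:
   time is divided by [eta] and the covector multiplied by [eta], so that it
   starts at [(eta h, 1)], near the equilibrium [dz]. *)
Record trajectory := Trajectory {
  t_eta : R; t_h : 'cV[R]_m; t_x : R -> E; t_z : R -> E }.

Variables (C rho T r : R).
Hypothesis FE : frame_estimate C rho.
Hypothesis T0 : 0 <= T.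
Hypothesis b0 : forall i, b i != 0.

Definition valid (tr : trajectory) :=
  [/\ 0 < t_eta tr <= 1, ball_h r (t_h tr), t_x tr 0 = 0,
    (forall i, t_z tr 0 0 (sp i) = t_eta tr * t_h tr i 0) /\ t_z tr 0 0 ord_max = 1 &
    forall t, 0 <= t <= T -> [/\ `|t_x tr t| <= rho, `|t_z tr t - e0| <= rho,
      forall j, is_derive t 1 (fun s => t_x tr s 0 j) (field_x X (t_x tr t) (t_z tr t) 0 j) &
      forall j, is_derive t 1 (fun s => t_z tr s 0 j) (field_p X (t_x tr t) (t_z tr t) 0 j)]].

Let O k (F : trajectory -> R -> R) := unifO valid t_eta T k F.

Let eta01 tr : valid tr -> 0 < t_eta tr <= 1.
Proof. by case. Qed.

Let C0 : 0 <= C. Proof. by case: FE. Qed.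
Let rho0 : 0 < rho. Proof. by case: FE. Qed.

Lemma field_bound j x z : `|x| <= rho -> `|z - e0| <= rho ->
  `|field j x z| <= C * (`|x| + `|z - e0|).
Proof.
move=> xr zr; have [_ _ _ H] := FE.
have := H j 0 e0 x z; rewrite normr0 subrr normr0 field0 !subr0.
by apply=> //; exact: ltW.
Qed.

Lemma O_norms : O 1 (fun tr t => `|t_x tr t|) /\ O 1 (fun tr t => `|t_z tr t - e0|).
Proof.
have [K K0 HK] := apriori C0 T0.
suff H tr t : valid tr -> 0 <= t <= T -> `|t_x tr t| <= K * (r + 1) * t_eta tr ^+ 1 /\
     `|t_z tr t - e0| <= K * (r + 1) * t_eta tr ^+ 1.
  split; exists (`|K * (r + 1)|) => // tr v t tT; rewrite normr_id;
    have /andP[e0' _] := eta01 v; have [H1 H2] := H tr t v tT.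
    by rewrite (le_trans H1)// ler_wpM2r ?ler_norm// expr1 ltW.
  by rewrite (le_trans H2)// ler_wpM2r ?ler_norm// expr1 ltW.
move=> [/andP[e0' e1] hr x0 [z0 z0m] D] tT.
have r0 : 0 <= r.
  by rewrite (le_trans _ hr)// sumr_ge0// => j _; exact: sqr_ge0.
have sub s : 0 <= s <= t -> 0 <= s <= T.
  by case/andP: tT => _ tT /andP[-> st]; exact: le_trans tT.
have d0 : 0 <= (r + 1) * t_eta tr by rewrite mulr_ge0 ?addr_ge0// ltW.
rewrite expr1 -!mulrA.
apply: (HK (t_x tr) (t_z tr) (fun s => field_x X (t_x tr s) (t_z tr s))
  (fun s => field_p X (t_x tr s) (t_z tr s))) => //.
- by move=> j s /sub/D[].
- by move=> j s /sub/D[].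
- by move=> j s /sub/D[? ? _ _]; exact: (field_bound (inl j)).
- by move=> j s /sub/D[? ? _ _]; exact: (field_bound (inr j)).
- by rewrite x0 normr0.
apply: mx_norm_le => // i j; rewrite ord1 mx_entryB.
have [k ->|->] := unliftP ord_max j.
  rewrite -/(sp k) z0 dz_sp subr0 normrM (gtr0_norm e0') mulrC.
  by rewrite ler_wpM2r ?(ltW e0')// ball_h_entry.
by rewrite z0m dz_max subrr normr0.
Qed.

Lemma O_x j : O 1 (fun tr t => t_x tr t 0 j).
Proof.
have [[K K0 H] _] := O_norms; exists K => // tr v t tT.
by rewrite (le_trans (ler_mx_entry _ _ _))// (le_trans _ (H tr v t tT))// normr_id.
Qed.

Lemma O_ze j : O 1 (fun tr t => t_z tr t 0 j - e0 0 j).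
Proof.
have [_ [K K0 H]] := O_norms; exists K => // tr v t tT.
rewrite -mx_entryB (le_trans (ler_mx_entry _ _ _))//.
by rewrite (le_trans _ (H tr v t tT))// normr_id.
Qed.

Lemma O_zsp a : O 1 (fun tr t => t_z tr t 0 (sp a)).
Proof.
by apply: unifO_ext (O_ze (sp a)) => tr _ t _; rewrite dz_sp subr0.
Qed.

Lemma O_lip (f : E -> R) :
  (forall x, `|x| <= rho -> `|f x - f 0| <= C * `|x|) ->
  O 1 (fun tr t => f (t_x tr t) - f 0).
Proof.
move=> H; have [[K K0 HK] _] := O_norms.
exists (C * K); first exact: mulr_ge0.
move=> tr v t tT; have [_ _ _ _ /(_ t tT)[xr _ _ _]] := v.
rewrite (le_trans (H _ xr))// -mulrA ler_wpM2l//.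
by rewrite (le_trans _ (HK tr v t tT))// normr_id.
Qed.

Lemma O_tay (f : E -> R) :
  (forall x, `|x| <= rho ->
    `|f x - f 0 - \sum_l x 0 l * 'D_(evec l) f 0| <= C * `|x| ^+ 2) ->
  O 2 (fun tr t => f (t_x tr t) - f 0 - \sum_l t_x tr t 0 l * 'D_(evec l) f 0).
Proof.
move=> H; have [[K K0 HK] _] := O_norms.
exists (C * K ^+ 2); first by rewrite mulr_ge0// exprn_ge0.
move=> tr v t tT; have [_ _ _ _ /(_ t tT)[xr _ _ _]] := v.
rewrite (le_trans (H _ xr))// -mulrA ler_wpM2l// -exprMn.
have := HK tr v t tT; rewrite normr_id expr1 => xK.
by rewrite lerXn2r ?nnegrE// (le_trans _ xK).
Qed.

Lemma O1_0 F : O 1 F -> O 0 F.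
Proof. exact: unifO_le. Qed.

Lemma O2_1 F : O 2 F -> O 1 F.
Proof. exact: unifO_le. Qed.

Lemma O_const c : O 0 (fun _ _ => c).
Proof. exact: unifO_cst. Qed.

Lemma O_addc k F c : O k (fun tr t => F tr t - c) -> O 0 F.
Proof.
move=> FO; apply: unifO_ext (unifOD (unifO_le (l := k) eta01 _ FO) (O_const c)) => //.
by move=> tr _ t _; rewrite subrK.
Qed.

Lemma O_X i j : O 1 (fun tr t => Xc i j (t_x tr t) - Xc i j 0).
Proof.
by apply: O_lip => x xr; have [_ _ /(_ x xr)[_ /(_ (i, j)) H _ _ _] _] := FE.
Qed.

Lemma O_DX l i j : O 1 (fun tr t => DX l i j (t_x tr t) - DX l i j 0).
Proof.
by apply: O_lip => x xr; have [_ _ /(_ x xr)[_ _ /(_ (l, i, j)) H _ _] _] := FE.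
Qed.

(** The linear Taylor term vanishes by [DXh]: the horizontal part of the frame is the coordinate
    frame up to second order. *)
Lemma O_Xh i j : O 2 (fun tr t => Xc i (sp j) (t_x tr t) - (j == i)%:R).
Proof.
have : O 2 (fun tr t => Xc i (sp j) (t_x tr t) - Xc i (sp j) 0 -
    \sum_l t_x tr t 0 l * 'D_(evec l) (Xc i (sp j)) 0).
  by apply: O_tay => x xr; have [_ _ /(_ x xr)[_ _ _ /(_ (i, sp j)) H _] _] := FE.
apply: unifO_ext => tr _ t _; rewrite Xc0_sp big1 ?subr0// => l _.
by rewrite DXh mulr0.
Qed.

Lemma O_Xz i : O 1 (fun tr t => Xc i ord_max (t_x tr t)).
Proof. by apply: unifO_ext (O_X i ord_max) => tr _ t _; rewrite Xc0_max subr0. Qed.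

Lemma O_DXh l i j : O 1 (fun tr t => DX l i (sp j) (t_x tr t)).
Proof. by apply: unifO_ext (O_DX l i (sp j)) => tr _ t _; rewrite [DX _ _ _ 0]DXh subr0. Qed.

Lemma O_DXz i : O 1 (fun tr t => DX ord_max i ord_max (t_x tr t)).
Proof.
by apply: unifO_ext (O_DX ord_max i ord_max) => tr _ t _; rewrite [DX _ _ _ 0]DXz subr0.
Qed.

Let g i tr t := hfib X i (t_x tr t) (t_z tr t).
Let dg l i tr t := dhfib X l i (t_x tr t) (t_z tr t).

Lemma O_zmax0 : O 0 (fun tr t => t_z tr t 0 ord_max).
Proof. by apply: (@O_addc 1 _ (e0 0 ord_max)); exact: O_ze. Qed.

Lemma O_g i : O 1 (g i).
Proof.
apply: (@unifO_ext _ _ _ _ _ 1 (fun tr t => \sum_a t_z tr t 0 (sp a) * Xc i (sp a) (t_x tr t)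
  + t_z tr t 0 ord_max * Xc i ord_max (t_x tr t))).
  by move=> tr _ t _; rewrite /g hfibE.
apply: unifOD; last exact: (unifOM O_zmax0 (O_Xz i)).
apply: unifO_sum => a; apply: (unifOM (k := 1) (l := 0) (O_zsp a)).
exact: O_addc (O_X i (sp a)).
Qed.

Lemma O_dg1 l i : O 1 (fun tr t => dg l i tr t - DX l i ord_max (t_x tr t)).
Proof.
apply: (@unifO_ext _ _ _ _ _ 1 (fun tr t => \sum_a t_z tr t 0 (sp a) * DX l i (sp a) (t_x tr t)
  + (t_z tr t 0 ord_max - 1) * DX l i ord_max (t_x tr t))).
  by move=> tr _ t _; rewrite /dg dhfibE2 mulrBl mul1r addrA.
apply: unifOD.
  apply: unifO_sum => a; apply: (unifOM (k := 1) (l := 0) (O_zsp a)).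
  exact: O1_0 (O_DXh _ _ _).
apply: (unifOM (k := 1) (l := 0)); last exact: O_addc (O_DX _ _ _).
by apply: unifO_ext (O_ze ord_max) => tr _ t _; rewrite dz_max.
Qed.

Lemma O_dgz i : O 1 (dg ord_max i).
Proof.
apply: unifO_ext (unifOD (O_dg1 ord_max i) (O_DXz i)) => tr _ t _.
by rewrite subrK.
Qed.

Let valid_dx tr : valid tr -> forall t, 0 <= t <= T -> forall j,
  is_derive t 1 (fun s => t_x tr s 0 j) (\sum_i g i tr t * Xc i j (t_x tr t)).
Proof. by move=> [_ _ _ _ D] t /D[_ _ + _] j => /(_ j); rewrite field_xE. Qed.

Let valid_dz tr : valid tr -> forall t, 0 <= t <= T -> forall j,
  is_derive t 1 (fun s => t_z tr s 0 j) (- \sum_i g i tr t * dg j i tr t).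
Proof. by move=> [_ _ _ _ D] t /D[_ _ _ +] j => /(_ j); rewrite field_pE. Qed.

(** Each term of the derivative has two factors of order 1: [g] vanishes at the equilibrium, and so
    does [dg ord_max], because the first [z]-derivatives of the frame vanish at the origin. *)
Lemma O_zmax : O 2 (fun tr t => t_z tr t 0 ord_max - 1).
Proof.
apply: (@unifO_int _ _ _ _ _ eta01 T0 2 _
  (fun tr t => - (\sum_i g i tr t * dg ord_max i tr t) - 0)).
- by move=> tr v t tT; apply: derB; exact: valid_dz.
- apply: unifO_ext (unifON (unifO_sum _ _ (fun i => unifOM (O_g i) (O_dgz i)))).
  by move=> tr _ t _; rewrite subr0.
- by move=> tr [_ _ _ [_ ->] _]; rewrite subrr.
Qed.

Lemma O_xmax : O 2 (fun tr t => t_x tr t 0 ord_max).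
Proof.
apply: (@unifO_int _ _ _ _ _ eta01 T0 2 _
  (fun tr t => \sum_i g i tr t * Xc i ord_max (t_x tr t))).
- by move=> tr v t tT; exact: valid_dx.
- exact: (unifO_sum _ _ (fun i => unifOM (O_g i) (O_Xz i))).
- by move=> tr [_ _ -> _ _]; rewrite mxE.
Qed.

(** [O_dg1] served to prove [O_zmax], which in return improves it by one order. *)
Lemma O_dg2 l i : O 2 (fun tr t => dg l i tr t - DX l i ord_max (t_x tr t)).
Proof.
apply: (@unifO_ext _ _ _ _ _ 2 (fun tr t => \sum_a t_z tr t 0 (sp a) * DX l i (sp a) (t_x tr t)
  + (t_z tr t 0 ord_max - 1) * DX l i ord_max (t_x tr t))).
  by move=> tr _ t _; rewrite /dg dhfibE2 mulrBl mul1r addrA.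
apply: unifOD.
  by apply: unifO_sum => a; apply: (unifOM (k := 1) (l := 1) (O_zsp a)); exact: O_DXh.
by apply: (unifOM (k := 2) (l := 0) O_zmax); exact: O_addc (O_DX _ _ _).
Qed.

Lemma O_dg0 l i : O 0 (dg l i).
Proof.
apply: unifO_ext (unifOD (O1_0 (O_dg1 l i)) (O_addc (O_DX l i ord_max))) => tr _ t _.
by rewrite subrK.
Qed.

Lemma DX_schwarz i j k : 'D_(evec (sp k)) (DX (sp j) i ord_max) 0 = d2z X i j k.
Proof.
have [d1 d2] := XS i ord_max.
apply: schwarz.
- by apply: filterS (open_nbhs_nbhs (conj Uo U0)) => y Uy; apply: d1; exact: mem_set.
- by have [d3 _] := d2 (evec (sp j)); apply: d3; exact: mem_set.
- by have [d3 _] := d2 (evec (sp k)); apply: d3; exact: mem_set.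
Qed.

Lemma O_DXsp i j : O 2 (fun tr t => DX (sp j) i ord_max (t_x tr t) -
  (2^-1 * Jbar b i j + \sum_k d2z X i j k * t_x tr t 0 (sp k))).
Proof.
have A1 : O 2 (fun tr t => DX (sp j) i ord_max (t_x tr t) - DX (sp j) i ord_max 0 -
    \sum_l t_x tr t 0 l * 'D_(evec l) (DX (sp j) i ord_max) 0).
  apply: O_tay => x xr.
  by have [_ _ /(_ x xr)[_ _ _ _ /(_ (sp j, i, ord_max)) H] _] := FE.
(* The [z] term of the linear Taylor part is already of order 2, so only horizontal second
   derivatives remain. *)
have A2 := unifOM O_xmax (O_const ('D_(evec ord_max) (DX (sp j) i ord_max) 0)).
apply: unifO_ext (unifOD A1 A2) => tr _ t _.
rewrite [DX _ _ _ 0]DXJ big_zmax.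
under eq_bigr do rewrite DX_schwarz mulrC.
by rewrite opprD addrA opprD addrA subrK.
Qed.

(** The covector paired with the derivative of $X_i$ along $X_j$. *)
Let Pij i j tr t := \sum_l Xc j l (t_x tr t) * dg l i tr t.

Lemma O_P i j : O 2 (fun tr t => Pij i j tr t -
  (2^-1 * Jbar b i j + \sum_k d2z X i j k * t_x tr t 0 (sp k))).
Proof.
have A1 := unifO_sum (index_enum 'I_m) xpredT
  (fun a => unifOM (O_Xh j a) (O_dg0 (sp a) i)).
have A2 := unifOM (O_Xz j) (O_dgz i).
have A3 := O_dg2 (sp j) i.
apply: unifO_ext (unifOD (unifOD A1 A2) (unifOD A3 (O_DXsp i j))) => tr _ t _.
rewrite /Pij big_zmax.
have -> : \sum_a (Xc j (sp a) (t_x tr t) - (a == j)%:R) * dg (sp a) i tr t =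
    \sum_a Xc j (sp a) (t_x tr t) * dg (sp a) i tr t - dg (sp j) i tr t.
  under eq_bigr do rewrite mulrBl; rewrite sumrB; congr (_ - _).
  rewrite (bigD1 j)//= eqxx mul1r big1 ?addr0// => a /negbTE->.
  by rewrite mul0r.
have alg (p q u v w : R) : p - u + q + (u - v + (v - w)) = p + q - w by ring.
exact: alg.
Qed.

(** The covector paired with the bracket $[X_j,X_i]$; [is_derive_g] is then the Poisson bracket
    formula for the derivative of $g_i$ along the flow. *)
Let Bij i j tr t := Pij i j tr t - Pij j i tr t.

Lemma Jbar_skew i j : Jbar b j i = - Jbar b i j.
Proof.
rewrite /Jbar !summxE -sumrN; apply: eq_bigr => k _.
by rewrite !mxE ![(j == _) && _]andbC; ring.
Qed.

Lemma O_B i j : O 2 (fun tr t => Bij i j tr t -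
  (Jbar b i j + J1 X (xpart (t_x tr t)) i j)).
Proof.
apply: unifO_ext (unifOB (O_P i j) (O_P j i)) => tr _ t _.
rewrite [J1 _ _ _ _]mxE Jbar_skew.
under [X in _ = _ - (_ + X)]eq_bigr do rewrite mulrBl [xpart _ _ _]mxE.
have alg (p p' a q q' : R) : p - (2^-1 * - a + q) - (p' - (2^-1 * a + q')) =
  p - p' - (- a + (q - q')) by field.
rewrite sumrB; exact: alg.
Qed.

Lemma is_derive_g tr i t : valid tr -> 0 <= t <= T ->
  is_derive t 1 (g i tr) (\sum_j Bij i j tr t * g j tr t).
Proof.
move=> v tT; have [_ _ _ _ /(_ t tT)[xr _ Dx Dz]] := v.
have [_ _ /(_ _ xr)[Ux _ _ _ _] _] := FE.
have dXi := frame_differentiable i Ux.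
have Dx' : is_derive t 1 (t_x tr) (field_x X (t_x tr t) (t_z tr t)).
  by apply: is_derive_mx => k l; rewrite ord1.
have Dz' : is_derive t 1 (t_z tr) (field_p X (t_x tr t) (t_z tr t)).
  by apply: is_derive_mx => k l; rewrite ord1.
have := is_derive_dotp Dz' (is_derive_comp Dx' dXi).
move=> D; apply: is_derive_eq D _.
rewrite derive_sum_evec// dotp_sumr.
have -> : \sum_k dotp (t_z tr t)
      (field_x X (t_x tr t) (t_z tr t) 0 k *: 'D_(evec k) (X i) (t_x tr t)) =
    \sum_j Pij i j tr t * g j tr t.
  under [RHS]eq_bigr do rewrite mulr_suml.
  rewrite [RHS]exchange_big/=; apply: eq_bigr => l _.
  have dXl : derivable (X i) (t_x tr t) (evec l) by exact: diff_derivable.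
  rewrite dotpZr -(dhfibE _ dXl) field_xE mulr_suml.
  by apply: eq_bigr => j _; rewrite -/(g j tr t) -/(dg l i tr t); ring.
have -> : dotp (field_p X (t_x tr t) (t_z tr t)) (X i (t_x tr t)) =
    - \sum_j Pij j i tr t * g j tr t.
  rewrite /dotp -sumrN.
  under [RHS]eq_bigr do rewrite mulr_suml -sumrN.
  rewrite [RHS]exchange_big/=; apply: eq_bigr => l _.
  rewrite field_pE mulNr mulr_suml -sumrN; apply: eq_bigr => j _.
  by rewrite -/(g j tr t) -/(dg l j tr t) -/(Xc i l (t_x tr t)); ring.
rewrite addrC -sumrB; apply: eq_bigr => j _.
by rewrite -mulrBl.
Qed.

Let O_eta : O 1 (fun tr _ => t_eta tr).
Proof. by apply: unifO_ext (unifO_eta T eta01 1) => tr _ t _; rewrite expr1. Qed.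

Let hh k tr t := hhat b t (t_h tr) k 0.
Let xh k tr t := xhat b t (t_h tr) k 0.

Lemma O_hh k : O 0 (hh k).
Proof.
apply: (@unifO_gronwall _ _ valid t_eta T eta01 T0 0 'I_m hh
  (fun k tr t => (Jbar b *m hhat b t (t_h tr)) k 0) (fun j l _ _ => Jbar b j l)).
- by move=> j tr _ t _; exact: is_derive_hhat.
- by move=> j l; exact: O_const.
- by move=> j; apply: unifO_ext (unifO0 _ _ _ 0) => tr _ t _; rewrite mxE subrr.
move=> j; exists (`|r + 1|) => // tr [_ hr _ _ _] t _.
by rewrite expr0 mulr1 /hh hhat0 (le_trans (ball_h_entry j hr))// ler_norm.
Qed.

Lemma O_xh k : O 0 (xh k).
Proof.
apply: (@unifO_int _ _ _ _ _ eta01 T0 0 _ (hh k) _ (O_hh k)).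
  by move=> tr _ t _; exact: is_derive_xhat.
by move=> tr _; rewrite /xh xhat0 mxE.
Qed.

Lemma O_J1 i j : O 1 (fun tr t => J1 X (xpart (t_x tr t)) i j).
Proof.
apply: unifO_ext (unifO_sum (index_enum 'I_m) xpredT
  (fun k => unifOM (O_const (d2z X i j k - d2z X j i k)) (O_x (sp k)))) => tr _ t _.
by rewrite [RHS]mxE; apply: eq_bigr => k _; rewrite [xpart _ _ _]mxE.
Qed.

(** Errors of the first pass. Their order 2 is what gives the products $x_ig_j$ up to order 3 in
    [O_quadratic]. *)
Let e1 i tr t := g i tr t - t_eta tr * hh i tr t.
Let e2 i tr t := t_x tr t 0 (sp i) - t_eta tr * xh i tr t.

Lemma O_e1 i : O 2 (e1 i).
Proof.
apply: (@unifO_gronwall _ _ valid t_eta T eta01 T0 2 'I_m e1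
  (fun i tr t => \sum_j Bij i j tr t * g j tr t -
     t_eta tr * (Jbar b *m hhat b t (t_h tr)) i 0) (fun j l _ _ => Jbar b j l)).
- move=> j tr v t tT; apply: derB; first exact: is_derive_g.
  by apply: derZ; exact: is_derive_hhat.
- by move=> j l; exact: O_const.
- move=> {}i.
  (* The residual is $(B-J)g$, a product of two terms of order 1. *)
  have A := unifO_sum (index_enum 'I_m) xpredT (fun j => unifOM
    (unifOD (O2_1 (O_B i j)) (O_J1 i j)) (O_g j)).
  apply: unifO_ext A => tr _ t _; rewrite [(_ *m _) i 0]mxE mulr_sumr -!sumrB.
  apply: eq_bigr => j _; rewrite /e1 /hh.
  have alg (u v w p q s : R) :
    (u - (v + w) + w) * p = u * p - s * (v * q) - v * (p - s * q) by ring.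
  exact: alg.
move=> j; apply: unifO_ext (unifO0 _ _ _ 2) => tr [_ _ x0 [z0 _] _] t _.
rewrite /e1 /hh hhat0 /g x0 hfibE Xc0_max mulr0 addr0 (bigD1 j)//= big1.
  by rewrite Xc0_sp eqxx mulr1 addr0 z0 subrr.
by move=> a /negbTE aj; rewrite Xc0_sp aj mulr0.
Qed.

Lemma O_dxh i : O 3 (fun tr t => \sum_j g j tr t * Xc j (sp i) (t_x tr t) - g i tr t).
Proof.
have A := unifO_sum (index_enum 'I_m) xpredT (fun j => unifOM (O_g j) (O_Xh j i)).
apply: unifO_ext A => tr _ t _.
under eq_bigr do rewrite mulrBr; rewrite sumrB; congr (_ - _).
rewrite (bigD1 i)//= eqxx mulr1 big1 ?addr0// => j ji.
by rewrite eq_sym (negbTE ji) mulr0.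
Qed.

Lemma O_e2 i : O 2 (e2 i).
Proof.
apply: (@unifO_int _ _ _ _ _ eta01 T0 2 _
  (fun tr t => \sum_j g j tr t * Xc j (sp i) (t_x tr t) - t_eta tr * hh i tr t)).
- move=> tr v t tT; apply: derB; first exact: valid_dx.
  by apply: derZ; exact: is_derive_xhat.
- have A := unifO_le eta01 (isT : (2 <= 3)%N) (O_dxh i).
  apply: unifO_ext (unifOD A (O_e1 i)) => tr _ t _.
  by rewrite /e1 addrA subrK.
by move=> tr [_ _ x0 _ _]; rewrite /e2 /xh x0 xhat0 !mxE mulr0 subrr.
Qed.

Lemma O_quadratic i j : O 3 (fun tr t => t_x tr t 0 (sp i) * g j tr t -
  t_eta tr ^+ 2 * (xh i tr t * hh j tr t)).
Proof.
have A := unifOM (O_e2 i) (O_g j).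
have B := unifOM (unifOM O_eta (O_xh i)) (O_e1 j).
apply: unifO_ext (unifOD A B) => tr _ t _; rewrite /e1 /e2.
have alg (u v w p q : R) : (u - p * v) * w + p * v * (w - p * q) = u * w - p ^+ 2 * (v * q) by ring.
exact: alg.
Qed.

Let vh (h : 'cV[R]_m) t : 'cV[R]_m := J1 X (xhat b t h) *m hhat b t h.

Lemma continuous_vh h i : continuous (fun t => vh h t i 0).
Proof.
move=> t; apply: is_derive_continuous.
under eq_fun do rewrite mxE.
apply: der_sum => j; apply: derM; last exact: is_derive_hhat.
under eq_fun do rewrite mxE.
by apply: der_sum => k; apply: derZ; exact: is_derive_xhat.
Qed.

Let HX h := cid (@duhamel R n b (vh h) (fun i => @continuous_vh h i)).
Let Hh h := sval (HX h).
Let Xh h := sval (cid (svalP (HX h))).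
Let HXP h := svalP (cid (svalP (HX h))).

Let e3 i tr t := e1 i tr t - t_eta tr ^+ 2 * Hh (t_h tr) t i 0.
Let e4 i tr t := e2 i tr t - t_eta tr ^+ 2 * Xh (t_h tr) t i 0.

Lemma O_e3 i : O 3 (e3 i).
Proof.
apply: (@unifO_gronwall _ _ valid t_eta T eta01 T0 3 'I_m e3
  (fun i tr t => \sum_j Bij i j tr t * g j tr t -
     t_eta tr * (Jbar b *m hhat b t (t_h tr)) i 0 -
     t_eta tr ^+ 2 * ((Jbar b *m Hh (t_h tr) t) i 0 + vh (t_h tr) t i 0))
  (fun j l _ _ => Jbar b j l)).
- move=> j tr v t tT; apply: derB.
    apply: derB; first exact: is_derive_g.
    by apply: derZ; exact: is_derive_hhat.
  by apply: derZ; have [_ _ D _ _] := HXP (t_h tr); exact: D.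
- by move=> j l; exact: O_const.
- move=> {}i.
  (* The residual splits into $(B-J-J^{(1)}(x))g$, of order 2 + 1, and
     $J^{(1)}(x)g-\eta^2J^{(1)}(\hat x)\hat h$, of order 3 by [O_quadratic]. *)
  have A1 := unifO_sum (index_enum 'I_m) xpredT (fun j => unifOM (O_B i j) (O_g j)).
  have A2 := unifO_sum (index_enum 'I_m) xpredT (fun j => unifO_sum (index_enum 'I_m) xpredT
    (fun k => unifOM (O_const (d2z X i j k - d2z X j i k)) (O_quadratic k j))).
  apply: unifO_ext (unifOD A1 A2) => tr _ t _.
  rewrite [(_ *m hhat _ _ _) i 0]mxE [(_ *m Hh _ _) i 0]mxE [vh _ _ _ _]mxE.
  rewrite -[LHS]big_split/= -[X in _ - _ ^+ 2 * X]big_split/= !mulr_sumr -!sumrB.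
  apply: eq_bigr => j _; rewrite /e3 /e1 /hh.
  rewrite [J1 _ _ _ _]mxE [J1 _ _ _ _]mxE.
  have -> : \sum_k (d2z X i j k - d2z X j i k) * (t_x tr t 0 (sp k) * g j tr t -
       t_eta tr ^+ 2 * (xh k tr t * hhat b t (t_h tr) j 0)) =
     (\sum_k (d2z X i j k - d2z X j i k) * xpart (t_x tr t) k 0) * g j tr t -
     t_eta tr ^+ 2 * ((\sum_k (d2z X i j k - d2z X j i k) * xhat b t (t_h tr) k 0) *
       hhat b t (t_h tr) j 0).
    rewrite !mulr_suml mulr_sumr -sumrB; apply: eq_bigr => k _.
    have alg (d p q w u v : R) : d * (p * q - w * (u * v)) = d * p * q - w * (d * u * v) by ring.
    rewrite [xpart _ _ _]mxE; exact: alg.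
  have alg (u v w p q s H k : R) : (u - (v + w)) * p + (w * p - s ^+ 2 * (k * q)) =
    u * p - s * (v * q) - s ^+ 2 * (v * H + k * q) - v * (p - s * q - s ^+ 2 * H) by ring.
  exact: alg.
move=> j; apply: unifO_ext (unifO0 _ _ _ 3) => tr [_ _ x0 [z0 _] _] t _.
have [H0 _ _ _ _] := HXP (t_h tr).
rewrite /e3 /e1 /hh hhat0 /g x0 hfibE Xc0_max mulr0 addr0 (bigD1 j)//= big1.
  by rewrite Xc0_sp eqxx mulr1 addr0 z0 subrr [Hh _ 0]H0 mxE mulr0 subr0.
by move=> a /negbTE aj; rewrite Xc0_sp aj mulr0.
Qed.

Lemma O_e4 i : O 3 (e4 i).
Proof.
apply: (@unifO_int _ _ _ _ _ eta01 T0 3 _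
  (fun tr t => \sum_j g j tr t * Xc j (sp i) (t_x tr t) - t_eta tr * hh i tr t -
    t_eta tr ^+ 2 * Hh (t_h tr) t i 0)).
- move=> tr v t tT; apply: derB.
    apply: derB; first exact: valid_dx.
    by apply: derZ; exact: is_derive_xhat.
  by apply: derZ; have [_ _ _ D _] := HXP (t_h tr); exact: D.
- apply: unifO_ext (unifOD (O_dxh i) (O_e3 i)) => tr _ t _.
  by rewrite /e3 /e1 !addrA subrK.
move=> tr [_ _ x0 _ _]; have [_ X00 _ _ _] := HXP (t_h tr).
by rewrite /e4 /e2 /xh x0 xhat0 [Xh _ 0]X00 !mxE !mulr0 !subrr.
Qed.

Lemma O_Xz2 i : O 2 (fun tr t => Xc i ord_max (t_x tr t) -
  \sum_k 2^-1 * Jbar b i k * t_x tr t 0 (sp k)).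
Proof.
have : O 2 (fun tr t => Xc i ord_max (t_x tr t) - Xc i ord_max 0 -
    \sum_l t_x tr t 0 l * 'D_(evec l) (Xc i ord_max) 0).
  by apply: O_tay => x xr; have [_ _ /(_ x xr)[_ _ _ /(_ (i, ord_max)) H _] _] := FE.
apply: unifO_ext => tr _ t _; rewrite Xc0_max subr0; congr (_ - _).
rewrite big_zmax DXz mulr0 addr0; apply: eq_bigr => k _.
by rewrite DXJ mulrC.
Qed.

(** The derivative of $z$ is quadratic in $(x,g)$ up to order 3, so the errors of the first pass
    suffice here. *)
Lemma O_e5 : O 3 (fun tr t => t_x tr t 0 ord_max - t_eta tr ^+ 2 * zhat b t (t_h tr)).
Proof.
apply: (@unifO_int _ _ _ _ _ eta01 T0 3 _
  (fun tr t => \sum_i g i tr t * Xc i ord_max (t_x tr t) - t_eta tr ^+ 2 *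
    (2^-1 * \sum_k hhat b t (t_h tr) k 0 * (Jbar b *m xhat b t (t_h tr)) k 0))).
- move=> tr v t tT; apply: derB; first exact: valid_dx.
  by apply: derZ; exact: is_derive_zhat.
- have A1 := unifO_sum (index_enum 'I_m) xpredT (fun i => unifOM (O_g i) (O_Xz2 i)).
  have A2 := unifO_sum (index_enum 'I_m) xpredT (fun i => unifO_sum (index_enum 'I_m) xpredT
    (fun k => unifOM (O_const (2^-1 * Jbar b i k)) (O_quadratic k i))).
  apply: unifO_ext (unifOD A1 A2) => tr _ t _.
  rewrite !mulr_sumr -big_split/= -sumrB; apply: eq_bigr => i _.
  rewrite [(_ *m xhat _ _ _) i 0]mxE mulrBr -addrA; congr (_ + _).
  rewrite !mulr_sumr -sumrN -big_split/= -sumrN; apply: eq_bigr => k _.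
  rewrite /xh /hh.
  have alg (p q u v w s : R) : - (w * (2^-1 * p * q)) + 2^-1 * p * (q * w - s ^+ 2 * (u * v)) =
    - (s ^+ 2 * (2^-1 * (v * (p * u)))) by field.
  exact: alg.
by move=> tr [_ _ x0 _ _]; rewrite x0 zhat0 mxE mulr0 subrr.
Qed.

Theorem expansion : exists2 K : R, 0 <= K & forall tr, valid tr ->
  forall t, 0 <= t <= T -> let h := t_h tr in let eta := t_eta tr in
  [/\ `| xpart (t_x tr t) - (eta *: xhat b t h + eta ^+ 2 *: vintegral 0 t (fun s =>
        vintegral 0 s (fun u => mxexp ((s - u) *: Jbar b) *m vh h u))) | <= K * eta ^+ 3,
     `| zpart (t_x tr t) - eta ^+ 2 * zhat b t h | <= K * eta ^+ 3,
     `| (\col_i hfib X i (t_x tr t) (t_z tr t)) - (eta *: hhat b t h + eta ^+ 2 *: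
        vintegral 0 t (fun s => mxexp ((t - s) *: Jbar b) *m vh h s)) | <= K * eta ^+ 3 &
     `| t_z tr t 0 ord_max - 1 | <= K * eta ^+ 2].
Proof.
have [K3 K30 H3] := unifO_fin eta01 O_e3.
have [K4 K40 H4] := unifO_fin eta01 O_e4.
have [K5 K50 H5] := O_e5.
have [Kz Kz0 Hz] := O_zmax.
exists (K3 + K4 + K5 + Kz); first by rewrite !addr_ge0.
move=> tr v t tT /=; have /andP[h0 _] := eta01 v.
have [_ _ _ _ HI] := HXP (t_h tr).
have [t0 _] := andP tT; have [-> ->] := HI t t0.
have ek k : 0 <= t_eta tr ^+ k by rewrite exprn_ge0// ltW.
have Kle K k : K <= K3 + K4 + K5 + Kz -> forall u, u <= K * t_eta tr ^+ k ->
    u <= (K3 + K4 + K5 + Kz) * t_eta tr ^+ k.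
  by move=> KK u /le_trans; apply; rewrite ler_wpM2r.
have KK0 k : 0 <= (K3 + K4 + K5 + Kz) * t_eta tr ^+ k.
  by rewrite mulr_ge0// !addr_ge0.
split.
- apply: mx_norm_le => // i j; rewrite ord1.
  apply: (@Kle K4); first by lra.
  have -> : (xpart (t_x tr t) - (t_eta tr *: xhat b t (t_h tr) +
      t_eta tr ^+ 2 *: Xh (t_h tr) t)) i 0 = e4 i tr t.
    by rewrite mx_entryB mx_entryD !mx_entryZ [xpart _ _ _]mxE opprD addrA.
  exact: H4.
- by apply: (@Kle K5); [lra|exact: H5].
- apply: mx_norm_le => // i j; rewrite ord1.
  apply: (@Kle K3); first by lra.
  have -> : (\col_i hfib X i (t_x tr t) (t_z tr t) - (t_eta tr *: hhat b t (t_h tr) +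
      t_eta tr ^+ 2 *: Hh (t_h tr) t)) i 0 = e3 i tr t.
    by rewrite mx_entryB mx_entryD !mx_entryZ [X in X - _]mxE opprD addrA.
  exact: H3.
- by apply: (@Kle Kz); [lra|exact: Hz].
Qed.

End Asymptotics.

(** * Existence of solutions *)

Section Clamp.
Context {R : realType} {N : nat}.
Local Notation E := 'rV[R]_N.

(** The matrix norm is the maximum norm, so truncating each coordinate projects onto the closed ball
    of radius [rho] and does not increase distances. *)
Definition clamp (a : E) (rho : R) (y : E) : E :=
  \row_j Num.max (a 0 j - rho) (Num.min (a 0 j + rho) (y 0 j)).

Lemma clamp_dist (a : E) (rho : R) y y' : `|clamp a rho y - clamp a rho y'| <= `|y - y'|.
Proof.
apply: mx_norm_le => // i j; rewrite ord1.
apply: le_trans (ler_mx_entry _ 0 j); rewrite !mx_entryB !mxE.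
move: (y 0 j) (y' 0 j) => u v.
rewrite ler_norml; apply/andP; have := ler_norm (u - v); have := ler_norm (v - u).
rewrite distrC => H1 H2; have := normr_ge0 (u - v); move: `|u - v| H1 H2 => w H1 H2 H0.
move: (a 0 j - rho) (a 0 j + rho) => p q.
by case: (leP q u) => A1; case: (leP q v) => A2; case: (leP p q) => A3;
  rewrite ?subrr; do ?[case: (leP p u) => A4]; do ?[case: (leP p v) => A5]; split; lra.
Qed.

Lemma clamp_id (a : E) (rho : R) y : `|y - a| <= rho -> clamp a rho y = y.
Proof.
move=> ya; apply/rowP => j; rewrite mxE.
have := le_trans (ler_mx_entry (y - a) 0 j) ya.
rewrite mx_entryB ler_norml => /andP[H1 H2].
by rewrite min_r ?max_r; lra.
Qed.

Lemma clamp_center (a : E) (rho : R) : 0 <= rho -> clamp a rho a = a.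
Proof. by move=> r0; apply: clamp_id; rewrite subrr normr0. Qed.

Lemma clamp_ball (a : E) (rho : R) y : 0 <= rho -> `|clamp a rho y - a| <= rho.
Proof.
move=> r0; apply: mx_norm_le => // i j; rewrite ord1 mx_entryB mxE.
rewrite ler_norml; apply/andP; move: (y 0 j) => u.
by case: (leP (a 0 j + rho) u) => A1; case: (leP (a 0 j - rho) (a 0 j + rho)) => A2;
  case: (leP (a 0 j - rho) u) => A3; split; lra.
Qed.

Lemma norm_lsubmx (y : 'rV[R]_(N + N)) : `|lsubmx y| <= `|y|.
Proof. by apply: mx_norm_le => // i j; rewrite mxE; exact: ler_mx_entry. Qed.

Lemma norm_rsubmx (y : 'rV[R]_(N + N)) : `|rsubmx y| <= `|y|.
Proof. by apply: mx_norm_le => // i j; rewrite mxE; exact: ler_mx_entry. Qed.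

Lemma picard_pair (f g : E -> E -> E) (L : R) (x0 z0 : E) : 0 < L ->
  (forall x z x' z', `|f x z - f x' z'| <= L * (`|x - x'| + `|z - z'|)) ->
  (forall x z x' z', `|g x z - g x' z'| <= L * (`|x - x'| + `|z - z'|)) ->
  exists x z : R -> E, [/\ x 0 = x0, z 0 = z0 &
    forall s : R, is_derive s 1 x (f (x s) (z s)) /\ is_derive s 1 z (g (x s) (z s))].
Proof.
move=> L0 fL gL.
pose F (y : 'rV[R]_(N + N)) := row_mx (f (lsubmx y) (rsubmx y)) (g (lsubmx y) (rsubmx y)).
have FL u v : `|F u - F v| <= (2 * L) * `|u - v|.
  have uv0 := normr_ge0 (u - v).
  have nl : L * (`|lsubmx u - lsubmx v| + `|rsubmx u - rsubmx v|) <= 2 * L * `|u - v|.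
    rewrite mulrAC [leRHS]mulrC ler_pM2l// mulrDl mul1r -!linearB.
    by rewrite lerD ?norm_lsubmx ?norm_rsubmx.
  apply: mx_norm_le => [|i j]; first by rewrite mulr_ge0// mulr_ge0// ltW.
  rewrite ord1 mx_entryB -(splitK j); case: (fintype.split j) => k /=.
    rewrite !row_mxEl -mx_entryB (le_trans (ler_mx_entry _ _ _))//.
    exact: le_trans nl.
  rewrite !row_mxEr -mx_entryB (le_trans (ler_mx_entry _ _ _))//.
  exact: le_trans nl.
have L20 : 0 < 2 * L by rewrite mulr_gt0.
have [y [y0 Dy]] := picard (row_mx x0 z0) L20 FL.
exists (fun s => lsubmx (y s)), (fun s => rsubmx (y s)); split.
- by rewrite y0 row_mxKl.
- by rewrite y0 row_mxKr.
move=> s; split; apply: is_derive_mx => i j; rewrite ord1; under eq_fun do rewrite mxE.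
  by have := is_derive_entry 0 (lshift N j) (Dy s); rewrite row_mxEl.
by have := is_derive_entry 0 (rshift N j) (Dy s); rewrite row_mxEr.
Qed.

End Clamp.

Section FlowExistence.
Context {R : realType} {n : nat}.
Local Notation m := (n.*2).
Local Notation N := (n.*2.+1).
Local Notation E := 'rV[R]_N.
Local Notation e0 := (@dz R n).
Variables (X : 'I_m -> E -> E) (U : set E).
Hypothesis X0 : forall i, X i 0 = evec (sp i).
Variables (C rho T : R).
Hypothesis FE : frame_estimate X U C rho.
Hypothesis T0 : 0 <= T.

Lemma flow_exists : exists2 d0 : R, 0 < d0 & forall z0 : E, `|z0 - e0| <= d0 ->
  exists (x z : R -> E) (alpha beta : R), [/\ alpha < 0, T < beta, x 0 = 0, z 0 = z0 &
    forall s, alpha < s < beta -> [/\ `|x s| < rho, `|z s - e0| < rho,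
      is_derive s 1 x (field_x X (x s) (z s)) &
      is_derive s 1 z (field_p X (x s) (z s))]].
Proof.
have [C0 rho0 _ HF] := FE.
(* Clamping makes the field globally Lipschitz; the a priori bound keeps the
   solution where the clamp is the identity. *)
pose f x z := field_x X (clamp 0 rho x) (clamp e0 rho z).
pose g x z := field_p X (clamp 0 rho x) (clamp e0 rho z).
have L0 : 0 < C + 1 by lra.
have cl (y : E) : `|clamp 0 rho y| <= rho.
  by have := clamp_ball 0 y (ltW rho0); rewrite subr0.
have cr (y : E) : `|clamp e0 rho y - e0| <= rho by apply: clamp_ball; exact: ltW.
have B j x z x' z' : `|field X j (clamp 0 rho x) (clamp e0 rho z) -
    field X j (clamp 0 rho x') (clamp e0 rho z')| <= (C + 1) * (`|x - x'| + `|z - z'|).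
  apply: (@le_trans _ _ (C * (`|x - x'| + `|z - z'|))); last first.
    by rewrite ler_wpM2r ?addr_ge0// lerDl.
  apply: le_trans (HF _ _ _ _ _ (cl _) (cr _) (cl _) (cr _)) _.
  by rewrite ler_wpM2l// lerD// clamp_dist.
have fL x z x' z' : `|f x z - f x' z'| <= (C + 1) * (`|x - x'| + `|z - z'|).
  apply: mx_norm_le => [|i j]; first by rewrite mulr_ge0 ?addr_ge0// ltW.
  by rewrite ord1 mx_entryB; exact: (B (inl j)).
have gL x z x' z' : `|g x z - g x' z'| <= (C + 1) * (`|x - x'| + `|z - z'|).
  apply: mx_norm_le => [|i j]; first by rewrite mulr_ge0 ?addr_ge0// ltW.
  by rewrite ord1 mx_entryB; exact: (B (inr j)).
have [K K0 HK] := @apriori R n C T C0 T0.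
(* The factor 2 makes the a priori bound [K * d0] strictly smaller than [rho]. *)
pose d0 := rho / (2 * (K + 1)).
have K1 : 0 < K + 1 by lra.
have d00 : 0 < d0 by rewrite divr_gt0// mulr_gt0.
have Kd : K * d0 < rho.
  have -> : rho = (2 * (K + 1)) * d0 by rewrite /d0; field; rewrite gt_eqF.
  by rewrite ltr_pM2r//; lra.
exists d0 => // z0 z0d.
have [x [z [x0 zz0 Dxz]]] := picard_pair 0 z0 L0 fL gL.
have Dx' (s : R) : is_derive s 1 x (field_x X (clamp 0 rho (x s)) (clamp e0 rho (z s))).
  by have [] := Dxz s.
have Dz' (s : R) : is_derive s 1 z (field_p X (clamp 0 rho (x s)) (clamp e0 rho (z s))).
  by have [] := Dxz s.
have fb s j : `|field X j (clamp 0 rho (x s)) (clamp e0 rho (z s))| <=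
    C * (`|x s| + `|z s - e0|).
  apply: le_trans (field_bound X0 FE j (cl _) (cr _)) _.
  rewrite ler_wpM2l// lerD//.
    have := clamp_dist 0 rho (x s) 0; rewrite clamp_center ?subr0// ltW//.
  by have := clamp_dist e0 rho (z s) e0; rewrite clamp_center// ltW.
have small t : 0 <= t <= T -> `|x t| < rho /\ `|z t - e0| < rho.
  move=> tT.
  have [] := HK x z (fun s => field_x X (clamp 0 rho (x s)) (clamp e0 rho (z s)))
    (fun s => field_p X (clamp 0 rho (x s)) (clamp e0 rho (z s))) d0 t (ltW d00) tT.
  - by move=> j s _; exact: is_derive_entry (Dx' s).
  - by move=> j s _; exact: is_derive_entry (Dz' s).
  - by move=> j s _; exact: (fb s (inl j)).
  - by move=> j s _; exact: (fb s (inr j)).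
  - by rewrite x0 normr0 ltW.
  - by rewrite zz0.
  by move=> H1 H2; split; exact: le_lt_trans Kd.
(* Strict bounds persist near 0 and near [T]; this provides the margins [alpha < 0] and [T < beta]
   of an open interval of definition. *)
have opn t : 0 <= t <= T -> exists2 e : R, 0 < e &
    forall s, `|s - t| < e -> `|x s| < rho /\ `|z s - e0| < rho.
  move=> /small[xt zt].
  have cx : {for t, continuous (fun s => `|x s|)}.
    apply: continuous_comp; last exact: norm_continuous.
    exact: is_derive_continuous (Dx' t).
  have cz : {for t, continuous (fun s => `|z s - e0|)}.
    apply: continuous_comp; last exact: norm_continuous.
    apply: cvgB; last exact: cvg_cst.
    exact: is_derive_continuous (Dz' t).
  have A1 : \forall s \near t, `|x s| < rho by exact: cvgr_lt cx _ xt.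
  have A2 : \forall s \near t, `|z s - e0| < rho by exact: cvgr_lt cz _ zt.
  have A3 : \forall s \near t, `|x s| < rho /\ `|z s - e0| < rho by apply: filterI.
  have [e /= e0' He] := (nbhs_ballP _ _).1 A3.
  exists e => // s st; apply: He; rewrite /ball/= distrC//.
have [ea ea0 Ha] := opn 0 (introT andP (conj (lexx _) T0)).
have [eb eb0 Hb] := opn T (introT andP (conj T0 (lexx _))).
exists x, z, (- ea), (T + eb); split => //; [lra|lra|].
move=> s /andP[s1 s2].
have [xs zs] : `|x s| < rho /\ `|z s - e0| < rho.
  have [s0|s0] := ltP s 0; first by apply: Ha; rewrite subr0 ltr_norml; apply/andP; split; lra.
  have [sT|sT] := leP s T; first by apply: small; rewrite s0.
  by apply: Hb; rewrite ltr_norml; apply/andP; split; lra.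
have xc : clamp 0 rho (x s) = x s by apply: clamp_id; rewrite subr0 ltW.
have zc : clamp e0 rho (z s) = z s by apply: clamp_id; rewrite ltW.
split => //.
  by have := Dx' s; rewrite xc zc.
by have := Dz' s; rewrite xc zc.
Qed.

End FlowExistence.

(** * Twice differentiable maps between coordinate spaces *)

Section TwiceDifferentiable.
Context {R : realType} {N : nat}.
Local Notation E := 'rV[R]_N.

Definition C2at (f : E -> E) (y : E) :=
  differentiable f y /\ forall v, differentiable ('D_v f) y.

Lemma C2at_near (f g : E -> E) y : (\forall u \near y, f u = g u) ->
  C2at f y -> C2at g y.
Proof.
move=> fg [df Df]; split; first exact: near_eq_differentiable df.
move=> v; apply: near_eq_differentiable (Df v).
have /nbhs_interior := fg; apply: filterS => u /= fgu.
exact: near_eq_derive.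
Qed.

Lemma C2at_comp (f g : E -> E) y : (\forall u \near y, C2at f u) ->
  (\forall w \near f y, C2at g w) -> C2at (g \o f) y.
Proof.
move=> nf ng; have [df Df] := nbhs_singleton nf; have [dg Dg] := nbhs_singleton ng.
split; first exact: differentiable_comp.
move=> v.
have ngf : \forall u \near y, C2at g (f u).
  exact: (differentiable_continuous df).
(* Near [y] the chain rule writes the derivative of the composite as sums of products of
   differentiable scalar functions. *)
apply: (@near_eq_differentiable _ _ _ (fun u => \row_j \sum_k
  'D_v f u 0 k * 'D_(evec k) g (f u) 0 j)).
  apply: filterS2 nf ngf => u [dfu _] [dgu _].
  rewrite (derive_comp v dfu dgu) (derive_sum_evec _ dgu).
  by apply/rowP => j; rewrite mxE summxE; apply: eq_bigr => k _; rewrite mxE.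
apply: differentiable_row => j.
have -> : (fun u => (\row_j \sum_k 'D_v f u 0 k * 'D_(evec k) g (f u) 0 j) 0 j) =
   \sum_(k < N) ((fun u => 'D_v f u 0 k) * (fun u => 'D_(evec k) g (f u) 0 j)).
  by apply/funext => u; rewrite mxE fct_sumE.
apply: differentiable_sum => k; apply: differentiableM.
  by apply: differentiable_entry; exact: Df.
apply: (@differentiable_entry _ _ _ _ (fun u => 'D_(evec k) g (f u))).
exact: (differentiable_comp df (Dg (evec k))).
Qed.

Lemma schwarz_vector (f : E -> E) y u v : (\forall w \near y, C2at f w) ->
  'D_v ('D_u f) y = 'D_u ('D_v f) y.
Proof.
move=> nf; have [df Df] := nbhs_singleton nf.
have De a k : \forall w \near y, 'D_a (fun w => f w 0 k) w = 'D_a f w 0 k.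
  by apply: filterS nf => w [dfw _]; apply: derive_entry; exact: diff_derivable.
have dDe a k : differentiable ('D_a (fun w => f w 0 k)) y.
  apply: (@near_eq_differentiable _ _ _ (fun w => 'D_a f w 0 k)).
    by apply: filterS (De a k) => w ->.
  by apply: differentiable_entry; exact: Df.
apply/rowP => k.
have E1 a c : 'D_a ('D_c f) y 0 k = 'D_a ('D_c (fun w => f w 0 k)) y.
  rewrite -derive_entry; last exact/diff_derivable/Df.
  by apply: near_eq_derive; apply: filterS (De c k) => w ->.
have nd : \forall w \near y, differentiable (fun w => f w 0 k) w.
  by apply: filterS nf => w [dfw _]; exact: differentiable_entry.
have S := schwarz nd (dDe u k) (dDe v k).
have E1uv := E1 u v; have E1vu := E1 v u.
exact: (etrans E1vu (etrans S (esym E1uv))).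
Qed.

End TwiceDifferentiable.

(** * Invariance under change of chart *)

Section Charts.
Context {R : realType} {N : nat} {M : smooth_manifold R N}.
Local Notation E := 'rV[R]_N.
Implicit Types (c d e : chart R N M) (q : M).

Lemma cinv_in c y : chart_axiom c -> cimage c y -> cdom c (cinv c y).
Proof.
move=> [_ _ cK _ _] [q cq <-]; rewrite cK//; exact: mem_set.
Qed.

Lemma cinvK c y : chart_axiom c -> cimage c y -> ccoord c (cinv c y) = y.
Proof.
by move=> [_ _ cK _ _] [q cq <-]; rewrite cK//; exact: mem_set.
Qed.

Lemma ccoordK c q : chart_axiom c -> cdom c q -> cinv c (ccoord c q) = q.
Proof. by move=> [_ _ cK _ _] cq; rewrite cK//; exact: mem_set. Qed.

Lemma ccoord_in c q : cdom c q -> cimage c (ccoord c q).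
Proof. by move=> cq; exists q. Qed.

Lemma chart_near c (A : set M) y : chart_axiom c -> cimage c y -> open A ->
  A (cinv c y) -> \forall u \near y, cimage c u /\ A (cinv c u).
Proof.
move=> [_ oi _ _ ci] cy oA Ay; apply: filterI.
  exact: (open_nbhs_nbhs (conj oi cy)).
apply: (ci y (mem_set cy)).
exact: (open_nbhs_nbhs (conj oA Ay)).
Qed.

Lemma overlap_near c d q : chart_axiom c -> chart_axiom d -> cdom c q -> cdom d q ->
  \forall u \near ccoord c q, (ccoord c @` (cdom c `&` cdom d)) u.
Proof.
move=> cc cd cq dq.
have [od _ _ _ _] := cd.
have := chart_near cc (ccoord_in cq) od; rewrite ccoordK// => /(_ dq).
apply: filterS => u [[q' cq' <-]]; rewrite ccoordK// => dq'.
by exists q'.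
Qed.

Lemma smooth_near_C2at (U : set E) (f : E -> E) (y : E) : nbhs y U -> smooth U f ->
  \forall u \near y, C2at f u.
Proof.
move=> yU fU; apply: filterS yU => u Uu.
have [df Df] := fU 2%N; split; first by apply: df; exact: mem_set.
by move=> v; have [+ _] := Df v; apply; exact: mem_set.
Qed.

Lemma ctransK c d q : chart_axiom c -> chart_axiom d -> cdom c q -> cdom d q ->
  ctrans c d (ccoord c q) = ccoord d q.
Proof. by move=> cc cd cq dq; rewrite /ctrans /= ccoordK. Qed.

Lemma ctrans_comp_near c d e q : chart_axiom c -> chart_axiom d ->
  cdom c q -> cdom d q ->
  \forall u \near ccoord c q, ctrans d e (ctrans c d u) = ctrans c e u.
Proof.
move=> cc cd cq dq; apply: filterS (overlap_near cc cd cq dq) => u [q' [cq' dq'] <-].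
by rewrite (ctransK cc cd)// /ctrans /= !ccoordK.
Qed.

Lemma ctrans_inv_near c d q : chart_axiom c -> chart_axiom d ->
  cdom c q -> cdom d q -> \forall u \near ccoord c q, ctrans d c (ctrans c d u) = u.
Proof.
move=> cc cd cq dq; apply: filterS (overlap_near cc cd cq dq) => u [q' [cq' dq'] <-].
by rewrite (ctransK cc cd)// (ctransK cd cc).
Qed.

(** [smooth_chart] compares a chart only with those of the atlas, so the transition map between two
    smooth charts is factored near the point through an atlas chart. *)
Lemma ctrans_C2_at c d q : charts_at q c -> charts_at q d ->
  C2at (ctrans c d) (ccoord c q).
Proof.
move=> [[cc cs] cq] [[cd ds] dq].
have [a aa aq] := atlas_cover q.
have ca := atlas_chart aa.
have [sca _] := cs a aa; have [_ sad] := ds a aa.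
have n1 := smooth_near_C2at (overlap_near cc ca cq aq) sca.
have n2 : \forall w \near ctrans c a (ccoord c q), C2at (ctrans a d) w.
  by rewrite (ctransK cc ca)//; exact: smooth_near_C2at (overlap_near ca cd aq dq) sad.
apply: C2at_near (C2at_comp n1 n2).
exact: ctrans_comp_near.
Qed.

Lemma ctrans_C2_near c d q : charts_at q c -> charts_at q d ->
  \forall u \near ccoord c q, C2at (ctrans c d) u.
Proof.
move=> [sc cq] [sd dq].
apply: filterS (overlap_near sc.1 sd.1 cq dq) => u [q' [cq' dq'] <-].
by apply: ctrans_C2_at.
Qed.

End Charts.

(** * Orthonormal frames of one hyperplane *)

Section FrameChange.
Context {R : realType} {n : nat}.
Local Notation m := (n.*2).
Local Notation N := (n.*2.+1).
Local Notation E := 'rV[R]_N.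
Variables (V : set E) (w : E) (gm : E -> E -> R).
Hypothesis Vw : V = [set v | dotp w v = 0].
Hypothesis w0 : w != 0.
Hypothesis gmC : forall u v, V u -> V v -> gm u v = gm v u.
Hypothesis gmL : forall a u v x, V u -> V v -> V x ->
  gm (a *: u + v) x = a * gm u x + gm v x.

Lemma kernel_sum (I : Type) (s : seq I) (P : pred I) (u : I -> R) (Y : I -> E) :
  (forall i, V (Y i)) -> V (\sum_(i <- s | P i) u i *: Y i).
Proof.
rewrite Vw /= => VY; rewrite dotp_sumr big1// => i _.
by rewrite dotpZr VY mulr0.
Qed.

Lemma metric_sum (I : Type) (s : seq I) (u : I -> R) (Y : I -> E) x :
  (forall i, V (Y i)) -> V x ->
  gm (\sum_(i <- s) u i *: Y i) x = \sum_(i <- s) u i * gm (Y i) x.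
Proof.
move=> VY Vx; have V0 : V 0 by rewrite Vw /= dotp0.
elim: s => [|i s IH].
  (* Linearity with coefficient -1 and two zero vectors gives [gm 0 x = 0]. *)
  rewrite !big_nil; have := gmL (-1) V0 V0 Vx.
  by rewrite scaler0 addr0 mulN1r addNr.
by rewrite !big_cons gmL ?IH//; exact: kernel_sum.
Qed.

(** Orthonormal vectors are independent, and the kernel of a nonzero form in dimension 2n + 1 has
    rank 2n, so a frame of 2n of them in the kernel spans it. *)
Lemma orthonormal_span (X : 'I_m -> E) (v : E) : (forall i, V (X i)) ->
  (forall i j, gm (X i) (X j) = (i == j)%:R) -> V v ->
  v = \sum_j gm v (X j) *: X j.
Proof.
move=> VX oX Vv.
pose B : 'M[R]_(m, N) := \matrix_(i, j) X i 0 j.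
have uB (u : 'rV[R]_m) : u *m B = \sum_i u 0 i *: X i.
  rewrite mulmx_sum_row; apply: eq_bigr => i _; congr (_ *: _).
  by apply/rowP => j; rewrite !mxE.
have cf (u : 'I_m -> R) j : gm (\sum_i u i *: X i) (X j) = u j.
  rewrite metric_sum// (bigD1 j)//= oX eqxx mulr1 big1 ?addr0// => i ij.
  by rewrite oX (negbTE ij) mulr0.
have freeB : row_free B.
  rewrite -kermx_eq0; apply/rowV0P => u /sub_kermxP; rewrite uB => u0.
  apply/rowP => j; rewrite mxE -(cf (fun i => u 0 i) j) u0.
  have := metric_sum [::] (fun=> 0) VX (VX j).
  by rewrite !big_nil.
have BK : (B <= kermx w^T)%MS.
  apply/sub_kermxP/matrixP => i j; rewrite !mxE.
  have VX0 : dotp w (X i) = 0 by have := VX i; rewrite Vw.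
  by rewrite -[RHS]VX0; apply: eq_bigr => k _; rewrite !mxE ord1 mulrC.
have rK : \rank (kermx w^T) = m.
  by rewrite mxrank_ker mxrank_tr rank_rV w0 subn1.
have KB : (kermx w^T <= B)%MS.
  by rewrite -(mxrank_leqif_sup BK) rK; move/eqP: freeB => ->.
have /submxP[u vE] : (v <= B)%MS.
  apply: submx_trans KB; apply/sub_kermxP/matrixP => i j; rewrite !mxE !ord1.
  have Vv0 : dotp w v = 0 by move: Vv; rewrite Vw.
  by rewrite -[RHS]Vv0; apply: eq_bigr => k _; rewrite !mxE mulrC.
rewrite {1}vE uB; apply: eq_bigr => j _; congr (_ *: _).
by rewrite vE uB cf.
Qed.

(* Two orthonormal frames of the same hyperplane have the same tensor
   \sum_i X_i (x) X_i, which is what makes the Hamiltonian frame independent. *)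
Lemma orthonormal_frames_tensor (X Z : 'I_m -> E) :
  (forall i, V (X i)) -> (forall i j, gm (X i) (X j) = (i == j)%:R) ->
  (forall i, V (Z i)) -> (forall i j, gm (Z i) (Z j) = (i == j)%:R) ->
  forall p, \sum_i dotp p (Z i) *: Z i = \sum_i dotp p (X i) *: X i.
Proof.
move=> VX oX VZ oZ p.
(* Orthonormality of both frames gives [Q *m Q^T = 1]; [Q] being square, [Q^T *m Q = 1] as well, and
   this second identity collapses the double sum. *)
pose Q : 'M[R]_m := \matrix_(i, j) gm (Z i) (X j).
have ZE i : Z i = \sum_j Q i j *: X j.
  by rewrite {1}(orthonormal_span VX oX (VZ i)); apply: eq_bigr => j _; rewrite mxE.
have QQ : Q *m Q^T = 1%:M.
  apply/matrixP => i k; rewrite [RHS]mxE -oZ {1}(ZE i) metric_sum// mxE.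
  by apply: eq_bigr => j _; rewrite [Q^T _ _]mxE [Q k j]mxE gmC.
have QQ' j k : \sum_i Q i j * Q i k = (j == k)%:R.
  have /matrixP/(_ j k) := mulmx1C QQ; rewrite !mxE => <-.
  by apply: eq_bigr => i _; rewrite [Q^T _ _]mxE.
have EL i : dotp p (Z i) *: Z i =
    \sum_j \sum_k (Q i j * Q i k) *: (dotp p (X j) *: X k).
  rewrite {1 2}(ZE i) dotp_sumr scaler_suml; apply: eq_bigr => j _.
  rewrite dotpZr scaler_sumr; apply: eq_bigr => k _.
  by rewrite !scalerA; congr (_ *: _); ring.
under eq_bigr do rewrite EL.
rewrite exchange_big/=; apply: eq_bigr => j _.
rewrite exchange_big/= (bigD1 j)//= -scaler_suml QQ' eqxx scale1r.
rewrite big1 ?addr0// => k kj; rewrite -scaler_suml QQ' eq_sym (negbTE kj).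
by rewrite scale0r.
Qed.

End FrameChange.

(** * Hamilton's equations under a change of chart *)

Section CanonicalChange.
Context {R : realType} {n : nat} {M : smooth_manifold R n.*2.+1}.
Variable S : contact_subriemannian M.
Local Notation m := (n.*2).
Local Notation N := (n.*2.+1).
Local Notation E := 'rV[R]_N.
Variables (c d : chart R N M) (X Y : 'I_m -> E -> E) (om : E -> E).
Hypothesis cs : smooth_chart c.
Hypothesis ds : smooth_chart d.
Hypothesis oX : orthonormal_frame S c X.
Hypothesis oY : orthonormal_frame S d Y.
Hypothesis dist_om : forall q, cdom c q ->
  dist S c q = [set v | dotp (om (ccoord c q)) v = 0].
Hypothesis om0 : forall q, cdom c q -> om (ccoord c q) != 0.

Lemma frame_differentiable_at (c' : chart R N M) (X' : 'I_m -> E -> E) i q :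
  orthonormal_frame S c' X' -> cdom c' q ->
  differentiable (X' i) (ccoord c' q).
Proof.
move=> [sX _] cq; have [+ _] := sX i 1%N; apply.
exact/mem_set/ccoord_in.
Qed.

Lemma tensor_change q p : cdom c q -> cdom d q ->
  \sum_i dotp p (dtrans d c q (Y i (ccoord d q))) *: dtrans d c q (Y i (ccoord d q)) =
  \sum_i dotp p (X i (ccoord c q)) *: X i (ccoord c q).
Proof.
move=> cq dq; have [_ /(_ q cq)[dX oX']] := oX; have [_ /(_ q dq)[dY oY']] := oY.
have chc : charts_at q c by [].
have chd : charts_at q d by [].
apply: (orthonormal_frames_tensor (gm := metr S c q) (dist_om cq) (om0 cq)) => //.
- by move=> u v; exact: metr_sym.
- by move=> a u v x; exact: metr_linear.
- by move=> i; exact: ((@dist_trans _ _ _ S _ _ _ chd chc _).1 (dY i)).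
- by move=> i j; rewrite -(@metr_trans _ _ _ S _ _ _ chd chc _ _ (dY i) (dY j)).
Qed.

(** The transpose of the differential of the transition map applied to [p]: the coordinates in [d]
    of the covector whose coordinates in [c] are [p]. *)
Definition pullback (p y : E) : E := \row_j dotp p ('D_(evec j) (ctrans d c) y).

Lemma dotp_pullback p y v : differentiable (ctrans d c) y ->
  dotp (pullback p y) v = dotp p ('D_v (ctrans d c) y).
Proof.
move=> dpsi; rewrite (derive_sum_evec v dpsi) dotp_sumr.
by apply: eq_bigr => j _; rewrite mxE dotpZr mulrC.
Qed.

Lemma hamiltonian_change q p : cdom c q -> cdom d q ->
  hamiltonian Y (ccoord d q) (pullback p (ccoord d q)) = hamiltonian X (ccoord c q) p.
Proof.
move=> cq dq; rewrite /hamiltonian; congr (_ * _).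
have [dpsi _] := @ctrans_C2_at _ _ _ d c q (conj ds dq) (conj cs cq).
have := congr1 (dotp p) (tensor_change p cq dq).
rewrite !dotp_sumr => H.
under eq_bigr do rewrite dotp_pullback// expr2.
under [RHS]eq_bigr do rewrite expr2.
by under eq_bigr do rewrite -dotpZr; rewrite [LHS]H; apply: eq_bigr => i _; rewrite dotpZr.
Qed.

Lemma dotp_field_p (X' : 'I_m -> E -> E) x p v : (forall i, differentiable (X' i) x) ->
  dotp (field_p X' x p) v = - \sum_i hfib X' i x p * dotp p ('D_v (X' i) x).
Proof.
move=> dX; rewrite /dotp.
under eq_bigr do rewrite field_pE mulNr mulr_suml.
rewrite sumrN; congr (- _); rewrite exchange_big/=; apply: eq_bigr => i _.
rewrite -/(dotp p _) derive_sum_evec// dotp_sumr mulr_sumr.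
apply: eq_bigr => l _; rewrite dotpZr dhfibE; first by ring.
exact: diff_derivable.
Qed.

Lemma derive_sum_dir (V W : normedModType R) (f : V -> W) (a : V) (I : Type) (s : seq I)
    (u : I -> R) (v : I -> V) : differentiable f a ->
  'D_(\sum_(i <- s) u i *: v i) f a = \sum_(i <- s) u i *: 'D_(v i) f a.
Proof.
move=> df; rewrite deriveE// linear_sum; apply: eq_bigr => i _.
by rewrite linearZ/= deriveE.
Qed.

Variables (x p : R -> E) (t : R).
Hypothesis Ux : cimage c (x t).
Hypothesis Dx : is_derive t 1 x (field_x X (x t) (p t)).
Hypothesis Dp : is_derive t 1 p (field_p X (x t) (p t)).
Hypothesis dq : cdom d (cinv c (x t)).

Let q s := cinv c (x s).
Let y0 := ccoord d (q t).

Let cq : cdom c (q t). Proof. exact: cinv_in cs.1 Ux. Qed.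
Let cx : ccoord c (q t) = x t. Proof. exact: cinvK cs.1 Ux. Qed.
Let chc : charts_at (q t) c. Proof. by []. Qed.
Let chd : charts_at (q t) d. Proof. by []. Qed.
Let npsi : \forall u \near y0, C2at (ctrans d c) u.
Proof. exact: ctrans_C2_near chd chc. Qed.
Let psi2 : C2at (ctrans d c) y0.
Proof. exact: ctrans_C2_at chd chc. Qed.
Let phi2 : C2at (ctrans c d) (x t).
Proof. by rewrite -cx; exact: ctrans_C2_at chc chd. Qed.
Let psiy0 : ctrans d c y0 = x t.
Proof. by rewrite /y0 (ctransK ds.1 cs.1). Qed.
Let dX i : differentiable (X i) (x t).
Proof. by rewrite -cx; exact: frame_differentiable_at oX cq. Qed.
Let dY i : differentiable (Y i) y0.
Proof. exact: frame_differentiable_at oY dq. Qed.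

Lemma field_x_change :
  'D_(field_x X (x t) (p t)) (ctrans c d) (x t) = field_x Y y0 (pullback (p t) y0).
Proof.
rewrite /field_x /hfib.
have := tensor_change (p t) cq dq; rewrite cx -/y0 => <-.
rewrite (derive_sum_dir _ _ _ phi2.1); apply: eq_bigr => i _.
rewrite dotp_pullback; last by case: psi2.
congr (_ *: _).
rewrite -[in 'D__ _ (x t)]psiy0 /dtrans -/y0.
have phi2' : differentiable (ctrans c d) (ctrans d c y0) by rewrite psiy0; case: phi2.
rewrite -(derive_comp (Y i y0) psi2.1 phi2').
rewrite (@near_eq_derive _ _ _ _ id) ?derive_id//.
exact: ctrans_inv_near ds.1 cs.1 dq cq.
Qed.

Lemma is_derive_coord_change :
  is_derive t 1 (fun s => ccoord d (q s)) (field_x Y y0 (pullback (p t) y0)).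
Proof.
rewrite -field_x_change; exact: (is_derive_comp Dx phi2.1).
Qed.

(* Differentiating the identity of the Hamiltonians in the two charts gives the
   force terms up to second derivatives of the transition map, which cancel by
   symmetry. *)
Lemma is_derive_covector_change :
  is_derive t 1 (fun s => pullback (p s) (ccoord d (q s)))
    (field_p Y y0 (pullback (p t) y0)).
Proof.
set p0 := p t.
have DXi j : is_derive y0 (evec j) (pullback p0)
    (\row_l dotp p0 ('D_(evec j) ('D_(evec l) (ctrans d c)) y0)).
  apply: is_derive_mx => a l; rewrite mxE.
  rewrite (_ : (fun y => _) = fun y => dotp p0 ('D_(evec l) (ctrans d c) y)); last first.
    by apply/funext => y; rewrite ord1 mxE.
  rewrite -[X in is_derive _ _ _ X]add0r -[X in X + _](dotp0 ('D_(evec l) (ctrans d c) y0)).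
  rewrite dotpC.
  apply: (@is_derive_dotp _ _ _ (fun=> p0)).
  by apply: derivableP; apply: diff_derivable; exact: psi2.2.
have Hamj j : \sum_i hfib Y i y0 (pullback p0 y0) *
    (dotp (\row_l dotp p0 ('D_(evec j) ('D_(evec l) (ctrans d c)) y0)) (Y i y0) +
     dotp (pullback p0 y0) ('D_(evec j) (Y i) y0)) =
    \sum_i hfib X i (x t) p0 * dotp p0 ('D_('D_(evec j) (ctrans d c) y0) (X i) (x t)).
  have D1 : is_derive y0 (evec j) (fun y => hamiltonian Y y (pullback p0 y))
    (\sum_i hfib Y i y0 (pullback p0 y0) *
    (dotp (\row_l dotp p0 ('D_(evec j) ('D_(evec l) (ctrans d c)) y0)) (Y i y0) +
     dotp (pullback p0 y0) ('D_(evec j) (Y i) y0))).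
    apply: (@is_derive_hamiltonian _ _ Y _ id (pullback p0)) => i.
    apply: is_derive_dotp => //.
    by apply: derivableP; exact: diff_derivable.
  have D2 : is_derive y0 (evec j) (fun y => hamiltonian X (ctrans d c y) p0)
    (\sum_i hfib X i (ctrans d c y0) p0 *
      (dotp 0 (X i (ctrans d c y0)) +
       dotp p0 ('D_('D_(evec j) (ctrans d c) y0) (X i) (ctrans d c y0)))).
    apply: (@is_derive_hamiltonian _ _ X _ (ctrans d c) (fun=> p0)) => i.
    apply: is_derive_dotp.
    have dXi : differentiable (X i) (ctrans d c y0) by rewrite psiy0.
    rewrite -(derive_comp _ psi2.1 dXi); apply: derivableP.
    by apply: diff_derivable; exact: (differentiable_comp psi2.1 dXi).
  rewrite -(@derive_val _ _ _ _ _ _ _ D1).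
  rewrite (@near_eq_derive _ _ _ _ (fun y => hamiltonian X (ctrans d c y) p0)).
    rewrite (@derive_val _ _ _ _ _ _ _ D2) psiy0; apply: eq_bigr => i _.
    by rewrite dotpC dotp0 add0r.
  apply: filterS (overlap_near ds.1 cs.1 dq cq) => u [q' [dq' cq'] <-].
  by rewrite hamiltonian_change// (ctransK ds.1 cs.1).
apply: is_derive_mx => a j; rewrite ord1.
rewrite (_ : (fun s => _) = fun s =>
    dotp (p s) ('D_(evec j) (ctrans d c) (ccoord d (q s)))); last first.
  by apply/funext => s; rewrite mxE.
have := is_derive_dotp Dp (is_derive_comp is_derive_coord_change (psi2.2 (evec j))).
move=> D; apply: is_derive_eq D _; rewrite -/p0.
rewrite (dotp_field_p _ _ dX) -Hamj field_pE.
rewrite [in X in _ + X]/field_x (derive_sum_dir _ _ _ (psi2.2 _)) dotp_sumr.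
rewrite -!sumrN -big_split/=; apply: eq_bigr => i _.
rewrite dotpZr (derive_sum_evec _ (psi2.2 _)) dotp_sumr.
have -> : dotp (\row_l dotp p0 ('D_(evec j) ('D_(evec l) (ctrans d c)) y0)) (Y i y0) =
    \sum_k dotp p0 (Y i y0 0 k *: 'D_(evec k) ('D_(evec j) (ctrans d c)) y0).
  by apply: eq_bigr => k _; rewrite mxE dotpZr mulrC schwarz_vector.
rewrite dhfibE; first by ring.
exact: diff_derivable.
Qed.

End CanonicalChange.

(** * Extremals in the normal form chart *)

Section RealInduction.
Context {R : realType}.

(** The supremum of the times up to which [P] holds is attained by the first assumption and, by the
    second, is not below [T]. Both may use all earlier times, as an a priori bound needs its whole
    past. *)
Lemma real_induction (T : R) (P : R -> Prop) : 0 <= T ->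
  (forall t, 0 <= t <= T -> (forall s, 0 <= s < t -> P s) -> P t) ->
  (forall t, 0 <= t < T -> (forall s, 0 <= s <= t -> P s) ->
    exists2 e : R, 0 < e & forall s, t < s < t + e -> P s) ->
  forall t, 0 <= t <= T -> P t.
Proof.
move=> T0 Pc Po.
pose A : set R := [set t | 0 <= t <= T /\ forall s, 0 <= s <= t -> P s].
have A0 : A 0.
  split; first by rewrite lexx.
  move=> s s0; have -> : s = 0 by apply/eqP; rewrite eq_le andbC.
  by apply: Pc => [|u]; [rewrite lexx|move=> /andP[u0 /(le_lt_trans u0)]; rewrite ltxx].
have supA : has_sup A by split; [exists 0|exists T => u [/andP[_ ?] _]].
pose u := sup A.
have u0 : 0 <= u by exact: (sup_upper_bound supA).
have uT : u <= T by apply: ge_sup => [|v [/andP[_ ?] _]]//; exists 0.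
have Pu s : 0 <= s < u -> P s.
  move=> /andP[s0 su].
  have us0 : 0 < u - s by rewrite subr_gt0.
  have [a [_ Pa] sa] := sup_adherent us0 supA.
  by apply: Pa; rewrite s0 /=; move: sa; rewrite -/u; lra.
have Pu' s : 0 <= s <= u -> P s.
  move=> /andP[s0]; rewrite le_eqVlt => /orP[/eqP->|su]; last by apply: Pu; rewrite s0.
  by apply: Pc => //; rewrite u0.
have [uT'|Tu] := ltP u T; last first.
  by move=> t /andP[t0 tT]; apply: Pu'; rewrite t0 (le_trans tT).
have [e e0 Pe] := Po u (introT andP (conj u0 uT')) Pu'.
pose v := Num.min (u + e / 2) T.
have uv : u < v by rewrite lt_min uT' andbT; lra.
have : A v.
  split; first by rewrite (le_trans u0 (ltW uv))/= ge_min lexx orbT.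
  move=> s /andP[s0]; rewrite le_min => /andP[s1 _].
  have [su|us] := leP s u; first by apply: Pu'; rewrite s0.
  by apply: Pe; rewrite us /=; lra.
by move=> /(sup_upper_bound supA); rewrite leNgt uv.
Qed.

Lemma closed_left_limit (Q : topologicalType) (g : R -> Q) (A : set Q) (t : R) :
  0 < t -> {for t, continuous g} -> closed A -> (forall s, 0 <= s < t -> A (g s)) ->
  A (g t).
Proof.
move=> t0 cg cA H; apply: contrapT => nA.
have nb : nbhs (g t) (~` A).
  by apply: open_nbhs_nbhs; split => //; exact: closed_openC.
have [e /= e0 He] := (nbhs_ballP _ _).1 (cg _ nb).
pose s := Num.max 0 (t - e / 2).
have s0 : 0 <= s by rewrite le_max lexx.
have st : s < t by rewrite gt_max t0 /=; lra.
apply: (He s); last by apply: H; rewrite s0.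
rewrite /ball/= ltr_norml; apply/andP; split; first by lra.
have : t - e / 2 <= s by rewrite le_max lexx orbT.
by lra.
Qed.

End RealInduction.

Section LineDerivatives.
Context {R : realType} {N : nat}.
Local Notation E := 'rV[R]_N.

Lemma derive_line_cst (f : E -> R) (v : E) (k : R) : differentiable f 0 ->
  (\forall s \near (0 : R), f (s *: v) = k) -> 'D_v f 0 = 0.
Proof.
move=> df fk.
have df' : differentiable f (0 + (0 : R) *: v) by rewrite scale0r addr0.
have D := is_derive_line df'.
have E0 : 'D_v f 0 = 'D_1 (fun s : R => f (0 + s *: v)) 0.
  by rewrite (@derive_val _ _ _ _ _ _ _ D) scale0r addr0.
rewrite E0 (@near_eq_derive _ _ _ _ (cst k)) ?derive_cst//.
by apply: filterS fk => s; rewrite add0r.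
Qed.

Lemma near0_line (U : set E) (v : E) : open U -> U 0 -> \forall s \near (0 : R), U (s *: v).
Proof.
move=> Uo U0.
have c : {for (0 : R), continuous (fun s : R => s *: v)} by exact: scalel_continuous.
apply: c; rewrite scale0r; exact: open_nbhs_nbhs (conj Uo U0).
Qed.

End LineDerivatives.

(** * The frame at the origin, read off the normal form *)

Section NormalFormFacts.
Context {R : realType} {n : nat} {M : smooth_manifold R n.*2.+1}.
Context {S : contact_subriemannian M} {q0 : M}.
Variable F : normal_form S q0.
Local Notation m := (n.*2).
Local Notation N := (n.*2.+1).
Local Notation E := 'rV[R]_N.
Local Notation c := (nf_c F).
Local Notation X := (nf_X F).
Local Notation b := (nf_b F).
Local Notation U := (cimage (nf_c F)).

Lemma nf_smooth_chart : smooth_chart c. Proof. by have [] := nf_chart F. Qed.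

Lemma nf_axiom : chart_axiom c. Proof. by have [] := nf_smooth_chart. Qed.

Lemma nf_open : open U. Proof. by have [_ +] := nf_axiom. Qed.

Lemma nf_dom : cdom c q0. Proof. by have [] := nf_chart F. Qed.

Lemma nf_zero : U 0.
Proof. by rewrite -(nf_centred F); exact: ccoord_in nf_dom. Qed.

Lemma nf_Ck i j : Ck 3 U (fun y => X i y 0 j).
Proof.
apply: Ck_entry; first exact: nf_open.
by have [+ _] := nf_frame F; apply.
Qed.

Lemma zaxis0 : zaxis (0 : E). Proof. by move=> i; rewrite mxE. Qed.

Lemma zaxis_dz (s : R) : zaxis (s *: dz : E).
Proof. by move=> i; rewrite mx_entryZ dz_sp mulr0. Qed.

Lemma zaxis_Vplane i (y : E) : zaxis y -> Vplane i y.
Proof. by move=> ya j _; rewrite !ya. Qed.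

Lemma nf_zpart_axis i y : U y -> zaxis y -> zpart (X i y) = 0.
Proof.
move=> Uy ya; have [k [->|->]] := ix_or_iy i.
  have [_ _ _ -> _] := nf_plane Uy (@zaxis_Vplane k y ya).
  by rewrite ya !mul0r.
have [_ _ _ _ ->] := nf_plane Uy (@zaxis_Vplane k y ya).
by rewrite ya !mul0r oppr0.
Qed.

Lemma nf_X0 i : X i 0 = evec (sp i).
Proof.
apply/rowP => j; have [k ->|->] := unliftP ord_max j.
  rewrite -/(sp k) (nf_axis nf_zero zaxis0) mxE eqxx /= (inj_eq lift_inj).
  by rewrite eq_sym.
have := nf_zpart_axis i nf_zero zaxis0; rewrite /zpart => ->.
by rewrite mxE eq_sym sp_max andbF.
Qed.

Lemma nf_entry_differentiable i j : differentiable (fun y => X i y 0 j) 0.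
Proof. by have [+ _] := nf_Ck i j; apply; exact: mem_set nf_zero. Qed.

(** Horizontal derivatives vanish by [nf_axis_d]; the vertical one vanishes because [nf_axis] fixes
    the entries along the whole [z]-axis. *)
Lemma nf_DXh i j l : 'D_(evec l) (fun y => X i y 0 (sp j)) 0 = 0.
Proof.
have [k ->|->] := unliftP ord_max l.
  exact: (nf_axis_d nf_zero zaxis0).
apply: (@derive_line_cst _ _ _ _ (i == j)%:R); first exact: nf_entry_differentiable.
apply: filterS (near0_line (evec ord_max) nf_open nf_zero) => s Us.
exact: (nf_axis Us (zaxis_dz s)).
Qed.

Lemma nf_DXz i : 'D_(evec ord_max) (fun y => X i y 0 ord_max) 0 = 0.
Proof.
apply: (@derive_line_cst _ _ _ _ 0); first exact: nf_entry_differentiable.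
apply: filterS (near0_line (evec ord_max) nf_open nf_zero) => s Us.
exact: (nf_zpart_axis i Us (zaxis_dz s)).
Qed.

Let A i k : R := 'D_(evec (sp k)) (fun y => X i y 0 ord_max) 0.

(* Condition (ii), [\sum_i x_i (X_i)_z = 0], divided by [s] on the line [s *: v]:
   its derivative at [0] is the quadratic form below. *)
Lemma nf_radial_quadratic (u : 'I_m -> R) : \sum_i \sum_k u i * u k * A i k = 0.
Proof.
pose v : E := \sum_k u k *: evec (sp k).
have vE k : v 0 (sp k) = u k.
  rewrite /v summxE (bigD1 k)//= big1 ?addr0 => [|j jk].
    by rewrite !mxE !eqxx mulr1.
  by rewrite !mxE (inj_eq lift_inj) eq_sym (negbTE jk) mulr0.
have vE0 : v 0 ord_max = 0.
  by rewrite /v summxE big1// => k _; rewrite !mxE eq_sym sp_max andbF mulr0.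
pose phi y := \sum_i u i * X i y 0 ord_max.
have dphi : is_derive (0 : E) v phi (\sum_i u i *: 'D_v (fun y => X i y 0 ord_max) 0).
  rewrite (_ : phi = \sum_(i < m) (u i *: (fun y => X i y 0 ord_max))); last first.
    by apply/funext => y; rewrite fct_sumE.
  apply: is_derive_sum => i; apply: is_deriveZ; apply: derivableP.
  exact/diff_derivable/nf_entry_differentiable.
have dphi' : differentiable phi 0.
  rewrite (_ : phi = \sum_(i < m) (u i *: (fun y => X i y 0 ord_max))); last first.
    by apply/funext => y; rewrite fct_sumE.
  by apply: differentiable_sum => i; apply: differentiableZ; exact: nf_entry_differentiable.
have H : 'D_v phi 0 = 0.
  apply: (@derive_line_cst _ _ _ _ 0) => //.
  apply: filterS (near0_line v nf_open nf_zero) => s Us.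
  have [->|s0] := eqVneq s 0.
    rewrite scale0r /phi big1// => i _.
    by rewrite nf_X0 mxE eq_sym sp_max andbF mulr0.
  have := nf_radial_z Us; rewrite /zpart => H.
  apply: (mulfI s0); rewrite mulr0 -[RHS]H /phi mulr_sumr; apply: eq_bigr => i _.
  by rewrite mx_entryZ vE; ring.
rewrite -[RHS]H (@derive_val _ _ _ _ _ _ _ dphi); apply: eq_bigr => i _.
rewrite (derive_sum_evec _ (nf_entry_differentiable _ _)) big_zmax vE0 scale0r addr0.
rewrite -[_ *: _]/(_ * _) mulr_sumr; apply: eq_bigr => k _.
by rewrite vE -mulrA.
Qed.

(** Polarisation of the vanishing quadratic form at two basis vectors. *)
Lemma nf_A_skew i j : A i j + A j i = 0.
Proof.
pose u (k : 'I_m) : R := (k == i)%:R; pose v (k : 'I_m) : R := (k == j)%:R.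
have pick (p q : 'I_m) : \sum_k \sum_l (k == p)%:R * (l == q)%:R * A k l = A p q.
  rewrite (bigD1 p)//= (bigD1 q)//= !eqxx !mul1r.
  rewrite big1 => [|l /negbTE->]; last by rewrite mulr0 mul0r.
  rewrite big1 ?addr0// => k /negbTE->; rewrite big1// => l _.
  by rewrite !mul0r.
have Qu := nf_radial_quadratic u; have Qv := nf_radial_quadratic v.
have Quv := nf_radial_quadratic (fun k => u k + v k).
suff : \sum_k \sum_l (u k + v k) * (u l + v l) * A k l =
    (\sum_k \sum_l u k * u l * A k l + \sum_k \sum_l v k * v l * A k l) +
    (A i j + A j i) by rewrite Qu Qv Quv !add0r => <-.
rewrite -(pick i j) -(pick j i) -!big_split/=; apply: eq_bigr => k _.
rewrite -!big_split/=; apply: eq_bigr => l _; rewrite /u /v.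
move: (A k l) (k == i)%:R (l == i)%:R (k == j)%:R (l == j)%:R => a p q p' q'.
by ring.
Qed.

(** The frame is horizontal at the origin, so the $X_0$-coefficient of the bracket is its [z]
    component [A i k - A k i], which is twice [A i k] by [nf_A_skew]. *)
Lemma nf_DXJ i k : 'D_(evec (sp k)) (fun y => X i y 0 ord_max) 0 = 2^-1 * Jbar b i k.
Proof.
have dX l : differentiable (X l) 0.
  by apply: differentiable_row => j; exact: nf_entry_differentiable.
have [kk /(congr1 (fun v : E => v 0 ord_max))] := nf_J F i k.
rewrite /lie_bracket !nf_X0 mx_entryB.
have AE p q : 'D_(evec (sp q)) (X p) 0 0 ord_max = A p q.
  by rewrite /A derive_entry//; exact: diff_derivable.
rewrite (AE i k) (AE k i) mx_entryD mx_entryZ dz_max mulr1.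
have -> : (\sum_l kk l *: X l 0) 0 ord_max = 0.
  rewrite summxE big1// => l _.
  by rewrite mx_entryZ nf_X0 mxE eq_sym sp_max andbF mulr0.
rewrite addr0 => <-; rewrite -/(A i k).
by have := nf_A_skew i k; move: (A i k) (A k i) => p q pq; lra.
Qed.

Lemma nf_b_neq0 i : b i != 0.
Proof.
have := nf_prod nf_zero zaxis0; rewrite [zpart _]mxE => H.
have : \prod_i nf_la F i 0 0 0 != 0.
  by rewrite H invr_eq0 pnatr_eq0 -lt0n fact_gt0.
by move=> /prodf_neq0/(_ i isT); rewrite -nf_b_la.
Qed.

Lemma nf_w_neq0 q : cdom c q -> nf_w F (ccoord c q) != 0.
Proof.
move=> cq; apply/eqP => w0; have := nf_reeb (ccoord_in cq).
by rewrite w0 dotpC dotp0 => /esym/eqP; rewrite oner_eq0.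
Qed.

End NormalFormFacts.

Section HamiltonRows.
Context {R : realType} {n : nat}.
Local Notation E := 'rV[R]_(n.*2.+1).
Variable X : 'I_(n.*2) -> E -> E.

Lemma row_hamiltonian_dp (x z : E) :
  \row_j 'D_(evec j) (fun p : E => hamiltonian X x p : R^o) z = field_x X x z.
Proof. by apply/rowP => j; rewrite mxE; exact: hamiltonian_dp. Qed.

Lemma row_hamiltonian_dx (x z : E) : (forall i, differentiable (X i) x) ->
  - \row_j 'D_(evec j) (fun y : E => hamiltonian X y z : R^o) x = field_p X x z.
Proof.
move=> dX; apply/rowP => j; rewrite [LHS]mxE [X in - X]mxE.
have H := hamiltonian_dx z j dX.
exact: (etrans (congr1 (fun u => - u) H) (opprK _)).
Qed.

End HamiltonRows.

(** * Rescaling, confinement and construction of extremals *)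

Section Extremals.
Context {R : realType} {n : nat} {M : smooth_manifold R n.*2.+1}.
Context {S : contact_subriemannian M} {q0 : M}.
Variable F : normal_form S q0.
Local Notation m := (n.*2).
Local Notation N := (n.*2.+1).
Local Notation E := 'rV[R]_N.
Local Notation e0 := (@dz R n).
Local Notation c := (nf_c F).
Local Notation X := (nf_X F).
Local Notation U := (cimage (nf_c F)).

(** The velocity has degree 1 and the force degree 2 in the covector, so multiplying the covector by
    [eta] compensates for the change of time scale. *)
Lemma field_xZ (k : R) (x p : E) : field_x X x (k *: p) = k *: field_x X x p.
Proof.
rewrite /field_x scaler_sumr; apply: eq_bigr => i _.
by rewrite /hfib dotpC dotpZr dotpC scalerA.
Qed.

Lemma field_pZ (k : R) (x p : E) : field_p X x (k *: p) = k ^+ 2 *: field_p X x p.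
Proof.
apply/rowP => l; rewrite mx_entryZ !field_pE mulrN mulr_sumr; congr (- _).
apply: eq_bigr => i _.
have -> : hfib X i x (k *: p) = k * hfib X i x p by rewrite /hfib dotpC dotpZr dotpC.
have -> : dhfib X l i x (k *: p) = k * dhfib X l i x p.
  by rewrite /dhfib mulr_sumr; apply: eq_bigr => j _; rewrite mx_entryZ mulrA.
by ring.
Qed.

Lemma is_derive_rescale (f : R -> E) (k t : R) (v : E) : is_derive (k * t) 1 f v ->
  is_derive t 1 (fun s => f (k * s)) (k *: v).
Proof.
move=> Df; apply: is_derive_mx => i j; rewrite mx_entryZ.
apply: (@der_scale _ (fun s => f s i j)); exact: is_derive_entry.
Qed.

Lemma is_derive_scale (f : R -> E) (k t : R) (v : E) : is_derive t 1 f v ->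
  is_derive t 1 (fun s => k *: f s) (k *: v).
Proof. exact: is_deriveZ. Qed.

Lemma extremal_field (alpha beta : R) (q : R -> M) (p : R -> chart R N M -> E) t :
  normal_extremal S alpha beta q p -> alpha < t < beta -> cdom c (q t) ->
  [/\ {for t, continuous q},
    is_derive t 1 (fun s => ccoord c (q s)) (field_x X (ccoord c (q t)) (p t c)) &
    is_derive t 1 (fun s => p s c) (field_p X (ccoord c (q t)) (p t c))].
Proof.
move=> ne tab cq; have [qc _ H] := ne t tab.
have ch : charts_at (q t) c by split => //; exact: nf_smooth_chart.
have [D1 D2] := H c ch X (nf_frame F).
have dX i : differentiable (X i) (ccoord c (q t)).
  exact: frame_differentiable_at (nf_frame F) cq.
split => //.
  by apply: is_derive_eq D1 _; exact: row_hamiltonian_dp.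
by apply: is_derive_eq D2 _; exact: row_hamiltonian_dx.
Qed.

Lemma initial_norm (r eta : R) (h : 'cV[R]_m) (z : E) : 0 <= r -> 0 < eta ->
  ball_h r h -> (forall i, z 0 (sp i) = eta * h i 0) -> z 0 ord_max = 1 ->
  `|z - e0| <= eta * (r + 1).
Proof.
move=> r0 eta0 hr zs zm; apply: mx_norm_le => [|i j].
  by rewrite mulr_ge0 ?addr_ge0// ltW.
rewrite ord1 mx_entryB; have [k ->|->] := unliftP ord_max j.
  rewrite -/(sp k) zs dz_sp subr0 normrM gtr0_norm// ler_pM2l//.
  exact: ball_h_entry.
by rewrite zm dz_max subrr normr0 mulr_ge0 ?addr_ge0// ltW.
Qed.

Variables (C rho T r K : R).
Hypothesis FE : frame_estimate X U C rho.
Hypothesis T0 : 0 <= T.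
Hypothesis r0 : 0 <= r.
Hypothesis K0 : 0 <= K.
Hypothesis HK : forall (x z dx dp : R -> E) (d t : R), 0 <= d -> 0 <= t <= T ->
  (forall j s, 0 <= s <= t -> is_derive s 1 (fun s => x s 0 j) (dx s 0 j)) ->
  (forall j s, 0 <= s <= t -> is_derive s 1 (fun s => z s 0 j) (dp s 0 j)) ->
  (forall j s, 0 <= s <= t -> `|dx s 0 j| <= C * (`|x s| + `|z s - e0|)) ->
  (forall j s, 0 <= s <= t -> `|dp s 0 j| <= C * (`|x s| + `|z s - e0|)) ->
  `|x 0| <= d -> `|z 0 - e0| <= d -> `|x t| <= K * d /\ `|z t - e0| <= K * d.

Lemma extremal_valid (eta : R) (h : 'cV[R]_m) q p :
  0 < eta <= 1 -> (K + 1) * (eta * (r + 1)) < rho -> ball_h r h ->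
  extremal_from F h eta^-1 (eta * T) q p ->
  (forall t, 0 <= t <= T -> cdom c (q (eta * t))) /\
  valid X rho T r (Trajectory eta h (fun s => ccoord c (q (eta * s)))
    (fun s => eta *: p (eta * s) c)).
Proof.
move=> /andP[eta0 eta1] Krho hr [[alpha [beta [a0 Tb ne]]] [q00 [ph pz]]].
have [C0 rho0 HU _] := FE.
pose x s := ccoord c (q (eta * s)); pose z s := eta *: p (eta * s) c.
pose d := eta * (r + 1).
have d0 : 0 <= d by rewrite mulr_ge0 ?addr_ge0// ltW.
(* The factor [K + 1] of the hypothesis yields both [K * d < rho], used to propagate, and
   [d <= rho], used to start. *)
have Kd : K * d < rho by move: Krho; rewrite -/d mulrDl mul1r; lra.
have drho : d <= rho.
  have : 0 <= K * d by rewrite mulr_ge0.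
  by move: Krho; rewrite -/d mulrDl mul1r; lra.
have x0 : x 0 = 0 by rewrite /x mulr0 q00 nf_centred.
have zs i : z 0 0 (sp i) = eta * h i 0.
  by have := ph i; rewrite nf_X0 dotp_evec /z mulr0 mx_entryZ => ->.
have zm : z 0 0 ord_max = 1.
  by move: pz; rewrite dotp_evec /z mulr0 mx_entryZ => ->; rewrite mulfV ?gt_eqF.
have z0 : `|z 0 - e0| <= d by exact: initial_norm zs zm.
have tab s : 0 <= s <= T -> alpha < eta * s < beta.
  move=> /andP[s0 sT]; apply/andP; split.
    by rewrite (lt_le_trans a0)// mulr_ge0// ltW.
  by rewrite (le_lt_trans _ Tb)// ler_pM2l.
have Dq s : 0 <= s <= T -> {for s, continuous (fun s => q (eta * s))}.
  move=> sT; have [qc _ _] := ne _ (tab s sT).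
  apply: (@continuous_comp _ _ _ (fun s => eta * s) q) => //.
  by apply: cvgMr; exact: cvg_id.
have Dx s : 0 <= s <= T -> cdom c (q (eta * s)) ->
    is_derive s 1 x (field_x X (x s) (z s)).
  move=> sT cq; have [_ D _] := extremal_field ne (tab s sT) cq.
  by rewrite field_xZ; exact: (is_derive_rescale D).
have Dz s : 0 <= s <= T -> cdom c (q (eta * s)) ->
    is_derive s 1 z (field_p X (x s) (z s)).
  move=> sT cq; have [_ _ D] := extremal_field ne (tab s sT) cq.
  rewrite field_pZ expr2 -scalerA; apply: is_derive_scale.
  exact: (is_derive_rescale D).
pose P s := [/\ cdom c (q (eta * s)), `|x s| <= rho & `|z s - e0| <= rho].
(* The a priori bound is strict inside the chart, so [P] propagates forward; it
   passes to left limits because the image in [M] of a closed ball of the chart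
   is compact, hence closed, [M] being Hausdorff. *)
have HP : forall t, 0 <= t <= T -> P t.
  apply: real_induction => // t.
  - move=> tT Ps; have [t00 _] := andP tT.
    move: t00; rewrite le_eqVlt => /orP[/eqP t00|t0].
      rewrite /P -t00 x0 mulr0 q00 normr0; split; [exact: nf_dom|exact: ltW|].
      by have := le_trans z0 drho.
    pose Ball : set E := [set y | `|y| <= rho].
    have cB : closed Ball.
      apply: (@closed_comp _ _ (fun y : E => `|y|) [set u | u <= rho]) => [y _|].
        exact: norm_continuous.
      exact: closed_le.
    have bB : bounded_set Ball.
      by exists rho; split; [exact: num_real|move=> u ru y /= /le_trans; apply; exact: ltW].
    have kB : compact (cinv c @` Ball).
      apply: continuous_compact; last exact: bounded_closed_compact.
      apply: continuous_in_subspaceT => y /set_mem By.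
      have [Uy _ _ _ _] := HU y By.
      by have [_ _ _ _ ci] := nf_axiom F; apply: ci; exact: mem_set.
    have clB : closed (cinv c @` Ball).
      exact: (compact_closed (@mfd_hausdorff _ _ M)).
    have [y By yq] : (cinv c @` Ball) (q (eta * t)).
      apply: (closed_left_limit (g := fun s => q (eta * s)) t0 (Dq t tT) clB) => s st.
      have [cq xr _] := Ps s st; exists (x s) => //.
      exact: ccoordK (nf_axiom F) cq.
    have [Uy _ _ _ _] := HU y By.
    have cq : cdom c (q (eta * t)) by rewrite -yq; exact: cinv_in (nf_axiom F) Uy.
    have xt : x t = y by rewrite /x -yq; exact: cinvK (nf_axiom F) Uy.
    split => //; first by rewrite xt.
    have cz : {for t, continuous (fun s => `|z s - e0|)}.
      apply: continuous_comp; last exact: norm_continuous.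
      apply: cvgB; last exact: cvg_cst.
      exact: is_derive_continuous (Dz t tT cq).
    apply: (closed_left_limit t0 cz (@closed_le _ rho)) => s st.
    by have [] := Ps s st.
  - move=> /andP[t0 tT] Ps.
    have tT' : 0 <= t <= T by rewrite t0 ltW.
    have sub s : 0 <= s <= t -> 0 <= s <= T.
      by case/andP => -> st; rewrite (le_trans st)// ltW.
    have [cq xr zr] : P t by apply: Ps; rewrite t0 lexx.
    have [] := HK (x := x) (z := z) (dx := fun s => field_x X (x s) (z s))
      (dp := fun s => field_p X (x s) (z s)) d0 tT'.
    + by move=> j s st; have [cs _ _] := Ps s st; exact: is_derive_entry (Dx s (sub s st) cs).
    + by move=> j s st; have [cs _ _] := Ps s st; exact: is_derive_entry (Dz s (sub s st) cs).
    + by move=> j s st; have [_ ? ?] := Ps s st;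
         apply: (field_bound _ FE (inl j)) => // i; exact: nf_X0.
    + by move=> j s st; have [_ ? ?] := Ps s st;
         apply: (field_bound _ FE (inr j)) => // i; exact: nf_X0.
    + by rewrite x0 normr0.
    + exact: z0.
    move=> /le_lt_trans/(_ Kd) xt /le_lt_trans/(_ Kd) zt.
    have cx : {for t, continuous (fun s => `|x s|)}.
      apply: continuous_comp; last exact: norm_continuous.
      exact: is_derive_continuous (Dx t tT' cq).
    have cz : {for t, continuous (fun s => `|z s - e0|)}.
      apply: continuous_comp; last exact: norm_continuous.
      apply: cvgB; last exact: cvg_cst.
      exact: is_derive_continuous (Dz t tT' cq).
    have A1 : \forall s \near t, `|x s| < rho by exact: cvgr_lt cx _ xt.
    have A2 : \forall s \near t, `|z s - e0| < rho by exact: cvgr_lt cz _ zt.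
    have A3 : \forall s \near t, cdom c (q (eta * s)).
      apply: (Dq t tT'); have [oc _ _ _ _] := nf_axiom F.
      exact: open_nbhs_nbhs (conj oc cq).
    have A4 : \forall s \near t, P s.
      by apply: filterS3 A1 A2 A3 => s ? ? ?; split => //; exact: ltW.
    have [e /= e0' He] := (nbhs_ballP _ _).1 A4.
    exists e => // s /andP[s1 s2]; apply: He; rewrite /ball/= ltr_norml.
    by apply/andP; split; lra.
split; first by move=> t /HP[].
split => //=; first by rewrite eta0.
move=> t tT; have [cq xr zr] := HP t tT; split => // j.
  exact: is_derive_entry (Dx t tT cq).
exact: is_derive_entry (Dz t tT cq).
Qed.

(** The covector is prescribed in the normal form chart and transported to every other chart by
    [pullback]. Its compatibility between two charts is then the chain rule for transition maps. *)
Lemma chart_extremal (eta : R) (x z : R -> E) (alpha beta : R) : 0 < eta ->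
  (forall s, alpha < s < beta -> [/\ U (x s),
    is_derive s 1 x (field_x X (x s) (z s)) & is_derive s 1 z (field_p X (x s) (z s))]) ->
  normal_extremal S (eta * alpha) (eta * beta) (fun s => cinv c (x (eta^-1 * s)))
   (fun s d => pullback c d (eta^-1 *: z (eta^-1 * s)) (ccoord d (cinv c (x (eta^-1 * s))))).
Proof.
move=> eta0 H t tab.
have tab' : alpha < eta^-1 * t < beta.
  by rewrite ltr_pdivlMl// ltr_pdivrMl// mulrC [t < _]mulrC.
have [Ut Dx Dz] := H _ tab'.
have ac := nf_axiom F; have sc := nf_smooth_chart F.
have cq := cinv_in ac Ut; have cx := cinvK ac Ut.
pose x' s := x (eta^-1 * s); pose p' s := eta^-1 *: z (eta^-1 * s).
have Dx' : is_derive t 1 x' (field_x X (x' t) (p' t)).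
  by rewrite field_xZ; exact: (is_derive_rescale Dx).
have Dp' : is_derive t 1 p' (field_p X (x' t) (p' t)).
  rewrite field_pZ expr2 -scalerA; apply: is_derive_scale.
  exact: (is_derive_rescale Dz).
have chc : charts_at (cinv c (x' t)) c by [].
split.
- apply: (@continuous_comp _ _ _ x' (cinv c)); first exact: is_derive_continuous Dx'.
  by have [_ _ _ _ ci] := ac; apply: ci; exact: mem_set.
- move=> d e chd che v.
  have d1 := ctrans_C2_at chd chc; have d2 := ctrans_C2_at che chc.
  have d3 := ctrans_C2_at chd che.
  rewrite (dotp_pullback _ _ d1.1) (dotp_pullback _ _ d2.1) /dtrans.
  have [[ad _] dq] := chd; have [[ae _] eq_] := che.
  have ce := ctransK ad ae dq eq_.
  congr (dotp _ _); rewrite -ce.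
  have d2' : differentiable (ctrans e c) (ctrans d e (ccoord d (cinv c (x' t)))).
    by rewrite ce; exact: d2.1.
  rewrite -(derive_comp v d3.1 d2'); apply: near_eq_derive.
  apply: filterS (ctrans_comp_near c ad ae dq eq_) => u; exact: esym.
move=> d [sd dq] Y oY /=; split.
  apply: is_derive_eq; last by apply/esym; exact: row_hamiltonian_dp.
  exact: (is_derive_coord_change sc sd (nf_frame F) oY (@nf_form_ker _ _ _ _ _ F)
    (@nf_w_neq0 _ _ _ _ _ F) Ut Dx' dq).
apply: is_derive_eq; last first.
  apply/esym; apply: row_hamiltonian_dx => i.
  exact: frame_differentiable_at oY dq.
exact: (is_derive_covector_change sc sd (nf_frame F) oY (@nf_form_ker _ _ _ _ _ F)
    (@nf_w_neq0 _ _ _ _ _ F) Ut Dx' Dp' dq).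
Qed.

Lemma pullback_id q p : cdom c q -> pullback c c p (ccoord c q) = p.
Proof.
move=> cq; have ac := nf_axiom F.
apply/rowP => j; rewrite mxE -[RHS]dotp_evec; congr (dotp _ _).
rewrite (@near_eq_derive _ _ _ _ id) ?derive_id//.
apply: filterS (overlap_near ac ac cq cq) => u [q' [cq' _] <-].
exact: ctransK.
Qed.

End Extremals.

Theorem proposition2p1 (R : realType) (n : nat)
    (M : smooth_manifold R n.*2.+1) (S : contact_subriemannian M) (q0 : M)
    (F : normal_form S q0) (T r : R) (T_gt0 : 0 < T) (r_gt0 : 0 < r) :
  exists C eta0 : R, [/\ 0 < C, 0 < eta0 &
    forall (eta : R) (h : 'cV[R]_(n.*2)), 0 < eta < eta0 -> ball_h r h ->
      (exists q p, extremal_from F h eta^-1 (eta * T) q p) /\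
      forall q p, extremal_from F h eta^-1 (eta * T) q p ->
      forall tau : R, 0 <= tau <= T ->
        cdom (nf_c F) (q (eta * tau)) /\
        exists (x : 'cV[R]_(n.*2)) (z : R) (htau : 'cV[R]_(n.*2)) (w : R),
          [/\ xpart (ccoord (nf_c F) (q (eta * tau))) = x,
              zpart (ccoord (nf_c F) (q (eta * tau))) = z,
              w != 0 &
              fibre_coordinates (nf_X F) (ccoord (nf_c F) (q (eta * tau)))
                (p (eta * tau) (nf_c F)) htau (eta^-1 * w^-1)] /\
          [/\ `| x - (eta *: xhat (nf_b F) tau h +
                 eta ^+ 2 *: vintegral 0 tau (fun sigma =>
                   vintegral 0 sigma (fun rho =>
                     mxexp ((sigma - rho) *: Jbar (nf_b F)) *m
                     J1 (nf_X F) (xhat (nf_b F) rho h) *m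
                     hhat (nf_b F) rho h))) | <= C * eta ^+ 3,
              `| z - eta ^+ 2 * zhat (nf_b F) tau h | <= C * eta ^+ 3,
              `| htau - (hhat (nf_b F) tau h +
                 eta *: vintegral 0 tau (fun sigma =>
                   mxexp ((tau - sigma) *: Jbar (nf_b F)) *m
                   J1 (nf_X F) (xhat (nf_b F) sigma h) *m
                   hhat (nf_b F) sigma h)) | <= C * eta ^+ 2 &
              `| w - 1 | <= C * eta ^+ 2]].
Proof.
have half (u : R) : `|u - 1| <= 2^-1 -> 2^-1 <= u.
  by rewrite ler_norml => /andP[+ _]; lra.
set b := nf_b F; set X := nf_X F; set c := nf_c F.
have r0 := ltW r_gt0; have T0 := ltW T_gt0.
have oU : open (cimage c) by exact: nf_open.
have U0 : cimage c 0 by exact: nf_zero.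
have XS := nf_Ck F.
have X0 := nf_X0 F; have DXh := nf_DXh F; have DXz := nf_DXz F; have DXJ := nf_DXJ F.
have [C [rho FE]] := frame_estimates oU U0 XS.
have [C0 rho0 HU _] := FE.
have [K K0 HK] := @apriori R n C T C0 T0.
have [Kx Kx0 HKx] := expansion oU U0 XS X0 DXh DXz DXJ r FE T0 (nf_b_neq0 F).
have [d0 d00 Hd] := flow_exists X0 FE T0.
(* Inverting a vertical component that is at least 1/2 doubles the constant in the estimate of [w];
   the extra 1 makes the constant positive. *)
have K2 : Kx <= 2 * Kx + 1 by lra.
have K3 u : 2^-1 <= u -> Kx <= (2 * Kx + 1) * u.
  move=> hu; apply: (@le_trans _ _ ((2 * Kx + 1) * 2^-1)); first by lra.
  by rewrite ler_wpM2l//; lra.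
have r1 : 0 < r + 1 by lra.
have K1 : 0 < K + 1 by lra.
have Kx1 : 0 < Kx + 1 by lra.
(* The four bounds give respectively [eta <= 1], confinement to the chart, an initial covector
   within reach of [flow_exists], and [Kx * eta <= 1/2], which keeps the vertical component at least
   1/2. *)
pose eta0 := Num.min (Num.min 1 (rho / ((K + 1) * (r + 1))))
  (Num.min (d0 / (r + 1)) (2 * (Kx + 1))^-1).
exists (2 * Kx + 1), eta0; split.
- by lra.
- by rewrite !lt_min ltr01 !divr_gt0 ?invr_gt0 ?mulr_gt0.
move=> eta h /andP[e0' ee] hr.
move: ee; rewrite !lt_min => /andP[/andP[e1 e2] /andP[e3 e4]].
have eta01 : 0 < eta <= 1 by rewrite e0' ltW.
have Krho : (K + 1) * (eta * (r + 1)) < rho.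
  move: e2; rewrite ltr_pdivlMr ?mulr_gt0//; lra.
have Kd0 : eta * (r + 1) <= d0 by move: e3; rewrite ltr_pdivlMr// => /ltW.
have Ke : Kx * eta <= 2^-1.
  have : eta * (2 * (Kx + 1)) < 1.
    by rewrite -ltr_pdivlMr ?mulr_gt0// mul1r.
  by move: e0'; lra.
split.
  (* The rescaled initial covector: the frame at the origin is the coordinate frame, so its
     coordinates are those of $(\eta h,1)$. *)
  pose z0 : 'rV[R]_(n.*2.+1) := dz + eta *: \sum_i h i 0 *: evec (sp i).
  have z0s i : z0 0 (sp i) = eta * h i 0.
    rewrite /z0 mx_entryD dz_sp add0r mx_entryZ summxE (bigD1 i)//= big1 ?addr0 => [|j ji].
      by rewrite !mxE !eqxx mulr1.
    by rewrite !mxE (inj_eq lift_inj) eq_sym (negbTE ji) mulr0.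
  have z0m : z0 0 ord_max = 1.
    rewrite /z0 mx_entryD dz_max mx_entryZ summxE big1 ?mulr0 ?addr0// => j _.
    by rewrite !mxE eq_sym sp_max andbF mulr0.
  have z0d : `|z0 - dz| <= d0 by rewrite (le_trans (initial_norm r0 e0' hr z0s z0m)).
  have [x [z [alpha [beta [a0 Tb x0 zz0 H]]]]] := Hd z0 z0d.
  have H' s : alpha < s < beta -> [/\ cimage c (x s),
      is_derive s 1 x (field_x X (x s) (z s)) & is_derive s 1 z (field_p X (x s) (z s))].
    move=> /H[xs zs Dx Dz]; split => //.
    by have [Ux _ _ _ _] := HU (x s) (ltW xs).
  exists (fun s => cinv c (x (eta^-1 * s))),
    (fun s d => pullback c d (eta^-1 *: z (eta^-1 * s)) (ccoord d (cinv c (x (eta^-1 * s))))).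
  split.
    exists (eta * alpha), (eta * beta); split.
    - by rewrite pmulr_rlt0.
    - by rewrite ltr_pM2l.
    - exact: (chart_extremal e0' H').
  have q00 : cinv c (x (eta^-1 * 0)) = q0.
    by rewrite mulr0 x0 -(nf_centred F); exact: ccoordK (nf_axiom F) (nf_dom F).
  split; first exact: q00.
  rewrite q00 (pullback_id _ (nf_dom F)) mulr0 zz0; split.
    by move=> i; rewrite X0 dotp_evec mx_entryZ z0s mulKf ?gt_eqF.
  by rewrite dotp_evec mx_entryZ z0m mulr1.
move=> q p ext tau tauT.
have [cq v] := extremal_valid FE T0 r0 K0 HK eta01 Krho hr ext.
split; first exact: cq.
have [/= Ex Ez Eg Ew] := HKx _ v tau tauT.
set y := ccoord c (q (eta * tau)) in Ex Ez Eg *.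
set zt := eta *: p (eta * tau) c in Eg Ew.
have e2K : Kx * eta ^+ 2 <= 2^-1.
  rewrite expr2 mulrA (le_trans _ Ke)// ler_piMr ?mulr_ge0// ltW//.
have zm : 2^-1 <= zt 0 ord_max.
  exact: half (le_trans Ew e2K).
have zm0 : 0 < zt 0 ord_max by rewrite (lt_le_trans _ zm)// invr_gt0.
exists (xpart y), (zpart y), (\col_i dotp (p (eta * tau) c) (X i y)), (zt 0 ord_max)^-1.
split.
  split => //; first by rewrite invr_eq0 gt_eqF.
  split; first by move=> i; rewrite mxE.
  by rewrite dotp_evec invrK /zt mx_entryZ mulKf ?gt_eqF.
have KC k : Kx * eta ^+ k <= (2 * Kx + 1) * eta ^+ k.
  by rewrite ler_wpM2r ?exprn_ge0 ?(ltW e0').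
have assoc (f g : R -> 'M[R]_(n.*2)) (u : R -> 'cV[R]_(n.*2)) :
   (fun s => f s *m g s *m u s) = fun s => f s *m (g s *m u s).
  by apply/funext => s; rewrite mulmxA.
split.
- apply: le_trans (KC 3%N); apply: le_trans Ex.
  by under [X in vintegral 0 tau X]eq_fun do rewrite assoc.
- exact: le_trans (KC 3%N).
- rewrite assoc; apply: le_trans (KC 2%N).
  (* The available estimate is for [eta] times the fibre coordinates, so both sides are multiplied
     by [eta]. *)
  rewrite -(ler_pM2l e0') -{1}(gtr0_norm e0') -normrZ mulrCA -exprS.
  apply: le_trans Eg; rewrite scalerBr scalerDr scalerA -expr2.
  rewrite (_ : eta *: (\col_i dotp _ _) = \col_i hfib X i y zt)//.
  by apply/colP => i; rewrite !mxE /hfib /zt [in RHS]dotpC dotpZr dotpC.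
- have -> : (zt 0 ord_max)^-1 - 1 = (1 - zt 0 ord_max) / zt 0 ord_max.
    by field; rewrite gt_eqF.
  rewrite normrM normfV (gtr0_norm zm0) ler_pdivrMr// distrC (le_trans Ew)//.
  by rewrite mulrAC ler_wpM2r ?exprn_ge0 ?(ltW e0') ?K3.
Qed.
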